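(* Let $\alpha_1,\alpha_2,\beta_1,\beta_2>0$, $\nu\in(0,1)$, let $X^\nu(t):=X^1(T^\nu(t))$ be the time-changed process described in the context, and let $p^\nu_{k,n}(t):=P(X^\nu(t)=n|X^\nu(0)=k)$, $k,n\in\mathbb{Z}$, $t\geq0$. Write $\sigma:=\alpha_1+\alpha_2+\beta_1+\beta_2$, $\kappa:=\alpha_1+\alpha_2-\beta_1-\beta_2$, $\rho:=\frac{\alpha_1\beta_1}{\alpha_2\beta_2}$, and let $\vartheta^k_{r,s}$, $\eta^k_{r,s}$ and $W_\nu(a,\omega,b;z)$ be as in the context. (i) Assume that $\alpha_1+\alpha_2\neq\beta_1+\beta_2$ and put $z_t:=\frac{[t^\nu\sigma]^2}{4}$. Then, for all $s,r\in\mathbb{Z}$: $$\begin{aligned}p^\nu_{2r,2s}(t)=\sum_{k=|s-r|}^{+\infty}\rho^{s-r}\vartheta^k_{r,s}(\alpha_1,\alpha_2,\beta_1,\beta_2)\left(\frac{\kappa}{2}\right)^{2k}\Big\{&\frac{t^{2k\nu}\kappa}{\sigma(2k+1)!}W_\nu(2k+1,0,2k\nu+1;z_t)+\frac{t^{2k\nu}}{(2k)!}W_\nu(2k+1,1,2k\nu+1;z_t)\\&-\frac{t^{(2k+1)\nu}\kappa}{2(2k+1)!}W_\nu(2k+2,1,(2k+1)\nu+1;z_t)-\frac{t^{(2k+1)\nu}\sigma}{2(2k)!}W_\nu(2k+2,2,(2k+1)\nu+1;z_t)\Big\};\end{aligned}$$ $$\begin{aligned}p^\nu_{2r,2s+1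}(t)={}&\alpha_1\sum_{k=|s-r|}^{+\infty}\rho^{s-r}\vartheta^k_{r,s}(\alpha_1,\alpha_2,\beta_1,\beta_2)\left(\frac{\kappa}{2}\right)^{2k}\Big\{\frac{t^{(2k+1)\nu}}{(2k+1)!}W_\nu(2k+2,1,(2k+1)\nu+1;z_t)-\frac{2t^{2k\nu}}{\sigma(2k+1)!}W_\nu(2k+1,0,2k\nu+1;z_t)\Big\}\\&+\alpha_2\sum_{k=|s-r+1|}^{+\infty}\rho^{s-r+1}\vartheta^k_{r,s+1}(\alpha_1,\alpha_2,\beta_1,\beta_2)\left(\frac{\kappa}{2}\right)^{2k}\Big\{\frac{t^{(2k+1)\nu}}{(2k+1)!}W_\nu(2k+2,1,(2k+1)\nu+1;z_t)-\frac{2t^{2k\nu}}{\sigma(2k+1)!}W_\nu(2k+1,0,2k\nu+1;z_t)\Big\};\end{aligned}$$ $$\begin{aligned}p^\nu_{2r+1,2s}(t)={}&\beta_2\sum_{k=|s-r|}^{+\infty}\rho^{s-r}\vartheta^k_{r,s}(\beta_1,\beta_2,\alpha_1,\alpha_2)\left(\frac{\kappa}{2}\right)^{2k}\Big\{\frac{t^{(2k+1)\nu}}{(2k+1)!}W_\nu(2k+2,1,(2k+1)\nu+1;z_t)-\frac{2t^{2k\nu}}{\sigma(2k+1)!}W_\nu(2k+1,0,2k\nu+1;z_t)\Big\}\\&+\beta_1\sum_{k=|s-r-1|}^{+\infty}\rho^{s-r-1}\vartheta^k_{r,s-1}(\beta_1,\beta_2,\alpha_1,\alpha_2)\left(\frac{\kappa}{2}\right)^{2k}\Big\{\frac{t^{(2k+1)\nu}}{(2k+1)!}W_\nu(2k+2,1,(2k+1)\nu+1;z_t)-\frac{2t^{2k\nu}}{\sigma(2k+1)!}W_\nu(2k+1,0,2k\nu+1;z_t)\Big\};\end{aligned}$$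 $$\begin{aligned}p^\nu_{2r+1,2s+1}(t)=\sum_{k=|s-r|}^{+\infty}\rho^{s-r}\vartheta^k_{r,s}(\beta_1,\beta_2,\alpha_1,\alpha_2)\left(\frac{\kappa}{2}\right)^{2k}\Big\{&-\frac{t^{2k\nu}\kappa}{\sigma(2k+1)!}W_\nu(2k+1,0,2k\nu+1;z_t)+\frac{t^{2k\nu}}{(2k)!}W_\nu(2k+1,1,2k\nu+1;z_t)\\&-\frac{t^{(2k+1)\nu}\sigma}{2(2k)!}W_\nu(2k+2,2,(2k+1)\nu+1;z_t)+\frac{t^{(2k+1)\nu}\kappa}{2(2k+1)!}W_\nu(2k+2,1,(2k+1)\nu+1;z_t)\Big\}.\end{aligned}$$ (ii) Assume that $\alpha_1+\alpha_2=\beta_1+\beta_2$ and put $w_t:=[t^\nu(\alpha_1+\alpha_2)]^2$. Then, for all $s,r\in\mathbb{Z}$: $$p^\nu_{2r,2s}(t)=\sum_{k=|s-r|}^{+\infty}\rho^{s-r}\eta^k_{r,s}(\alpha_1,\alpha_2,\beta_1,\beta_2)\Big\{\frac{t^{2k\nu}}{(2k)!}W_\nu(2k+1,1,2k\nu+1;w_t)-(\alpha_1+\alpha_2)\frac{t^{(2k+1)\nu}}{(2k)!}W_\nu(2k+2,2,(2k+1)\nu+1;w_t)\Big\};$$ $$\begin{aligned}p^\nu_{2r,2s+1}(t)={}&\alpha_1\sum_{k=|s-r|}^{+\infty}\rho^{s-r}\eta^k_{r,s}(\alpha_1,\alpha_2,\beta_1,\beta_2)\Big\{\frac{t^{(2k+1)\nu}}{(2k+1)!}W_\nu(2k+2,1,(2k+1)\nu+1;w_t)-\frac{t^{2k\nu}}{(\alpha_1+\alpha_2)(2k+1)!}W_\nu(2k+1,0,2k\nu+1;w_t)\Big\}\\&+\alpha_2\sum_{k=|s-r+1|}^{+\infty}\rho^{s-r+1}\eta^k_{r,s+1}(\alpha_1,\alpha_2,\beta_1,\beta_2)\Big\{\frac{t^{(2k+1)\nu}}{(2k+1)!}W_\nu(2k+2,1,(2k+1)\nu+1;w_t)-\frac{t^{2k\nu}}{(\alpha_1+\alpha_2)(2k+1)!}W_\nu(2k+1,0,2k\nu+1;w_t)\Big\};\end{aligned}$$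 $$\begin{aligned}p^\nu_{2r+1,2s}(t)={}&\beta_2\sum_{k=|s-r|}^{+\infty}\rho^{s-r}\eta^k_{r,s}(\beta_1,\beta_2,\alpha_1,\alpha_2)\Big\{\frac{t^{(2k+1)\nu}}{(2k+1)!}W_\nu(2k+2,1,(2k+1)\nu+1;w_t)-\frac{t^{2k\nu}}{(\alpha_1+\alpha_2)(2k+1)!}W_\nu(2k+1,0,2k\nu+1;w_t)\Big\}\\&+\beta_1\sum_{k=|s-r-1|}^{+\infty}\rho^{s-r-1}\eta^k_{r,s-1}(\beta_1,\beta_2,\alpha_1,\alpha_2)\Big\{\frac{t^{(2k+1)\nu}}{(2k+1)!}W_\nu(2k+2,1,(2k+1)\nu+1;w_t)-\frac{t^{2k\nu}}{(\alpha_1+\alpha_2)(2k+1)!}W_\nu(2k+1,0,2k\nu+1;w_t)\Big\};\end{aligned}$$ $$p^\nu_{2r+1,2s+1}(t)=\sum_{k=|s-r|}^{+\infty}\rho^{s-r}\eta^k_{r,s}(\beta_1,\beta_2,\alpha_1,\alpha_2)\Big\{\frac{t^{2k\nu}}{(2k)!}W_\nu(2k+1,1,2k\nu+1;w_t)-\frac{t^{(2k+1)\nu}(\alpha_1+\alpha_2)}{(2k)!}W_\nu(2k+2,2,(2k+1)\nu+1;w_t)\Big\}.$$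
   Context: $\{X^1(t):t\geq 0\}$ is the continuous-time Markov chain on $\mathbb{Z}$ whose state probabilities $p_{k,n}(t):=P(X^1(t)=n|X^1(0)=k)$ satisfy $p_{k,n}(0)=1_{\{k=n\}}$ and whose generator $g_{k,n}:=\lim_{t\to 0}\frac{p_{k,n}(t)-p_{k,n}(0)}{t}$ is as follows. For even $k$: $g_{k,k+1}=\alpha_1$, $g_{k,k-1}=\alpha_2$, $g_{k,k}=-(\alpha_1+\alpha_2)$. For odd $k$: $g_{k,k+1}=\beta_1$, $g_{k,k-1}=\beta_2$, $g_{k,k}=-(\beta_1+\beta_2)$. All other entries are $0$. $\{S^\nu(t):t\geq0\}$ is the $\nu$-stable subordinator, with $\mathbb{E}[e^{\gamma S^\nu(t)}]=e^{-|\gamma|^\nu t}$ for $\gamma\leq0$, and $\{T^\nu(t):t\geq0\}$ is its inverse, $T^\nu(t)=\inf\{s\geq0:S^\nu(s)>t\}$; it is independent of $X^1$, $T^\nu(0)=0$, and $\mathbb{E}[e^{\gamma T^\nu(t)}]=E_\nu(\gamma t^\nu)$, where $E_\nu(x):=\sum_{j\geq0}\frac{x^j}{\Gamma(\nu j+1)}$. Generalized Fox-Wright function: ${}_p\psi_q\left[\begin{smallmatrix}(a_l,A_l)_{1,p}\\(b_l,B_l)_{1,q}\end{smallmatrix};z\right]=\sum_{n=0}^{+\infty}\frac{z^n}{n!}\frac{\prod_{j=1}^p\Gamma(a_j+A_jn)}{\prod_{l=1}^q\Gamma(b_l+B_ln)}$, with $z,a_j,b_l\in\mathbb{C}$, $A_j,B_l\in\mathbb{R}$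 (and $1/\Gamma(x)=0$ at $x=0,-1,-2,\ldots$). We abbreviate $$W_\nu(a,\omega,b;z):={}_2\psi_2\left[\begin{smallmatrix}(a,2)&(1,1)\\(\omega,2)&(b,2\nu)\end{smallmatrix};z\right]=\sum_{n=0}^{+\infty}\frac{z^n}{n!}\frac{\Gamma(a+2n)\Gamma(1+n)}{\Gamma(\omega+2n)\Gamma(b+2\nu n)}.$$ Binomial coefficients with negative arguments are equal to zero (and $\binom{m}{l}=0$ for $l>m\geq0$, as usual). If $\alpha_1+\alpha_2\neq\beta_1+\beta_2$, $$\vartheta^n_{r,s}(\alpha_1,\alpha_2,\beta_1,\beta_2):=\left(\frac{4\alpha_2\beta_2}{(\alpha_1+\alpha_2-\beta_1-\beta_2)^2}\right)^{s-r}\sum_{h=0}^{n-s+r}\binom{n}{h+s-r}\left(\frac{4\alpha_1\beta_2}{(\alpha_1+\alpha_2-\beta_1-\beta_2)^2}\right)^{h}\sum_{l=0}^{h}\binom{h+s-r}{l}\binom{h+s-r}{h-l}\left(\frac{\alpha_2\beta_1}{\alpha_1\beta_2}\right)^{l};$$ if $\alpha_1+\alpha_2=\beta_1+\beta_2$, $$\eta^n_{r,s}(\alpha_1,\alpha_2,\beta_1,\beta_2):=\left(\frac{\alpha_2}{\alpha_1}\right)^{s-r}(\alpha_1\beta_2)^n\sum_{l=0}^{n-s+r}\binom{n}{l}\binom{n}{s-r+l}\left(\frac{\alpha_2\beta_1}{\alpha_1\beta_2}\right)^{l}.$$ $\vartheta^n_{r,s}(\beta_1,\beta_2,\alpha_1,\alpha_2)$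 and $\eta^n_{r,s}(\beta_1,\beta_2,\alpha_1,\alpha_2)$ are obtained by exchanging $\alpha_i\leftrightarrow\beta_i$, $i=1,2$. *)

(* Defs.v *)
From HB Require Import structures.
From mathcomp Require Import all_boot all_order all_algebra.
From mathcomp Require Import all_classical all_reals all_analysis.
Import Order.TTheory GRing.Theory Num.Theory.
Import numFieldNormedType.Exports.

Set Implicit Arguments.
Unset Strict Implicit.
Unset Printing Implicit Defensive.

Local Open Scope classical_set_scope.
Local Open Scope ring_scope.

(* A process indexed by [0, +oo[ is a function R -> Omega -> E; its values at
   negative times are never used. *)

Section Processes.
Context {R : realType} {d : measure_display} {Omega : measurableType d}.
Variable P : probability Omega R.

(* P (Y t = n | Y 0 = k), meaningful when P (Y 0 = k) > 0. *)
Definition state_prob (Y : R -> Omega -> int) (k n : int) (t : R) : R :=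
  fine (P ([set w | Y t w = n] `&` [set w | Y 0 w = k])) /
  fine (P [set w | Y 0 w = k]).

Definition transition_function (p : R -> int -> int -> R) : Prop :=
  [/\ forall k n, p 0 k n = (k == n)%:R,
      forall (t : R) k n, 0 <= t -> 0 <= p t k n,
      forall (t : R) k, 0 <= t -> (\esum_(n in [set: int]) (p t k n)%:E = 1)%E &
      forall (t u : R) k n, 0 <= t -> 0 <= u ->
        (\esum_(j in [set: int]) (p t k j * p u j n)%:E = (p (t + u) k n)%:E)%E].

(* The Markov property is written multiplicatively, so that it makes sense for
   every initial law; given a history {X (u i) = x i, i < m} and X t = k, the
   conditional law of X (t + h) is p h k. *)
Definition homogeneous_markov (X : R -> Omega -> int)
    (p : R -> int -> int -> R) : Prop :=
  forall (m : nat) (u : 'I_m -> R) (x : 'I_m -> int) (t h : R) (k n : int),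
    (forall i, 0 <= u i <= t) -> 0 <= t -> 0 <= h ->
    let past := [set w | (forall i, X (u i) w = x i) /\ X t w = k] in
    P (past `&` [set w | X (t + h) w = n]) = (P past * (p h k n)%:E)%E.

(* Right-continuity of the paths in the discrete space int makes X piecewise
   constant, and is what makes a random time change of X well defined. *)
Definition markov_chain_with_generator (X : R -> Omega -> int)
    (g : int -> int -> R) : Prop :=
  [/\ forall (t : R) n, 0 <= t -> measurable [set w | X t w = n],
      forall w (t : R), 0 <= t -> \forall u \near t^'+, X u w = X t w &
      exists p : R -> int -> int -> R,
        [/\ transition_function p, homogeneous_markov X p &
            forall k n,
              (fun t => (p t k n - p 0 k n) / t) @ 0^'+ --> g k n]].

(* Independent increments, over an arbitrary finite sequence of times. *)
Definition independent_increments (S : R -> Omega -> R) : Prop :=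
  forall (m : nat) (u : nat -> R) (B : nat -> set R),
    0 <= u 0%N -> nondecreasing_seq u -> (forall i, measurable (B i)) ->
    P [set w | forall i, (i < m)%N -> B i (S (u i.+1) w - S (u i) w)] =
    (\prod_(i < m) P [set w | B i (S (u i.+1) w - S (u i) w)%R])%E.

Definition stationary_increments (S : R -> Omega -> R) : Prop :=
  forall (t h : R) (B : set R), 0 <= t -> 0 <= h -> measurable B ->
    P [set w | B (S (t + h) w - S t w)] = P [set w | B (S h w)].

Definition subordinator (S : R -> Omega -> R) : Prop :=
  [/\ forall t : R, 0 <= t -> measurable_fun [set: Omega] (S t),
      forall w, S 0 w = 0,
      forall w (t u : R), 0 <= t -> t <= u -> S t w <= S u w,
      forall w (t : R), 0 <= t -> (S ^~ w) @ t^'+ --> S t w &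
      independent_increments S /\ stationary_increments S].

Definition stable_subordinator (nu : R) (S : R -> Omega -> R) : Prop :=
  subordinator S /\
  forall gamma t : R, gamma <= 0 -> 0 <= t ->
    ('E_P[fun w => expR (gamma * S t w)%R] =
     (expR (- (`|gamma| `^ nu * t)))%:E)%E.

(* For a stable subordinator the set below is almost surely nonempty; on the
   exceptional event the library's convention is inf set0 = 0. *)
Definition inverse_process (S : R -> Omega -> R) (t : R) (w : Omega) : R :=
  inf [set s | 0 <= s /\ t < S s w].

Definition time_change (X : R -> Omega -> int) (T : R -> Omega -> R)
    (t : R) (w : Omega) : int := X (T t w) w.

(* Independence of the sigma-algebras generated by X and by T, expressed on the
   finite-dimensional events, which are generating pi-systems. *)
Definition independent_processes (X : R -> Omega -> int)
    (T : R -> Omega -> R) : Prop :=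
  forall (m : nat) (u : 'I_m -> R) (x : 'I_m -> int)
         (l : nat) (v : 'I_l -> R) (B : 'I_l -> set R),
    (forall i, 0 <= u i) -> (forall j, 0 <= v j) ->
    (forall j, measurable (B j)) ->
    let EX := [set w | forall i, X (u i) w = x i] in
    let ET := [set w | forall j, B j (T (v j) w)] in
    P (EX `&` ET) = (P EX * P ET)%E.

End Processes.

Section Formulas.
Context {R : realType}.

Definition generator (alpha1 alpha2 beta1 beta2 : R) (k n : int) : R :=
  let up := if (2 %| k)%Z then alpha1 else beta1 in
  let down := if (2 %| k)%Z then alpha2 else beta2 in
  if n == k + 1 then up
  else if n == k - 1 then down
  else if n == k then - (up + down)
  else 0.

Definition has_sum_from (m : nat) (f : nat -> R) (l : R) : Prop :=
  (fun n => \sum_(m <= k < n) f k) @ \oo --> l.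

Definition Gamma_integral (x : R) : R :=
  \int[lebesgue_measure]_(u in `]0, +oo[) (u `^ (x - 1) * expR (- u)).

(* Euler's integral for x > 0, extended to x <= 0 by Gamma (x + 1) = x Gamma x.
   At the poles 0, -1, -2, ... a factor of the product vanishes, so that
   Gamma x = 0 and, division by 0 being 0, also 1 / Gamma x = 0. *)
Definition Gamma (x : R) : R :=
  let n := if 0 < x then 0%N else `|Num.floor x|%N.+1 in
  Gamma_integral (x + n%:R) / \prod_(i < n) (x + i%:R).

(* The parameters (a_l, A_l) and (b_l, B_l) are given as sequences of pairs. *)
Definition fox_wright (aA bB : seq (R * R)) (z : R) : R :=
  limn (fun N => \sum_(0 <= n < N)
    (z ^+ n / n`!%:R *
     (\prod_(c <- aA) Gamma (c.1 + c.2 * n%:R) /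
      \prod_(c <- bB) Gamma (c.1 + c.2 * n%:R)))).

Definition W (nu a omega b z : R) : R :=
  fox_wright [:: (a, 2); (1, 1)] [:: (omega, 2); (b, 2 * nu)] z.

Definition binZ (m l : int) : R :=
  if (0 <= m) && (0 <= l) then 'C(`|m|%N, `|l|%N)%:R else 0.

(* The outer sum in theta_coef and the sum in eta_coef end at n - s + r, and are
   empty when this bound is negative. *)
Definition theta_coef (n : nat) (r s : int) (alpha1 alpha2 beta1 beta2 : R) : R :=
  let kappa2 := (alpha1 + alpha2 - beta1 - beta2) ^+ 2 in
  (4 * alpha2 * beta2 / kappa2) ^ (s - r) *
  \sum_(h < (absz (n%:Z - s + r)%R).+1 | (h%:Z <= n%:Z - s + r)%R)
    (binZ n%:Z (h%:Z + s - r) * (4 * alpha1 * beta2 / kappa2) ^+ h *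
     \sum_(l < h.+1)
       (binZ (h%:Z + s - r) l%:Z * binZ (h%:Z + s - r) (h%:Z - l%:Z) *
        ((alpha2 * beta1) / (alpha1 * beta2)) ^+ l)).

Definition eta_coef (n : nat) (r s : int) (alpha1 alpha2 beta1 beta2 : R) : R :=
  (alpha2 / alpha1) ^ (s - r) * (alpha1 * beta2) ^+ n *
  \sum_(l < (absz (n%:Z - s + r)%R).+1 | (l%:Z <= n%:Z - s + r)%R)
    (binZ n%:Z l%:Z * binZ n%:Z (s - r + l%:Z) *
     ((alpha2 * beta1) / (alpha1 * beta2)) ^+ l).

End Formulas.

(* Main.v *)
(** The generator G of the chain is bounded, so with s = (alpha1 + alpha2 + beta1 +
    beta2) / 2 and A = G + s the transition probabilities are given by
    exp (s t) p_{k,n}(t) = sum_i (t^i / i!) (A^i delta_n)(k). The shift by s makes A^2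
    translation invariant on the even and on the odd integers: it jumps by 2, -2 and 0
    with weights alpha1 beta1, alpha2 beta2 and kappa^2 / 4 + alpha1 beta2 + alpha2 beta1.
    So A^(2k) is given by the coefficients of the k-th power of one Laurent polynomial;
    since alpha1 beta1 + (alpha1 beta2 + alpha2 beta1) x + alpha2 beta2 x^2 factors as
    (alpha1 + alpha2 x) (beta1 + beta2 x), these are the sums theta (expanding around
    kappa^2 x / 4) and eta (kappa = 0).

    Since T is independent of X^1 and X^1 is right-continuous, p^nu_{k,n}(t) is the
    expectation of p_{k,n}(T t). The coefficients of index k are bounded by s^(2k), which
    allows integration of the double series term by term, and it remains to compute
    E [exp (- s T) T^i / i!] by expanding the exponential: splitting even and odd powers
    of s gives the two functions W. The moments E [T^m] = m! t^(m nu) / Gamma (m nu + 1)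
    follow from the self-similarity of S, which makes T t equal in law to
    (t / S 1)^nu. *)
Require Import Defs.
From HB Require Import structures.
From mathcomp Require Import all_boot all_order all_algebra.
From mathcomp Require Import all_classical all_reals all_analysis.
From mathcomp Require Import measurable_realfun.
From mathcomp Require Import zify ring lra.
Import Order.TTheory GRing.Theory Num.Theory.
Import numFieldNormedType.Exports.

Set Implicit Arguments.
Unset Strict Implicit.
Unset Printing Implicit Defensive.

Local Open Scope classical_set_scope.
Local Open Scope ring_scope.

(** Of p only the derivatives at time 0 are given, so differentiability at positive times has to be
    extracted from the Chapman-Kolmogorov identity; a Taylor remainder that is uniform in the state
    then takes the place of a uniqueness theorem for the backward equation. The shift s is chosen
    because it makes the diagonal entries of A equal to - kappa / 2 on even and kappa / 2 on odd
    states: being opposite, they cancel the nearest-neighbour part of A^2. The weights of A^2 are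
    nonnegative with sum s^2, whence the bound s^(2k), and majorants of the form exp (K T), whence
    the need for all exponential moments of T. Of S only the Laplace transform is given, so the
    self-similarity rests on a uniqueness argument: step functions are limits of polynomials in
    exponentials. Finally [Gamma] and [W] are total functions, the [fine] part of an integral and a
    bare limit. Finiteness and positivity of Gamma (m nu + 1) follow from E [(S 1)^(- m nu)] Gamma
    (m nu + 1) = m!, whose right side is neither 0 nor infinite, and the values of W are read off
    from series of moments already known to converge. *)

(** * Taylor expansion for linear systems with nearest-neighbour coupling *)

Section TaylorExpansion.
Context {R : realType}.
Implicit Types (f df : R -> R) (d u l : int -> R).

Lemma norm_le_pow_fact f df (tau M : R) (m : nat) :
  f 0 = 0 -> f x @[x --> 0^'+] --> 0 ->
  (forall t : R, 0 < t -> is_derive t (1 : R) f (df t)) ->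
  (forall t : R, 0 < t <= tau -> `|df t| <= M * (t ^+ m / m`!%:R)) ->
  forall t : R, 0 <= t <= tau -> `|f t| <= M * (t ^+ m.+1 / m.+1`!%:R).
Proof.
move=> f0 cf0 Df Bdf t /andP[t0 ttau].
move: t0; rewrite le_eqVlt => /predU1P[<-|t0].
  by rewrite f0 normr0 expr0n/= mul0r mulr0.
(* The sign [s] gives both halves of the absolute value from one use of the mean value theorem, for
   [c * x ^+ m.+1 - s * f x], whose derivative is nonnegative on the interval. *)
have key (s : R) : `|s| = 1 -> s * f t <= M * (t ^+ m.+1 / m.+1`!%:R).
  move=> hs.
  pose c : R := M / m.+1`!%:R.
  pose g : R -> R := c *: ((@id R) ^+ m.+1) - s *: f.
  have gE x : g x = c * x ^+ m.+1 - s * f x by rewrite /g !fctE.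
  have Dg (x : R) : 0 < x -> 
      is_derive x (1 : R) g (M * (x ^+ m / m`!%:R) - s * df x).
    move=> x0; have := Df x x0 => Dfx.
    apply: is_derive_eq; rewrite /GRing.scale/= mulr1 /c factS natrM.
    have h1 : (m`!%:R : R) != 0 by rewrite pnatr_eq0 -lt0n fact_gt0.
    have h2 : (m.+1%:R : R) != 0 by rewrite pnatr_eq0.
    by field; rewrite h1 nat1r h2.
  have cg : {within `[0, t], continuous g}.
    apply/(continuous_within_itvP _ t0); split.
    - move=> x; rewrite in_itv/= => /andP[x0 _]; have := Dg x x0 => Dgx.
      by apply/differentiable_continuous/derivable1_diffP.
    - rewrite gE f0 expr0n/= mulr0 mulr0.
      rewrite (_ : g = fun x => c * x ^+ m.+1 - s * f x); last exact/funext.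
      apply: cvgB; last by rewrite -[X in _ --> X](mulr0 s); apply: cvgMr.
      rewrite -[X in _ --> X](mulr0 c); apply: cvgMr.
      have := @exprn_continuous R m.+1 0; rewrite /continuous_at/= expr0n/=.
      exact: cvg_at_right_filter.
    - apply: cvg_at_left_filter.
      have := Dg t t0 => Dgx.
      by apply/differentiable_continuous/derivable1_diffP.
  have Dg' (x : R) : x \in `]0, t[ ->
      is_derive x (1 : R) g (M * (x ^+ m / m`!%:R) - s * df x).
    by rewrite in_itv/= => /andP[x0 _]; exact: Dg.
  have [x xt] := MVT t0 Dg' cg.
  rewrite !gE f0 expr0n/= !mulr0 !subr0 => E.
  have -> : M * (t ^+ m.+1 / m.+1`!%:R) = c * t ^+ m.+1 by rewrite /c mulrA mulrAC.
  rewrite -subr_ge0.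
  rewrite E mulr_ge0 ?(ltW t0)// subr_ge0.
  apply: le_trans (Bdf x _); last first.
    by move: xt; rewrite in_itv/= => /andP[-> /ltW xt]; rewrite (le_trans xt).
  by rewrite (le_trans (ler_norm _))// normrM hs mul1r.
rewrite ler_norml -[X in X && _]lerN2 opprK.
by rewrite -mulN1r key ?normrN1// -[f t]mul1r key ?normr1.
Qed.


Lemma is_derive_pow_fact_sum (c : nat -> R) (m : nat) (t : R) :
  is_derive t (1 : R) (fun x : R => \sum_(i < m.+1) c i * (x ^+ i / i`!%:R))
    (\sum_(i < m) c i.+1 * (t ^+ i / i`!%:R)).
Proof.
elim: m => [|m IH].
  rewrite big_ord0 (_ : (fun _ => _) = cst (c 0%N)); first exact: is_derive_cst.
  by apply/funext => x; rewrite big_ord_recl big_ord0 expr0 fact0 divr1 mulr1 addr0.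
rewrite (_ : (fun _ => _) = (fun x : R => \sum_(i < m.+1) c i * (x ^+ i / i`!%:R))
    + (c m.+1 / m.+1`!%:R) *: (@id R) ^+ m.+1); last first.
  apply/funext => x; rewrite !fctE big_ord_recr/=; congr (_ + _).
  by rewrite /GRing.scale/= mulrA mulrAC.
have DX : is_derive t (1 : R) ((c m.+1 / m.+1`!%:R) *: (@id R) ^+ m.+1)
    (c m.+1 / m.+1`!%:R * (m.+1%:R * t ^+ m)).
  by apply: is_derive_eq; rewrite /GRing.scale/= mulr1.
apply: (is_derive_eq (is_deriveD IH DX)).
rewrite [in RHS]big_ord_recr/=; congr (_ + _).
rewrite factS natrM.
have h1 : (m`!%:R : R) != 0 by rewrite pnatr_eq0 -lt0n fact_gt0.
have h2 : (m.+1%:R : R) != 0 by rewrite pnatr_eq0.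
by field; rewrite h1 nat1r h2.
Qed.

(** A tridiagonal matrix acting on functions of the starting state: this is the side on which the
    generator acts in the backward equation, the target state being a parameter. *)
Definition nbr_op d u l (f : int -> R) (k : int) : R :=
  d k * f k + u k * f (k + 1) + l k * f (k - 1).

Lemma nbr_op_sum d u l (f : nat -> int -> R) (c : nat -> R) (m : nat) k :
  nbr_op d u l (fun j => \sum_(i < m) f i j * c i) k =
  \sum_(i < m) nbr_op d u l (f i) k * c i.
Proof.
rewrite /nbr_op !mulr_sumr -!big_split/=; apply: eq_bigr => i _.
by rewrite !mulrA !mulrDl.
Qed.

Lemma nbr_opB d u l (f g : int -> R) k :
  nbr_op d u l (fun j => f j - g j) k = nbr_op d u l f k - nbr_op d u l g k.
Proof. by rewrite /nbr_op; ring. Qed.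

Lemma nbr_op_bound d u l (f : int -> R) (K B : R) k :
  `|d k| + `|u k| + `|l k| <= K -> (forall j, `|f j| <= B) ->
  `|nbr_op d u l f k| <= K * B.
Proof.
move=> hK fB; rewrite /nbr_op.
have B0 : 0 <= B by rewrite (le_trans _ (fB k)).
apply: (@le_trans _ _ ((`|d k| + `|u k| + `|l k|) * B)); last exact: ler_wpM2r.
rewrite (le_trans (ler_normD _ _))// mulrDl lerD//.
  rewrite (le_trans (ler_normD _ _))// mulrDl lerD// normrM ler_wpM2l//.
by rewrite normrM ler_wpM2l.
Qed.

(** The derivative of the remainder of order m + 1 is [nbr_op] applied to the remainder of order m,
    so each integration gains a factor K and one more power of t over its factorial. The bound must
    be uniform in k because [nbr_op] mixes neighbouring states. *)
Lemma taylor_nbr_op (F : int -> R -> R) d u l (K B tau : R) :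
  0 <= B -> 
  (forall k, `|d k| + `|u k| + `|l k| <= K) ->
  (forall k (t : R), 0 < t ->
     is_derive t (1 : R) (F k) (nbr_op d u l (F ^~ t) k)) ->
  (forall k, F k x @[x --> 0^'+] --> F k 0) ->
  (forall k t, 0 <= t <= tau -> `|F k t| <= B) ->
  forall m k t, 0 <= t <= tau ->
  `|F k t - \sum_(i < m) iter i (nbr_op d u l) (F ^~ 0) k * (t ^+ i / i`!%:R)|
  <= B * K ^+ m * (t ^+ m / m`!%:R).
Proof.
move=> B0 hK DF cF FB; have K0 : 0 <= K by apply: le_trans (hK 0); rewrite !addr_ge0.
elim => [|m IH] k t ht.
  by rewrite big_ord0 subr0 expr0 fact0 divr1 !mulr1 FB.
set c := fun k i => iter i (nbr_op d u l) (F ^~ 0) k.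
pose S k x : R := \sum_(i < m.+1) c k i * (x ^+ i / i`!%:R).
have S0 : S k 0 = F k 0.
  rewrite /S big_ord_recl/= expr0 fact0 divr1 mulr1 big1 ?addr0// => i _.
  by rewrite expr0n/= mul0r mulr0.
have := @norm_le_pow_fact (F k - S k)
  (fun t => nbr_op d u l (fun j => F j t - \sum_(i < m) c j i * (t ^+ i / i`!%:R)) k)
  tau (B * K ^+ m.+1) m; apply => //.
- by rewrite !fctE S0 subrr.
- have cS : S k x @[x --> 0^'+] --> S k 0.
    apply: cvg_at_right_filter.
    have h := is_derive_pow_fact_sum (c k) m 0.
    apply/differentiable_continuous/derivable1_diffP.
    exact: (@ex_derive _ _ _ _ _ _ _ h).
  suff : (F k - S k) x @[x --> 0^'+] --> F k 0 - S k 0 by rewrite S0 subrr.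
  exact: cvgB (cF k) cS.
- move=> x x0; have h1 := DF k x x0; have h2 := is_derive_pow_fact_sum (c k) m x.
  rewrite nbr_opB.
  have -> : nbr_op d u l (fun j => \sum_(i < m) c j i * (x ^+ i / i`!%:R)) k =
      \sum_(i < m) c k i.+1 * (x ^+ i / i`!%:R).
    exact: (nbr_op_sum d u l (fun i j => c j i) (fun i => x ^+ i / i`!%:R)).
  exact: is_deriveB.
- move=> x /andP[x0 xtau].
  rewrite exprS (mulrCA B) -!(mulrA K).
  apply: nbr_op_bound => // j.
  by apply: IH; rewrite (ltW x0).
Qed.

(** The remainder is B times a term of the series of exp (K t). The bound B may depend on the time
    horizon, since the functions of interest carry an exponential factor. *)
Lemma taylor_nbr_op_cvg (F : int -> R -> R) d u l (K : R) :
  (forall k, `|d k| + `|u k| + `|l k| <= K) ->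
  (forall k (t : R), 0 < t ->
     is_derive t (1 : R) (F k) (nbr_op d u l (F ^~ t) k)) ->
  (forall k, F k x @[x --> 0^'+] --> F k 0) ->
  (forall tau, exists2 B, 0 <= B & forall k t, 0 <= t <= tau -> `|F k t| <= B) ->
  forall k t, 0 <= t ->
  (fun m => \sum_(i < m) iter i (nbr_op d u l) (F ^~ 0) k * (t ^+ i / i`!%:R))
     @ \oo --> F k t.
Proof.
move=> hK DF cF FB k t t0; have [B B0 {}FB] := FB t.
have := @taylor_nbr_op F d u l K B t B0 hK DF cF FB.
move=> /(_ _ k t) h.
apply/cvgrPdist_le => e e0.
have /cvgrPdist_le/(_ e e0) : (fun m => B * exp_coeff (K * t) m) @ \oo --> 0.
  rewrite -[X in _ --> X](mulr0 B); apply: cvgMr.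
  exact/cvg_series_cvg_0/is_cvg_series_exp_coeff.
apply: filterS => m; rewrite sub0r normrN => hm.
apply: le_trans (h m _) _; first by rewrite t0 lexx.
apply: le_trans hm; apply: le_trans (ler_norm _).
have -> // : B * K ^+ m * (t ^+ m / m`!%:R) = B * exp_coeff (K * t) m.
by rewrite exp_coeffE/= exprMn; ring.
Qed.
End TaylorExpansion.

(** * Kolmogorov's backward equation from the rates at time 0 *)

Section BackwardEquation.
Context {R : realType}.
Variables (up down : int -> R) (p : R -> int -> int -> R).
Hypothesis tf : transition_function p.
Hypothesis stay_rate : forall k,
  (fun t => (p t k k - 1) / t) @ 0^'+ --> - (up k + down k).
Hypothesis up_rate : forall k, (fun t => p t k (k + 1) / t) @ 0^'+ --> up k.
Hypothesis down_rate : forall k, (fun t => p t k (k - 1) / t) @ 0^'+ --> down k.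

Lemma esum_int_nbrs (f : int -> R) (k : int) (s : R) : (forall j, 0 <= f j) ->
  (\esum_(j in [set: int]) (f j)%:E = s%:E)%E ->
  (\esum_(j in ~` [set k; (k + 1)%R; (k - 1)%R]) (f j)%:E =
   (s - (f k + f (k + 1) + f (k - 1)))%R%:E)%E.
Proof.
move=> f0; have f0' A i : A i -> (0 <= (f i)%:E)%E by rewrite lee_fin.
rewrite (esumID [set k; k + 1; k - 1])//; last by move=> i; exact: f0'.
rewrite !setTI esum_fset//; last first.
  by move=> i _; rewrite lee_fin.
rewrite (_ : \sum_(i \in [set k; (k + 1)%R; (k - 1)%R]) (f i)%:E =
   (f k + f (k + 1) + f (k - 1))%R%:E)%E; last first.
  rewrite fsbigU0//=; last first.
    by move=> x [[->|->] h]; move: h => /=; lia.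
  rewrite fsbigU0//=; last first.
    by move=> x [-> h]; move: h => /=; lia.
  by rewrite !fsbig_set1.
move=> h; rewrite EFinB -h. by rewrite addeAC subee ?add0e.
Qed.

Let p_ge0 t k n : 0 <= t -> 0 <= p t k n. Proof. by case: tf => _ h _ _; exact: h. Qed.

Lemma transition_le1 t k n : 0 <= t -> p t k n <= 1.
Proof.
move=> t0; case: tf => _ _ h _; rewrite -lee_fin -(h t k t0).
rewrite -(@esum_set1 _ _ n (fun n => (p t k n)%:E)) ?lee_fin ?p_ge0//.
rewrite [leRHS](esumID [set n])//; last by move=> i _; rewrite lee_fin p_ge0.
by rewrite setTI leeDl// esum_ge0// => i _; rewrite lee_fin p_ge0.
Qed.

(** What remains of the Chapman-Kolmogorov sum after removing the three nearest states is a sum over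
    far states; as p is at most 1, it is dominated by the probability of reaching a far state in
    time h. *)
Lemma transition_nbrs_bound (h t : R) k n : 0 <= h -> 0 <= t ->
  0 <= p (h + t) k n - (p h k k * p t k n + p h k (k + 1) * p t (k + 1) n
     + p h k (k - 1) * p t (k - 1) n)
  <= 1 - (p h k k + p h k (k + 1) + p h k (k - 1)).
Proof.
move=> h0 t0; case: (tf) => _ _ hs hck.
have pp0 j : 0 <= p h k j * p t j n by rewrite mulr_ge0// p_ge0.
have E1 := esum_int_nbrs k pp0 (hck h t k n h0 t0).
have E2 := esum_int_nbrs k (fun j => p_ge0 k j h0) (hs h k h0).
rewrite -!lee_fin -E1 -E2; apply/andP; split.
  by apply: esum_ge0 => j _; rewrite lee_fin.
apply: le_esum => j _; rewrite lee_fin -[leRHS]mulr1.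
by rewrite ler_wpM2l ?p_ge0 ?transition_le1.
Qed.

Let gen (f : int -> R) k := nbr_op (fun k => - (up k + down k)) up down f k.

Let err k (h : R) : R := `|(p h k k - 1) / h + (up k + down k)| +
  `|p h k (k + 1) / h - up k| + `|p h k (k - 1) / h - down k|.

Let cvg_err k : err k h @[h --> 0^'+] --> 0.
Proof.
rewrite [X in _ --> X](_ : 0 = `|- (up k + down k) + (up k + down k)| + `|up k - up k|
  + `|down k - down k| :> R); last by rewrite addNr !subrr normr0 !addr0.
apply: cvgD; first apply: cvgD.
- apply: cvg_norm; apply: cvgD; [exact: stay_rate|exact: cvg_cst].
- apply: cvg_norm; apply: cvgB; [exact: up_rate|exact: cvg_cst].
- apply: cvg_norm; apply: cvgB; [exact: down_rate|exact: cvg_cst].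
Qed.

(* Up to the replacement of difference quotients by rates, the remainder is the
   contribution of the jumps outside the nearest neighbours; their probability is
   o(h) because the limiting rates out of k sum to 0. *)
Let increment_bound (t h : R) k n : 0 <= t -> 0 < h ->
  `|p (t + h) k n - p t k n - h * gen (p t ^~ n) k| <= 2 * h * err k h.
Proof.
move=> t0 h0; have /andP[b1 b2] := transition_nbrs_bound k n (ltW h0) t0.
set r := _ - _ in b1 b2.
set A := (p h k k - 1) / h + (up k + down k).
set B := p h k (k + 1) / h - up k.
set C := p h k (k - 1) / h - down k.
have h1 : h != 0 by rewrite gt_eqF.
have rle : r <= h * err k h.
  apply: (le_trans b2).
  have -> : 1 - (p h k k + p h k (k + 1) + p h k (k - 1)) = - h * (A + B + C).
    by rewrite /A /B /C; field.
  rewrite mulNr -mulrN ler_wpM2l ?(ltW h0)//.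
  rewrite (le_trans (ler_norm _))// normrN /err -/A -/B -/C.
  rewrite (le_trans (ler_normD _ _))// lerD2r; exact: ler_normD.
have -> : p (t + h) k n - p t k n - h * gen (p t ^~ n) k =
   r + h * (A * p t k n + B * p t (k + 1) n + C * p t (k - 1) n).
  by rewrite /r /gen /nbr_op /A /B /C (addrC t h); field.
rewrite (le_trans (ler_normD _ _))// ger0_norm//.
rewrite (_ : 2 * h * err k h = h * err k h + h * err k h); last by ring.
rewrite lerD// normrM (gtr0_norm h0) ler_wpM2l ?(ltW h0)//.
have le1 X j : `|X * p t j n| <= `|X|.
  by rewrite normrM ler_piMr// ger0_norm ?p_ge0 ?transition_le1.
by rewrite /err (le_trans (ler_normD _ _))// lerD// (le_trans (ler_normD _ _))// lerD.
Qed.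

Let gen_bound t k n : 0 <= t -> `|gen (p t ^~ n) k| <= 2 * (`|up k| + `|down k|).
Proof.
move=> t0; rewrite -[leRHS]mulr1; apply: nbr_op_bound.
  by rewrite normrN mulrDl mul1r -addrA lerD2r ler_normD.
by move=> j; rewrite ger0_norm ?p_ge0 ?transition_le1.
Qed.

(** A modulus of continuity that depends on neither t nor the target, so that it can be used at a
    base point moving with h. *)
Let lip k (h : R) : R := 2 * h * err k h + h * (2 * (`|up k| + `|down k|)).

Let cvg_id0 : (h : R) @[h --> 0^'+] --> (0 : R).
Proof. by apply: cvg_at_right_filter; exact: cvg_id. Qed.

Let cvg_lip k : lip k h @[h --> 0^'+] --> 0.
Proof.
rewrite /lip -[X in _ --> X](_ : 2 * 0 * 0 + 0 * (2 * (`|up k| + `|down k|)) = _); last first.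
  by rewrite mulr0 !mul0r addr0.
apply: cvgD; last by apply: cvgMl; exact: cvg_id0.
by apply: cvgM; [apply: cvgMr; exact: cvg_id0|exact: cvg_err].
Qed.

Let lip_bound (t h : R) k n : 0 <= t -> 0 < h ->
  `|p (t + h) k n - p t k n| <= lip k h.
Proof.
move=> t0 h0.
rewrite -[X in `|X|](subrK (h * gen (p t ^~ n) k)) (le_trans (ler_normD _ _))//.
rewrite /lip lerD ?increment_bound//.
by rewrite normrM (gtr0_norm h0) ler_wpM2l ?(ltW h0)// gen_bound.
Qed.

Lemma transition_cvg_at_right0 k n : p t k n @[t --> 0^'+] --> p 0 k n.
Proof.
apply/cvgrPdist_le => e e0.
have /cvgrPdist_le/(_ e e0) := cvg_lip k.
apply: filterS2 (nbhs_right_gt 0) => h h0; rewrite sub0r normrN => hl.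
rewrite distrC (le_trans _ (le_trans (ler_norm _) hl))//.
by rewrite -{1}[h]add0r lip_bound.
Qed.

Lemma backward_equation k n (t : R) : 0 < t ->
  is_derive t (1 : R) (fun u => p u k n)
    (nbr_op (fun k => - (up k + down k)) up down (p t ^~ n) k).
Proof.
move=> t0.
suff H : h^-1 *: (p (h *: 1 + t) k n - p t k n) @[h --> 0^'] --> gen (p t ^~ n) k.
  have D : derivable (fun u => p u k n) t 1 by apply/cvg_ex; exists (gen (p t ^~ n) k).
  by split => //; apply: (cvg_lim _ H) => //; exact: norm_hausdorff.
apply: (@cvg_at_right_left_dnbhs _ R^o).
- apply/cvgrPdist_le => e e0.
  have : (2 * err k h) @[h --> 0^'+] --> (2 * 0 : R) by apply: cvgMr; exact: cvg_err.
  rewrite mulr0 => /cvgrPdist_le/(_ e e0).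
  apply: filterS2 (nbhs_right_gt 0) => h h0; rewrite sub0r normrN => hl.
  rewrite distrC (le_trans _ (le_trans (ler_norm _) hl))//.
  have := increment_bound k n (ltW t0) h0.
  rewrite /GRing.scale/= mulr1 (addrC h t).
  rewrite -(ler_pM2l (x := h^-1)) ?invr_gt0// -{1}(gtr0_norm (x := h^-1)) ?invr_gt0//.
  rewrite -normrM mulrBr mulKf ?gt_eqF//.
  by rewrite (mulrC 2) -mulrA mulKf ?gt_eqF.
(* In the left quotient the base point t - h moves with h: the increment bound is applied there, and
   the generator term is carried from t - h to t by [lip] at k and its two neighbours. *)
apply/cvg_at_leftNP; rewrite oppr0; apply/cvgrPdist_le => e e0.
pose bnd h := 2 * err k h + (`|up k + down k| * lip k h +
   `|up k| * lip (k + 1) h + `|down k| * lip (k - 1) h).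
have : bnd h @[h --> 0^'+] --> (2 * 0 + (`|up k + down k| * 0 + `|up k| * 0 + `|down k| * 0) : R).
  apply: cvgD; first by apply: cvgMr; exact: cvg_err.
  apply: cvgD; last by apply: cvgMr; exact: cvg_lip.
  by apply: cvgD; apply: cvgMr; exact: cvg_lip.
rewrite !mulr0 !addr0 => /cvgrPdist_le/(_ e e0).
apply: filterS3 (nbhs_right_gt 0) (nbhs_right_lt t0) => h h0 ht; rewrite sub0r normrN => hl.
have th0 : 0 <= t - h by rewrite subr_ge0 ltW.
have hn0 : h != 0 by rewrite gt_eqF.
rewrite /= (le_trans _ (le_trans (ler_norm _) hl))//.
rewrite /GRing.scale/= mulr1 (addrC (- h) t).
have -> : gen (p t ^~ n) k - (- h)^-1 * (p (t - h) k n - p t k n) =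
  - (h^-1 * (p (t - h + h) k n - p (t - h) k n - h * gen (p (t - h) ^~ n) k)) +
  nbr_op (fun k => - (up k + down k)) up down (fun j => p (t - h + h) j n - p (t - h) j n) k.
  by rewrite subrK /gen /nbr_op; field.
rewrite (le_trans (ler_normD _ _))// /bnd lerD//.
  rewrite normrN normrM (gtr0_norm (x := h^-1)) ?invr_gt0//.
  rewrite -(ler_pM2l h0) mulVKf//.
  by rewrite (_ : h * (2 * err k h) = 2 * h * err k h) ?increment_bound//; ring.
rewrite /nbr_op (le_trans (ler_normD _ _))// lerD//; last first.
  by rewrite normrM ler_wpM2l// lip_bound.
rewrite (le_trans (ler_normD _ _))// lerD// normrM ?normrN ler_wpM2l// lip_bound//.
Qed.

End BackwardEquation.

(** * Exponential series of the two-periodic chain *)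

Section TwoPeriodicChain.
Context {R : realType}.
Variables (a1 a2 b1 b2 : R).

Definition up_rate (k : int) : R := if (2 %| k)%Z then a1 else b1.
Definition down_rate (k : int) : R := if (2 %| k)%Z then a2 else b2.

Definition centered_generator : (int -> R) -> int -> R :=
  nbr_op (fun k => (a1 + a2 + b1 + b2) / 2 - (up_rate k + down_rate k))
    up_rate down_rate.

Variable p : R -> int -> int -> R.
Hypothesis tf : transition_function p.
Hypothesis rates : forall k n,
  (fun t => (p t k n - p 0 k n) / t) @ 0^'+ --> generator a1 a2 b1 b2 k n.

Let p0 k n : p 0 k n = (k == n)%:R. Proof. by case: tf. Qed.

Let stayP k : (fun t => (p t k k - 1) / t) @ 0^'+ --> - (up_rate k + down_rate k).
Proof.
have := @rates k k; rewrite p0 eqxx /generator.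
have -> : (k == k + 1) = false by apply/eqP; lia.
have -> : (k == k - 1) = false by apply/eqP; lia.
by rewrite eqxx.
Qed.

Let upP k : (fun t => p t k (k + 1) / t) @ 0^'+ --> up_rate k.
Proof.
have := @rates k (k + 1); rewrite p0 /generator eqxx.
have -> : (k == k + 1) = false by apply/eqP; lia.
under eq_fun do rewrite mulr0n subr0.
by rewrite ?eqxx.
Qed.

Let downP k : (fun t => p t k (k - 1) / t) @ 0^'+ --> down_rate k.
Proof.
have := @rates k (k - 1); rewrite p0 /generator eqxx.
have -> : (k == k - 1) = false by apply/eqP; lia.
have -> : (k - 1 == k + 1) = false by apply/eqP; lia.
under eq_fun do rewrite mulr0n subr0.
by rewrite ?eqxx.
Qed.

Lemma transition_right_continuous k n (t : R) : 0 <= t ->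
  p u k n @[u --> t^'+] --> p t k n.
Proof.
rewrite le_eqVlt => /predU1P[<-|t0].
  exact: transition_cvg_at_right0 tf stayP upP downP _ _.
have h := backward_equation tf stayP upP downP k n t0.
apply: cvg_at_right_filter.
apply/(@differentiable_continuous _ _ _ _ (fun u => p u k n))/derivable1_diffP.
exact: (@ex_derive _ _ _ _ _ _ _ h).
Qed.

Hypotheses (a1_gt0 : 0 < a1) (a2_gt0 : 0 < a2) (b1_gt0 : 0 < b1) (b2_gt0 : 0 < b2).

Lemma transition_expansion k n (t : R) : 0 <= t ->
  (fun m => \sum_(i < m) iter i centered_generator (fun j => (j == n)%:R) k *
                (t ^+ i / i`!%:R)) @ \oo -->
  expR ((a1 + a2 + b1 + b2) / 2 * t) * p t k n.
Proof.
move=> t0; set s := (a1 + a2 + b1 + b2) / 2.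
have s0 : 0 <= s by rewrite /s divr_ge0// !addr_ge0// ltW.
pose F k t := expR (s * t) * p t k n.
have F0 : F ^~ 0 = (fun j => (j == n)%:R).
  by apply/funext => j; rewrite /F mulr0 expR0 mul1r p0.
rewrite -F0 -/(F k t) /centered_generator -/s.
(* A row of the centered generator has absolute sum at most s + 2 (up + down); the constant bounds
   both parities crudely by the sum of all four rates. *)
have H := @taylor_nbr_op_cvg _ F (fun k => s - (up_rate k + down_rate k))
  up_rate down_rate (s + 2 * (a1 + a2 + b1 + b2)).
apply: H; last exact: t0.
- move=> j; rewrite /up_rate /down_rate -/s.
  have [A1 A2 B1 B2] : [/\ 0 <= a1, 0 <= a2, 0 <= b1 & 0 <= b2].
    by split; exact: ltW.
  have tri x y : 0 <= y -> `|s - (x + y)| <= s + `|x| + y.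
    by move=> y0; rewrite (le_trans (ler_normB _ _))// (ger0_norm s0) -addrA lerD2l
      (le_trans (ler_normD _ _))// (ger0_norm y0).
  by case: ifP => _; rewrite (le_trans (lerD (lerD (tri _ _ _) (lexx _)) (lexx _)))//;
    rewrite !ger0_norm//; lra.
- move=> j u u0; have h := backward_equation tf stayP upP downP j n u0.
  pose E : R -> R := expR \o (s *: (@id R)).
  have hE : is_derive u (1 : R) E (s * expR (s * u)).
    by apply: is_derive_eq; rewrite /GRing.scale/= mulr1 mulrC.
  apply: (is_derive_eq (is_deriveM hE h)).
  by rewrite /GRing.scale/= /E/= /F /nbr_op /=; ring.
- move=> j; apply: cvgM; last exact: transition_right_continuous.
  apply: cvg_at_right_filter.
  apply: continuous_comp; last exact: continuous_expR.
  by apply: cvgMr; exact: cvg_id.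
- move=> tau; exists (expR (s * tau)); first exact: expR_ge0.
  move=> j u /andP[u0 utau]; rewrite /F normrM (gtr0_norm (expR_gt0 _)).
  have [_ hp _ _] := tf.
  rewrite ger0_norm ?hp// -[leRHS]mulr1 ler_pM ?expR_ge0 ?hp//.
    by rewrite ler_expR ler_wpM2l.
  exact: transition_le1.
Qed.

End TwoPeriodicChain.

(** * Powers of the centered generator and the coefficients theta and eta *)

Section LatticeWalkCoefficients.
Context {R : realType}.
Variables (a1 a2 b1 b2 : R).

Let kappa := a1 + a2 - b1 - b2.

(* [walk_poly / 'X] is the symbol of the square of the centered generator, which
   moves by -2, 0 or 2; [walk_coef k j] is the coefficient of ['X^-j] in its k-th
   power. *)
Definition walk_poly : {poly R} :=
  (a1 * b1)%:P + (kappa ^+ 2 / 4 + (a1 * b2 + a2 * b1))%:P * 'X +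
  (a2 * b2)%:P * 'X^2.

Definition walk_coef (k : nat) (j : int) : R :=
  if j <= k%:Z then (walk_poly ^+ k)`_`|(k%:Z - j)%R|%N else 0.

Lemma walk_coef0 j : walk_coef 0 j = (j == 0)%:R.
Proof.
rewrite /walk_coef expr0 coef1.
case: ifPn => [j0|j0]; first by congr (_%:R); congr nat_of_bool; lia.
by rewrite (_ : (j == 0) = false)//; lia.
Qed.

Lemma walk_coefS k j : walk_coef k.+1 j =
  a1 * b1 * walk_coef k (j - 1) + a2 * b2 * walk_coef k (j + 1) +
  (kappa ^+ 2 / 4 + (a1 * b2 + a2 * b1)) * walk_coef k j.
Proof.
rewrite /walk_coef exprS; set Q := walk_poly ^+ k.
rewrite /walk_poly; set A := a1 * b1; set C := a2 * b2.
set B := kappa ^+ 2 / 4 + (a1 * b2 + a2 * b1).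
move: A B C => A B C.
have E i : ((A%:P + B%:P * 'X + C%:P * 'X^2) * Q)`_i = A * Q`_i +
   (if (i < 1)%N then 0 else B * Q`_i.-1) + (if (i < 2)%N then 0 else C * Q`_i.-2).
  rewrite !mulrDl !coefD -(mulrA B%:P 'X Q) -(mulrA C%:P 'X^2 Q) !coefCM.
  rewrite coefXnM coefXM; case: i => [|[|i]]; rewrite /= ?mulr0 ?subn2//=.
case: ifPn => h1; last first.
  by rewrite !ifF ?mulr0 ?addr0//; lia.
rewrite E.
have -> : (j - 1 <= k%:Z) = true by lia.
have -> : (k%:Z - (j - 1))%R = (k.+1%:Z - j)%R by lia.
(* At indices 0 and 1 the products by ['X] and ['X^2] have no coefficient to shift; these are
   exactly the values of j at which the guard in [walk_coef] returns 0. *)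
case: (ltnP `|(k.+1%:Z - j)%R| 1) => h2.
  have -> : (j <= k%:Z) = false by lia.
  have -> : (j + 1 <= k%:Z) = false by lia.
  have -> : (`|(k.+1%:Z - j)%R| < 2)%N by lia.
  by rewrite !mulr0.
have -> : (j <= k%:Z) = true by lia.
have -> : `|(k.+1%:Z - j)%R|.-1 = `|(k%:Z - j)%R|%N by lia.
case: (ltnP `|(k.+1%:Z - j)%R| 2) => h3.
  have -> : (j + 1 <= k%:Z) = false by lia.
  by rewrite mulr0 !addr0.
have -> : (j + 1 <= k%:Z) = true by lia.
have -> : `|(k%:Z - j)%R|.-1 = `|(k%:Z - (j + 1))%R|%N by lia.
by rewrite addrAC.
Qed.

(** Each double step moves the half-displacement by at most 1. This is why the series of the theorem
    may start at the absolute value of the displacement. *)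
Lemma walk_coef_out k j : (k < `|j|)%N -> walk_coef k j = 0.
Proof.
elim: k j => [|k IH] j jk.
  by rewrite walk_coef0 (_ : (j == 0) = false)//; lia.
by rewrite walk_coefS !IH ?mulr0 ?addr0//; lia.
Qed.

(** The entry of the 2k-th power of the centered generator at displacement x, target minus start; it
    is the same for even and odd starting states. *)
Definition walk_kernel (k : nat) (x : int) : R :=
  if (2 %| x)%Z then walk_coef k (x %/ 2)%Z else 0.

Local Notation N := (centered_generator a1 a2 b1 b2).

(** The value of f at a neighbour is reached by staying then jumping or by jumping then staying; the
    diagonal entries at the two ends of the jump are opposite, so these contributions cancel. *)
Lemma centered_generator2 (f : int -> R) x : N (N f) x =
  a1 * b1 * f (x + 2) + a2 * b2 * f (x - 2) +
  (kappa ^+ 2 / 4 + (a1 * b2 + a2 * b1)) * f x.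
Proof.
have E1 : (2 %| x + 1)%Z = ~~ (2 %| x)%Z by lia.
have E2 : (2 %| x - 1)%Z = ~~ (2 %| x)%Z by lia.
rewrite /centered_generator /nbr_op /up_rate /down_rate E1 E2 -!addrA.
rewrite subrr addNr !addr0 (_ : 1 + 1 = 2 :> int)// (_ : - 1 + - 1 = - 2 :> int)//.
by rewrite /kappa; case: ifP => _ /=; field.
Qed.

Lemma iter_centered_generator_even k n x :
  iter k.*2 N (fun j => (j == n)%:R) x = walk_kernel k (n - x).
Proof.
elim: k x => [|k IH] x.
  rewrite /= /walk_kernel; case: ifPn => h; last first.
    by rewrite (_ : (x == n) = false)//; lia.
  by rewrite walk_coef0; congr (_%:R); congr nat_of_bool; lia.
rewrite doubleS iterS iterS centered_generator2 !IH /walk_kernel.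
have -> : (2 %| n - (x + 2))%Z = (2 %| n - x)%Z by lia.
have -> : (2 %| n - (x - 2))%Z = (2 %| n - x)%Z by lia.
case: ifPn => h; last by rewrite !mulr0 !addr0.
rewrite walk_coefS.
have -> : ((n - (x + 2)) %/ 2)%Z = ((n - x) %/ 2)%Z - 1 by lia.
by have -> : ((n - (x - 2)) %/ 2)%Z = ((n - x) %/ 2)%Z + 1 by lia.
Qed.

Lemma iter_centered_generator_odd k n x :
  iter k.*2.+1 N (fun j => (j == n)%:R) x = N (fun y => walk_kernel k (n - y)) x.
Proof.
by rewrite iterS; congr (N _ x); apply/funext => y; exact: iter_centered_generator_even.
Qed.

Lemma coef_linear_exp (a b : R) m l :
  ((a%:P + b%:P * 'X) ^+ m)`_l = 'C(m, l)%:R * (a ^+ (m - l) * b ^+ l).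
Proof.
rewrite exprDn coef_sum.
have E (i : 'I_m.+1) : ((a%:P) ^+ (m - i) * (b%:P * 'X) ^+ i *+ 'C(m, i))`_l =
    (i == l :> nat)%:R * ('C(m, l)%:R * (a ^+ (m - l) * b ^+ l)).
  rewrite coefMn exprMn -!polyC_exp.
  have -> : (a ^+ (m - i))%:P * ((b ^+ i)%:P * 'X^i) = (a ^+ (m - i) * b ^+ i)%:P * 'X^i.
    by rewrite polyCM mulrA.
  rewrite coefCM coefXn eq_sym.
  case: eqP => [->|_]; rewrite ?(mulr0n, mulr1n).
    by rewrite mulr1 mul1r mulr_natl.
  by rewrite mulr0 mul0r mul0rn.
rewrite (eq_bigr _ (fun i _ => E i)).
have [lm|ml] := leqP l m.
  rewrite (bigD1 (Ordinal (lm : (l < m.+1)%N)))//= eqxx mul1r big1 ?addr0// => i il.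
  by rewrite (_ : (i == l :> nat) = false) ?mul0r//; apply/negbTE.
by rewrite bin_small// !mul0r big1// => i _; rewrite mulr0.
Qed.

Lemma coef_quadratic_exp m h :
  (((a1%:P + a2%:P * 'X) * (b1%:P + b2%:P * 'X)) ^+ m)`_h =
  \sum_(l < h.+1) ('C(m, l)%:R * 'C(m, h - l)%:R *
    (a1 ^+ (m - l) * a2 ^+ l * (b1 ^+ (m - (h - l)) * b2 ^+ (h - l)))).
Proof.
rewrite exprMn coefM; apply: eq_bigr => l _; rewrite !coef_linear_exp; ring.
Qed.

Lemma walk_polyE : walk_poly =
  (kappa ^+ 2 / 4)%:P * 'X + (a1%:P + a2%:P * 'X) * (b1%:P + b2%:P * 'X).
Proof. by rewrite /walk_poly !rmorphD/= !rmorphM/=; ring. Qed.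

Lemma binZ_nat (m l : nat) : binZ m%:Z l%:Z = 'C(m, l)%:R :> R.
Proof. by []. Qed.

Lemma binZ_neg (m l : int) : l < 0 -> binZ m l = 0 :> R.
Proof. by rewrite /binZ => l0; case: ifPn => // /andP[_]; lia. Qed.

Hypotheses (a1_gt0 : 0 < a1) (a2_gt0 : 0 < a2) (b1_gt0 : 0 < b1) (b2_gt0 : 0 < b2).

Let nz : [/\ a1 != 0, a2 != 0, b1 != 0 & b2 != 0].
Proof. by split; rewrite gt_eqF. Qed.

Let rho := (a1 * b1) / (a2 * b2).
Let q := (a2 * b1) / (a1 * b2).

(** Integer powers with exponent k - (l + l') are written as quotients of natural powers, which
    turns the identity into field arithmetic on monomials; [theta_monomial] has the same form with m
    in the place of k. *)
Lemma eta_monomial (k l l' : nat) : (l <= k)%N -> (l' <= k)%N ->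
  a1 ^+ (k - l) * a2 ^+ l * (b1 ^+ (k - l') * b2 ^+ l') =
  rho ^+ k / rho ^+ (l + l') * ((a2 / a1) ^+ k / (a2 / a1) ^+ (l + l')) *
  (a1 * b2) ^+ k * q ^+ l.
Proof.
move=> lk lk'; have [a10 a20 b10 b20] := nz.
have E (x : R) (n i : nat) : (i <= n)%N -> x ^+ n = x ^+ (n - i) * x ^+ i.
  by move=> ni; rewrite -exprD subnK.
rewrite /rho /q !exprMn !exprVn !exprMn !exprD (E a1 k l)// (E b1 k l')//.
by field; rewrite !expf_neq0.
Qed.

Lemma theta_monomial (u : R) (k m l l' : nat) : u != 0 ->
  (m <= k)%N -> (l <= m)%N -> (l' <= m)%N ->
  u ^+ (k - m) * (a1 ^+ (m - l) * a2 ^+ l * (b1 ^+ (m - l') * b2 ^+ l')) =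
  u ^+ k * (rho ^+ m / rho ^+ (l + l')) *
  ((a2 * b2 / u) ^+ m / (a2 * b2 / u) ^+ (l + l')) *
  (a1 * b2 / u) ^+ (l + l') * q ^+ l.
Proof.
move=> u0 mk lk lk'; have [a10 a20 b10 b20] := nz.
have E (x : R) (n i : nat) : (i <= n)%N -> x ^+ n = x ^+ (n - i) * x ^+ i.
  by move=> ni; rewrite -exprD subnK.
rewrite /rho /q !exprMn !exprVn !exprMn !exprD (E a1 m l)// (E b1 m l')// (E u k m)//.
by field; rewrite !expf_neq0.
Qed.

Let exprzBnat (x : R) (n m : nat) (j : int) : x != 0 -> j = n%:Z - m%:Z ->
  x ^ j = x ^+ n / x ^+ m.
Proof. by move=> x0 ->; rewrite expfzDr// -invr_expz. Qed.

Lemma walk_coef_eta k (r s : int) : kappa = 0 -> (`|s - r| <= k)%N ->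
  walk_coef k (s - r) =
  ((a1 * b1) / (a2 * b2)) ^ (s - r) * eta_coef k r s a1 a2 b1 b2.
Proof.
move=> k0 hk; rewrite /walk_coef ifT; last by lia.
rewrite walk_polyE k0 expr0n/= mul0r mul0r add0r coef_quadratic_exp.
rewrite /eta_coef.
have -> : (k%:Z - s + r)%R = (k%:Z - (s - r))%R by lia.
set j := s - r in hk *; set h := `|(k%:Z - j)%R|%N.
have hE : h%:Z = k%:Z - j by lia.
rewrite [in RHS](eq_bigl xpredT); last by move=> l /=; apply/idP; have := ltn_ord l; lia.
rewrite mulr_sumr mulr_sumr; apply: eq_bigr => l _.
have lh : (l <= h)%N by have := ltn_ord l; lia.
have [kl|lk] := ltnP k l.
  by rewrite binZ_nat bin_small// !mul0r !mulr0.
(* Symmetry of binomial coefficients, as j + l = k - (h - l); a negative j + l corresponds to h - l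
   > k, where both sides vanish. *)
have jlE : binZ k%:Z (j + l%:Z) = 'C(k, h - l)%:R :> R.
  have [jl|jl] := ltP (j + l%:Z) 0.
    by rewrite binZ_neg// bin_small//; lia.
  have -> : j + l%:Z = `|(j + l%:Z)%R|%N%:Z by lia.
  rewrite binZ_nat -[in RHS]bin_sub; last by lia.
  by have -> : `|(j + l%:Z)%R|%N = (k - (h - l))%N by lia.
rewrite jlE binZ_nat.
have [hlk|khl] := leqP (h - l) k; last by rewrite (bin_small khl) !(mulr0n, mulr0, mul0r).
have [a10 a20 b10 b20] := nz.
rewrite !(@exprzBnat _ k h) ?mulf_neq0 ?invr_neq0 ?mulf_neq0//; try by lia.
have := eta_monomial lk hlk; rewrite subnKC// => ->.
by rewrite -/rho -/q; ring.
Qed.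

Lemma coef_walk_poly_exp k i : (walk_poly ^+ k)`_i =
  \sum_(0 <= m < k.+1) 'C(k, m)%:R * ((kappa ^+ 2 / 4) ^+ (k - m) *
    (if (i < k - m)%N then 0
     else (((a1%:P + a2%:P * 'X) * (b1%:P + b2%:P * 'X)) ^+ m)`_(i - (k - m)))).
Proof.
rewrite walk_polyE exprDn coef_sum big_mkord; apply: eq_bigr => m _.
by rewrite coefMn exprMn -polyC_exp -mulrA coefCM coefXnM mulr_natl.
Qed.

(** Of the k factors of the power, m contribute the quadratic part and k - m the monomial [u * 'X].
    The coefficient of index k - j then asks for degree h = m - j of the quadratic part, and h is
    the summation index of theta. *)
Let walk_coef_theta_term (u : R) (k : nat) (j : int) (m h : nat) :
  u != 0 -> m%:Z = h%:Z + j -> (m <= k)%N ->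
  'C(k, m)%:R * (u ^+ (k - m) *
    (((a1%:P + a2%:P * 'X) * (b1%:P + b2%:P * 'X)) ^+ m)`_h) =
  rho ^ j * (a2 * b2 / u) ^ j * u ^+ k *
  (binZ k (h%:Z + j) * (a1 * b2 / u) ^+ h *
   (\sum_(l < h.+1) binZ (h%:Z + j) l%:Z * binZ (h%:Z + j) (h%:Z - l%:Z) * q ^+ l)).
Proof.
have [a10 a20 b10 b20] := nz.
have jE0 : m%:Z = h%:Z + j -> j = m%:Z - h%:Z by clear; lia.
have sub0 (l : 'I_h.+1) : h%:Z - l%:Z = (h - l)%N%:Z.
  by have := ltn_ord l; clear; lia.
move=> u0 mE; have {}jE0 := jE0 mE; move=> mk; rewrite -mE binZ_nat coef_quadratic_exp !mulr_sumr.
apply: eq_bigr => l _; have lh : (l <= h)%N by rewrite -ltnS.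
rewrite sub0 !binZ_nat.
have [ml|lm] := ltnP m l; first by rewrite (bin_small ml) !(mulr0n, mul0r, mulr0).
have [hlm|mhl] := leqP (h - l) m; last by rewrite (bin_small mhl) !(mulr0n, mul0r, mulr0).
have := theta_monomial u0 mk lm hlm; rewrite subnKC// => E.
have -> : rho ^ j = rho ^+ m / rho ^+ h.
  by apply: exprzBnat => //; rewrite !mulf_neq0 ?invr_neq0 ?mulf_neq0.
have -> : (a2 * b2 / u) ^ j = (a2 * b2 / u) ^+ m / (a2 * b2 / u) ^+ h.
  by apply: exprzBnat => //; rewrite !mulf_neq0 ?invr_neq0.
transitivity ('C(k, m)%:R * ('C(m, l)%:R * 'C(m, h - l)%:R) * (u ^+ (k - m) *
  (a1 ^+ (m - l) * a2 ^+ l * (b1 ^+ (m - (h - l)) * b2 ^+ (h - l))))); first by ring.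
by rewrite E; ring.
Qed.

(** Reindexing by m = h + j for j of either sign: the indices on one side without a partner on the
    other carry zero terms. *)
Let sum_int_shift (f g : nat -> R) (k H : nat) (j : int) :
  H%:Z = k%:Z - j -> (`|j| <= k)%N ->
  (forall m h : nat, m%:Z = h%:Z + j -> (m <= k)%N -> f m = g h) ->
  (forall m : nat, m%:Z < j -> (m <= k)%N -> f m = 0) ->
  (forall h : nat, h%:Z + j < 0 -> g h = 0) ->
  \sum_(0 <= m < k.+1) f m = \sum_(0 <= h < H.+1) g h.
Proof.
clear; move=> HE hk fg f0 g0.
have [j0|j0] := leP 0 j.
  rewrite (@big_cat_nat _ _ _ `|j|%N)//=; last by lia.
  rewrite big_nat big1 ?add0r; last first.
    by move=> m /andP[_ mj]; apply: f0; lia.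
  rewrite -{1}[`|j|%N]add0n big_addn (_ : (k.+1 - `|j| = H.+1)%N); last by lia.
  by apply: eq_big_nat => h /andP[_ hH]; apply: fg; lia.
rewrite [RHS](@big_cat_nat _ _ _ `|j|%N)//=; last by lia.
rewrite [X in _ = X + _]big_nat [X in _ = X + _]big1 ?add0r; last first.
  by move=> h /andP[_ hj]; apply: g0; lia.
rewrite -{1}[`|j|%N](add0n `|j|%N) big_addn (_ : (H.+1 - `|j| = k.+1)%N); last by lia.
by apply: eq_big_nat => m /andP[_ mk]; apply: fg; lia.
Qed.

Lemma walk_coef_theta k (r s : int) : kappa != 0 -> (`|s - r| <= k)%N ->
  walk_coef k (s - r) =
  ((a1 * b1) / (a2 * b2)) ^ (s - r) * theta_coef k r s a1 a2 b1 b2 *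
  (kappa / 2) ^+ k.*2.
Proof.
move=> k0 hk; rewrite /walk_coef ifT; last by lia.
rewrite coef_walk_poly_exp /theta_coef -/kappa.
have -> : (k%:Z - s + r)%R = (k%:Z - (s - r))%R by lia.
under [in RHS]eq_bigr => h _.
  have -> : h%:Z + s - r = h%:Z + (s - r) by lia.
  over.
set j := s - r in hk *; set H := `|(k%:Z - j)%R|%N.
have HE : H%:Z = k%:Z - j by lia.
rewrite [in RHS](eq_bigl xpredT); last by move=> l /=; apply/idP; have := ltn_ord l; lia.
have [a10 a20 b10 b20] := nz.
set u := kappa ^+ 2 / 4.
have u0 : u != 0 by rewrite mulf_neq0 ?expf_neq0// invr_neq0// pnatr_eq0.
have uk : (kappa / 2) ^+ k.*2 = u ^+ k.
  by rewrite -mul2n exprM /u; congr (_ ^+ k); field.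
have cu (x y : R) : 4 * x * y / kappa ^+ 2 = x * y / u by rewrite /u; field.
rewrite cu uk.
have term m h := @walk_coef_theta_term u k j m h u0.
transitivity (\sum_(0 <= h < H.+1) (rho ^ j * (a2 * b2 / u) ^ j * u ^+ k *
  (binZ k (h%:Z + j) * (a1 * b2 / u) ^+ h *
   (\sum_(l < h.+1) binZ (h%:Z + j) l%:Z * binZ (h%:Z + j) (h%:Z - l%:Z) * q ^+ l)))); last first.
  rewrite big_mkord -mulr_sumr -/rho.
  under [in RHS]eq_bigr => h _ do rewrite cu.
  by rewrite /q; ring.
apply: (sum_int_shift HE hk).
- move=> m h mh mk; rewrite -(term m h mh mk).
  have [-> ->] : (H < k - m)%N = false /\ (H - (k - m) = h)%N.
    by clear -HE mh mk; split; lia.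
  by [].
- move=> m mj mk; have -> : (H < k - m)%N by clear -HE mj mk; lia.
  by rewrite !mulr0.
- by move=> h hj; rewrite binZ_neg// !mul0r mulr0.
Qed.

End LatticeWalkCoefficients.

(** * Gamma integrals and factorials *)

Section GammaFunction.
Context {R : realType}.
Local Notation mu := (@lebesgue_measure R).

(** The next term of the exponential series, x^(i+1) / (i+1)! <= exp x, bounds each summand times
    exp (- x) by (m + 1) / x. *)
Lemma cvg_pow_fact_sum_expRN (m : nat) :
  (\sum_(i < m) x ^+ i / i`!%:R) * expR (- x) @[x --> +oo] --> (0 : R).
Proof.
apply: (@squeeze_cvgr _ _ _ _ (cst 0) (fun x : R => m%:R * m.+1%:R * (x^-1))).
- near=> x; have x1 : 1 <= x by near: x; exact: nbhs_pinfty_ge.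
  have x0 : 0 < x by rewrite (lt_le_trans ltr01).
  rewrite mulr_ge0 ?expR_ge0 ?sumr_ge0//=; last first.
    by move=> i _; rewrite divr_ge0// exprn_ge0// ltW.
  rewrite expRN ler_pdivrMr ?expR_gt0//.
  have hi (i : 'I_m) : x ^+ i / i`!%:R <= m.+1%:R * x^-1 * expR x.
    have := expR_ge1Dxn i (ltW x0) => h.
    have {}h : x ^+ i.+1 / i.+1`!%:R <= expR x by apply: le_trans h; rewrite lerDr.
    apply: (@le_trans _ _ (m.+1%:R * x^-1 * (x ^+ i.+1 / i.+1`!%:R))); last first.
      by rewrite ler_wpM2l// mulr_ge0// invr_ge0 ltW.
    have f0 : (i`!%:R : R) != 0 by rewrite pnatr_eq0 -lt0n fact_gt0.
    have E : m.+1%:R * x^-1 * (x ^+ i.+1 / i.+1`!%:R) =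
        m.+1%:R / i.+1%:R * (x ^+ i / i`!%:R).
      by rewrite factS natrM exprS; field; rewrite f0 (gt_eqF x0) nat1r pnatr_eq0.
    rewrite E ler_peMl ?divr_ge0 ?exprn_ge0 ?(ltW x0)// ler_pdivlMr// mul1r ler_nat.
    by rewrite ltnS ltnW.
  apply: (le_trans (ler_sum _ (fun i _ => hi i))).
  rewrite sumr_const card_ord le_eqVlt; apply/orP; left; apply/eqP.
  by rewrite -[LHS]mulr_natl; ring.
- exact: cvg_cst.
- rewrite -[X in _ --> X](mulr0 (m%:R * m.+1%:R)); apply: cvgMr.
  apply/cvgrVy; first by near=> x; rewrite invr_gt0; near: x; exact: nbhs_pinfty_gt.
  by apply: cvg_trans; [|exact: cvg_id]; apply: near_eq_cvg; near=> x; rewrite /= invrK.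
Unshelve. all: by end_near. Qed.

Lemma integral_pow_expRN (m : nat) :
  (\int[mu]_(x in `[0%R, +oo[) (x ^+ m / m`!%:R * expR (- x))%:E = 1)%E.
Proof.
(* An explicit antiderivative: differentiating the partial sum of the exponential drops its last
   term, which is what survives the product rule. *)
pose F : R -> R := - ((fun x => \sum_(i < m.+1) (cst 1 i : R) * (x ^+ i / i`!%:R))
  * (expR \o -%R)).
have FE x : F x = - ((\sum_(i < m.+1) x ^+ i / i`!%:R) * expR (- x)).
  by rewrite /F !fctE; under eq_bigr do rewrite mul1r.
have DF (x : R) : is_derive x (1 : R) F (x ^+ m / m`!%:R * expR (- x)).
  have h1 := @is_derive_pow_fact_sum R (cst 1) m x.
  have h2 : is_derive x (1 : R) (expR \o -%R) (- expR (- x)).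
    by apply: is_derive_eq; rewrite /GRing.scale/= mulrN1.
  apply: (is_derive_eq (is_deriveN (is_deriveM h1 h2))); rewrite /GRing.scale/=.
  under eq_bigr do rewrite mul1r.
  under [X in _ + _ * X]eq_bigr do rewrite mul1r.
  by rewrite big_ord_recr/=; ring.
have cF : continuous F.
  move=> x; have h := DF x.
  apply/differentiable_continuous/derivable1_diffP.
  exact: (@ex_derive _ _ _ _ _ _ _ h).
rewrite (@ge0_continuous_FTC2y _ _ F _ 0).
- rewrite FE big_ord_recl/= expr0 fact0 divr1 big1 ?addr0; last first.
    by move=> i _; rewrite expr0n/= mul0r.
  by rewrite oppr0 expR0 mulr1 -EFinB opprK add0r.
- by move=> x x0; rewrite mulr_ge0 ?expR_ge0// divr_ge0// exprn_ge0.
- apply: continuous_subspaceT => x; apply: cvgM.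
    by apply: cvgMl; exact: exprn_continuous.
  by apply: continuous_comp; [exact: continuousN|exact: continuous_expR].
- rewrite (_ : F = (fun x => - ((\sum_(i < m.+1) x ^+ i / i`!%:R) * expR (- x)))); last exact/funext.
  by rewrite -[X in _ --> X]oppr0; apply: cvgN; exact: cvg_pow_fact_sum_expRN.
- by move=> x _; have h := DF x; exact: (@ex_derive _ _ _ _ _ _ _ h).
- by apply: cvg_at_right_filter; exact: cF.
- by move=> x _; rewrite derive1E; have h := DF x; exact: (@derive_val _ _ _ _ _ _ _ h).
Qed.

Lemma integral_expRN_tail (c : R) :
  (\int[mu]_(x in `[c, +oo[) (expR (- x))%:E = (expR (- c))%:E)%E.
Proof.
pose F : R -> R := - (expR \o -%R).
have DF (x : R) : is_derive x (1 : R) F (expR (- x)).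
  have h2 : is_derive x (1 : R) (expR \o -%R) (- expR (- x)).
    by apply: is_derive_eq; rewrite /GRing.scale/= mulrN1.
  by apply: (is_derive_eq (is_deriveN h2)); rewrite opprK.
have cF : continuous F.
  move=> x; have h := DF x.
  apply/differentiable_continuous/derivable1_diffP.
  exact: (@ex_derive _ _ _ _ _ _ _ h).
rewrite (@ge0_continuous_FTC2y _ _ F _ 0).
- by rewrite /F !fctE -EFinB opprK add0r.
- by move=> x x0; rewrite expR_ge0.
- apply: continuous_subspaceT => x.
  by apply: continuous_comp; [exact: continuousN|exact: continuous_expR].
- by rewrite -[X in _ --> X]oppr0; apply: cvgN; exact: cvgr_expR.
- by move=> x _; have h := DF x; exact: (@ex_derive _ _ _ _ _ _ _ h).
- by apply: cvg_at_right_filter; exact: cF.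
- by move=> x _; rewrite derive1E; have h := DF x; exact: (@derive_val _ _ _ _ _ _ _ h).
Qed.

(** Kept in the extended reals because its finiteness at m nu + 1 is a conclusion drawn from the
    moments of the subordinator, whereas [Gamma] would turn an infinite integral into 0. *)
Definition eGamma_integral (x : R) : \bar R :=
  (\int[mu]_(u in `[0%R, +oo[) (u `^ (x - 1) * expR (- u))%:E)%E.

Lemma Gamma_eGamma (x : R) : 0 < x -> Gamma x = fine (eGamma_integral x).
Proof.
move=> x0; rewrite /Gamma x0 big_ord0 divr1 addr0 /Gamma_integral /Rintegral.
rewrite /eGamma_integral; congr fine.
apply: integral_itv_obnd_cbnd.
apply/measurable_EFinP; apply: measurable_funTS; apply: measurable_funM.
  exact: measurable_powR.
by apply: measurableT_comp => //; exact: measurable_expR.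
Qed.

Lemma Gamma0 : Gamma 0 = 0 :> R.
Proof.
rewrite /Gamma ltxx floor0 big_ord_recl/= addr0 mul0r invr0 mulr0 //.
Qed.

Lemma eGamma_integralS (m : nat) : eGamma_integral m.+1%:R = m`!%:R%:E.
Proof.
have f0 : (0 : R) <= m`!%:R by rewrite ler0n.
have fn0 : (m`!%:R : R) != 0 by rewrite pnatr_eq0 -lt0n fact_gt0.
rewrite -[RHS]mule1 -(integral_pow_expRN m) -ge0_integralZl//; last first.
- by move=> x; rewrite /= in_itv/= andbT => x0; rewrite lee_fin mulr_ge0 ?expR_ge0// divr_ge0// exprn_ge0.
- apply/measurable_EFinP; apply: measurable_funTS; apply: measurable_funM.
    by apply: measurable_funM => //; exact: exprn_measurable.
  by apply: measurableT_comp => //; exact: measurable_expR.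
apply: eq_integral => x; rewrite inE/= in_itv/= andbT => x0.
rewrite -EFinM -natr1 addrK powR_mulrn//; congr EFin.
by field.
Qed.

Lemma Gamma_natS (m : nat) : Gamma m.+1%:R = m`!%:R :> R.
Proof. by rewrite Gamma_eGamma// eGamma_integralS. Qed.

End GammaFunction.

(** * The Laplace transform determines the tail probabilities *)

Section LaplaceUniqueness.
Context {R : realType}.

Lemma cvg_mulrn_expRN (a : R) : 0 < a ->
  (fun n : nat => n%:R * expR (- (n%:R * a))) @ \oo --> 0.
Proof.
move=> a0.
have h (n : nat) : n.+1%:R * expR (- (n.+1%:R * a)) <= 2 / a ^+ 2 * harmonic n :> R.
  rewrite expRN ler_pdivrMr ?expR_gt0//.
  have h1 : (n.+1%:R * a) ^+ 2 / 2 <= expR (n.+1%:R * a).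
    apply: le_trans (expR_ge1Dxn 1 _); last by rewrite mulr_ge0// ltW.
    by rewrite lerDr.
  apply: (@le_trans _ _ (2 / a ^+ 2 * harmonic n * ((n.+1%:R * a) ^+ 2 / 2))).
    rewrite le_eqVlt; apply/orP; left; apply/eqP; rewrite /harmonic/=.
    by field; rewrite nat1r pnatr_eq0 (gt_eqF a0).
  by rewrite ler_wpM2l// ?mulr_ge0 ?invr_ge0 ?exprn_ge0// ltW.
rewrite -cvg_shiftS; apply: (@squeeze_cvgr _ _ _ _ (cst 0) (fun n => 2 / a ^+ 2 * harmonic n)).
- by apply: nearW => n; rewrite h andbT mulr_ge0 ?expR_ge0.
- exact: cvg_cst.
- by rewrite -[X in _ --> X](mulr0 (2 / a ^+ 2)); apply: cvgMr; exact: cvg_harmonic.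
Qed.

Lemma bernoulli_ge (y : R) (M : nat) : 0 <= y <= 1 -> 1 - M%:R * y <= (1 - y) ^+ M.
Proof.
move=> /andP[y0 y1]; elim: M => [|M IH]; first by rewrite mul0r subr0 expr0.
rewrite exprS (le_trans _ (ler_wpM2l _ IH)) ?subr_ge0//.
rewrite -natr1; have : 0 <= M%:R * y * y by rewrite !mulr_ge0.
by nra.
Qed.

(* Expanding the power makes this a combination of exponentials in [x]; with the
   rate [n * (ln 2 / t)] the product of [2 ^ n] and the inner exponential tends to
   0 or to +oo according to the sign of [x - t]. *)
Definition sharp_step (t : R) (n : nat) (x : R) : R :=
  (1 - expR (- (n%:R * (ln 2 / t) * x))) ^+ (n * 2 ^ n).

Lemma sharp_step_itv (t : R) n (x : R) : 0 < t -> 0 <= x -> 0 <= sharp_step t n x <= 1.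
Proof.
move=> t0 x0; have l2 : 0 <= ln (2 : R) by rewrite ln_ge0// ler1n.
have h : 0 <= 1 - expR (- (n%:R * (ln 2 / t) * x)) <= 1.
  rewrite subr_ge0 lerBlDr lerDl expR_ge0 andbT expR_le1 oppr_le0.
  by rewrite !mulr_ge0// invr_ge0 ltW.
by rewrite exprn_ge0/= ?exprn_ile1//; case/andP: h.
Qed.

(** With y the inner exponential and M the exponent, (1 - y)^M lies between 1 - M y and exp (- M y),
    where M y = n exp (n (ln 2 / t) (t - x)). The extra factor n in M makes the limit 0 at x = t
    too, so that the strict inequality is obtained without assuming a law free of atoms. *)
Lemma sharp_step_cvg (t x : R) : 0 < t -> 0 <= x ->
  (fun n => sharp_step t n x) @ \oo --> ((t < x)%R%:R : R).
Proof.
move=> t0 x0; have l2 : 0 < ln (2 : R) by rewrite ln_gt0// ltr1n.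
have ME n : (n * 2 ^ n)%N%:R * expR (- (n%:R * (ln 2 / t) * x)) =
    n%:R * expR (n%:R * (ln 2 / t) * (t - x)) :> R.
  rewrite natrM natrX -mulrA; congr (_ * _).
  rewrite -{1}[2](@lnK R) ?posrE// -expRM_natl -expRD; congr expR.
  by field; rewrite gt_eqF.
have yP n : 0 <= expR (- (n%:R * (ln 2 / t) * x)) <= 1.
  rewrite expR_ge0/= expR_le1 oppr_le0.
  by rewrite !mulr_ge0// ?invr_ge0 ltW.
have [xt|tx] := leP x t.
- apply: (@squeeze_cvgr _ _ _ _ (cst 0) (fun n => expR (- n%:R))).
  + apply: nearW => n; have /andP[-> _] /= := sharp_step_itv n t0 x0.
    have /andP[y0 y1] := yP n.
    apply: (@le_trans _ _ (expR (- expR (- (n%:R * (ln 2 / t) * x))) ^+ (n * 2 ^ n))).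
      by apply: lerXn2r; rewrite ?nnegrE ?subr_ge0 ?expR_ge0// expR_ge1Dx.
    rewrite -expRM_natl ler_expR mulrN lerN2 ME.
    by rewrite ler_peMr// (le_trans _ (expR_ge1Dx _))// lerDl !mulr_ge0 ?subr_ge0// ?invr_ge0 ltW.
  + exact: cvg_cst.
  + exact: cvgn_expR.
- have d0 : 0 < ln 2 / t * (x - t) by rewrite !mulr_gt0 ?invr_gt0 ?subr_gt0.
  apply: (@squeeze_cvgr _ _ _ _
    (fun n : nat => 1 - n%:R * expR (- (n%:R * (ln 2 / t * (x - t))))) (cst 1)).
  + apply: nearW => n; have /andP[_ ->] := sharp_step_itv n t0 x0.
    rewrite andbT (le_trans _ (bernoulli_ge _ (yP n)))// ME.
    by have -> : n%:R * (ln 2 / t) * (t - x) = - (n%:R * (ln 2 / t * (x - t))) by ring.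
  + rewrite -[X in _ --> X]subr0; apply: cvgB; first exact: cvg_cst.
    exact: cvg_mulrn_expRN.
  + exact: cvg_cst.
Qed.

Context d (T : measurableType d) (P : probability T R).

Lemma integrable_bounded (f : T -> R) (B : R) : measurable_fun [set: T] f ->
  (forall w, `|f w| <= B) -> P.-integrable [set: T] (EFin \o f).
Proof.
move=> mf fB; apply: (@le_integrable _ _ _ P setT measurableT _ (cst B%:E)).
- exact/measurable_EFinP.
- by move=> w _ /=; rewrite !lee_fin (le_trans (fB w))// ler_norm.
- exact: finite_measure_integrable_cst.
Qed.

Lemma measurable_preimage_set (f : T -> R) (B : set R) :
  measurable_fun [set: T] f -> measurable B -> measurable [set w | B (f w)].
Proof. by move=> mf mB; rewrite -[X in measurable X]setTI; exact: mf. Qed.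

Lemma measurable_gt_set (f : T -> R) (t : R) :
  measurable_fun [set: T] f -> measurable [set w | t < f w].
Proof.
move=> mf; rewrite (_ : [set w | _] = [set w | `]t, +oo[%classic (f w)]).
  exact: measurable_preimage_set.
by apply/seteqP; split => w /=; rewrite in_itv/= andbT.
Qed.

Lemma measurable_le_set (f : T -> R) (t : R) :
  measurable_fun [set: T] f -> measurable [set w | f w <= t].
Proof.
move=> mf; rewrite (_ : [set w | _] = [set w | `]-oo, t]%classic (f w)]).
  exact: measurable_preimage_set.
by apply/seteqP; split => w /=; rewrite in_itv.
Qed.

Variables X Y : T -> R.
Hypotheses (mX : measurable_fun [set: T] X) (mY : measurable_fun [set: T] Y).
Hypotheses (X_ge0 : forall w, 0 <= X w) (Y_ge0 : forall w, 0 <= Y w).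
Hypothesis eq_laplace : forall g : R, 0 <= g ->
  (\int[P]_w (expR (- (g * X w)))%:E = \int[P]_w (expR (- (g * Y w)))%:E)%E.

Let term (Z : T -> R) (g c : R) (M : nat) (w : T) : R :=
  expR (- (g * Z w)) * (1 - expR (- (c * Z w))) ^+ M.

Let measurable_term (Z : T -> R) (g c : R) M : measurable_fun [set: T] Z ->
  measurable_fun [set: T] (term Z g c M).
Proof.
move=> mZ; have mE a : measurable_fun [set: T] (fun w => expR (- (a * Z w))).
  apply: measurableT_comp; first exact: measurable_expR.
  by apply: measurableT_comp => //; exact: measurable_funM.
apply: measurable_funM => //.
by apply: measurable_funX; apply: measurable_funB.
Qed.

Let integrable_term (Z : T -> R) (g c : R) M : measurable_fun [set: T] Z -> (forall w, 0 <= Z w) ->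
  0 <= g -> 0 <= c -> P.-integrable [set: T] (EFin \o term Z g c M).
Proof.
move=> mZ Z0 g0 c0; apply: (@integrable_bounded _ 1); first exact: measurable_term.
move=> w; have e01 (a : R) : 0 <= a -> 0 <= expR (- (a * Z w)) <= 1.
  by move=> a0; rewrite expR_ge0/= expR_le1 oppr_le0 mulr_ge0.
have /andP[eg0 eg1] := e01 _ g0; have /andP[ec0 ec1] := e01 _ c0.
have h0 : 0 <= 1 - expR (- (c * Z w)) by rewrite subr_ge0.
have h1 : 1 - expR (- (c * Z w)) <= 1 by rewrite lerBlDr lerDl.
rewrite ger0_norm ?mulr_ge0 ?exprn_ge0//.
by rewrite mulr_ile1// ?exprn_ge0// exprn_ile1.
Qed.

(** The additional factor with rate g makes an induction on M possible: splitting off one factor 1 -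
    exp (- c Z) yields a difference of terms of order M at the rates g and g + c. *)
Let eq_term (g c : R) M : 0 <= g -> 0 <= c ->
  (\int[P]_w (term X g c M w)%:E = \int[P]_w (term Y g c M w)%:E)%E.
Proof.
elim: M g => [|M IH] g g0 c0.
  by rewrite /term; under eq_integral do rewrite expr0 mulr1;
    under [in RHS]eq_integral do rewrite expr0 mulr1; exact: eq_laplace.
have E (Z : T -> R) w : ((term Z g c M.+1 w)%:E = (term Z g c M w)%:E - (term Z (g + c) c M w)%:E)%E.
  rewrite -EFinB; congr EFin; rewrite /term mulrDl opprD expRD exprS; ring.
have gc0 : 0 <= g + c by rewrite addr_ge0.
have step (Z : T -> R) : measurable_fun [set: T] Z -> (forall w, 0 <= Z w) ->
    (\int[P]_w (term Z g c M.+1 w)%:E =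
     \int[P]_w (term Z g c M w)%:E - \int[P]_w (term Z (g + c)%R c M w)%:E)%E.
  move=> mZ Z0; rewrite -integralB_EFin.
  - by apply: eq_integral => w _; exact: E.
  - exact: measurableT.
  - exact: (@integrable_term Z g c M mZ Z0 g0 c0).
  - exact: (@integrable_term Z (g + c) c M mZ Z0 gc0 c0).
by rewrite (step X mX X_ge0) (step Y mY Y_ge0) (IH g g0 c0) (IH (g + c) gc0 c0).
Qed.

(** The indicator of t < x is a bounded pointwise limit of sharp steps, and the expectations of
    these are determined by the Laplace transform. *)
Lemma laplace_ccdf (t : R) : 0 < t -> P [set w | t < X w] = P [set w | t < Y w].
Proof.
move=> t0.
have l2 : 0 <= ln (2 : R) by rewrite ln_ge0// ler1n.
have key (Z : T -> R) : measurable_fun [set: T] Z -> (forall w, 0 <= Z w) ->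
    (fun n => \int[P]_w (sharp_step t n (Z w))%:E)%E @ \oo --> P [set w | t < Z w].
  move=> mZ Z0; have mA : measurable [set w | t < Z w].
    exact: measurable_gt_set.
  rewrite -(setIT [set w | t < Z w]) -integral_indic//.
  apply: (@dominated_cvg _ _ _ P setT measurableT _ _ (cst 1%E)).
  - move=> n; apply/measurable_EFinP.
    have := @measurable_term Z 0 (n%:R * (ln 2 / t)) (n * 2 ^ n) mZ.
    by rewrite /term; under eq_fun do rewrite mul0r oppr0 expR0 mul1r.
  - move=> w _; apply/cvg_EFin; first exact: nearW.
    rewrite indicE (_ : (w \in _) = (t < Z w)); last by apply/idP/idP; rewrite inE.
    exact: sharp_step_cvg.
  - by [].
  - exact: finite_measure_integrable_cst.
  - move=> n w _ /=; have /andP[h0 h1] := sharp_step_itv n t0 (Z0 w).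
    by rewrite lee_fin ger0_norm.
apply: (cvg_unique _ (key X mX X_ge0)); first exact: ereal_hausdorff.
rewrite (_ : (fun n => _) = (fun n => \int[P]_w (sharp_step t n (Y w))%:E)%E); first exact: key.
apply/funext => n; rewrite /sharp_step.
have c0 : 0 <= n%:R * (ln 2 / t) by rewrite !mulr_ge0// ?invr_ge0 ltW.
have := @eq_term 0 _ (n * 2 ^ n) (lexx _) c0; rewrite /term.
by under eq_integral do rewrite mul0r oppr0 expR0 mul1r;
  under [in RHS]eq_integral do rewrite mul0r oppr0 expR0 mul1r.
Qed.

End LaplaceUniqueness.

(** * Negative powers as integrals of exponentials *)

Section LayerCake.
Context {R : realType}.
Local Notation mu := (@lebesgue_measure R).

Lemma lt_powR_inv (a x r : R) : 0 < a -> 0 <= x -> 0 <= r ->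
  (r < x `^ a) = (r `^ a^-1 < x).
Proof.
move=> a0 x0 r0; have an0 : a != 0 by rewrite gt_eqF.
have E1 : (r `^ a^-1) `^ a = r by rewrite -powRrM mulVf// powRr1.
have E2 : (x `^ a) `^ a^-1 = x by rewrite -powRrM mulfV// powRr1.
apply/idP/idP => h.
  rewrite -E2; apply: gt0_ltr_powR => //; rewrite ?nnegrE ?powR_ge0 ?invr_gt0//.
by rewrite -E1; apply: gt0_ltr_powR => //; rewrite ?nnegrE ?powR_ge0.
Qed.

(** Both sides integrate exp (- x) over the region 0 <= r < (x / s)^a, sliced at fixed x on the left
    and at fixed r on the right, where the slice is the half-line x > s r^(1/a). *)
Lemma integral_powR_expRN (s a : R) : 0 < s -> 0 < a ->
  (\int[mu]_(x in `[0%R, +oo[) ((x / s) `^ a * expR (- x))%:E =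
   \int[mu]_(r in `[0%R, +oo[) (expR (- (s * r `^ a^-1)))%:E)%E.
Proof.
move=> s0 a0.
pose A : set (R * R) := [set z | 0 <= z.1 /\ 0 <= z.2 /\ z.2 < (z.1 / s) `^ a].
have mfst : measurable_fun [set: R * R] (fst : R * R -> R) by exact: measurable_fst.
have msnd : measurable_fun [set: R * R] (snd : R * R -> R) by exact: measurable_snd.
have mA : measurable A.
  rewrite (_ : A = [set z | 0 <= z.1] `&` ([set z | 0 <= z.2] `&`
     [set z | 0 < (z.1 / s) `^ a - z.2])); last first.
    by apply/seteqP; split => z /=; rewrite subr_gt0.
  apply: measurableI; [|apply: measurableI].
  - rewrite (_ : [set z | _] = [set z | - z.1 <= 0]); last first.
      by apply/seteqP; split => z /=; rewrite oppr_le0.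
    by apply: measurable_le_set; exact: measurable_funN.
  - rewrite (_ : [set z | _] = [set z | - z.2 <= 0]); last first.
      by apply/seteqP; split => z /=; rewrite oppr_le0.
    by apply: measurable_le_set; exact: measurable_funN.
  - apply: measurable_gt_set; apply: measurable_funB => //.
    by apply: (measurableT_comp (measurable_powR _)); exact: measurable_funM.
pose f z : \bar R := (\1_A z * expR (- z.1))%:E.
have mf : measurable_fun [set: R * R] f.
  apply/measurable_EFinP; apply: measurable_funM; first exact: measurable_indic.
  by apply: (measurableT_comp (@measurable_expR R)); exact: measurable_funN.
have f0 z : (0 <= f z)%E by rewrite lee_fin mulr_ge0 ?expR_ge0.
transitivity (\int[mu]_x \int[mu]_r f (x, r))%E.
  rewrite integral_mkcond; apply: eq_integral => x _; rewrite patchE.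
  case: ifPn => [|xD].
    rewrite inE/= in_itv/= andbT => x0.
    have E r : f (x, r) = ((expR (- x))%:E * (\1_`[0, (x / s) `^ a[ r)%:E)%E.
      rewrite /f -EFinM mulrC; congr ((_ * _)%:E); rewrite !indicE; congr (_%:R).
      congr nat_of_bool; apply/idP/idP; rewrite !inE/= in_itv/=.
        by move=> [_ [h1 h2]]; rewrite h1 h2.
      by move=> /andP[h1 h2]; split.
    under eq_integral do rewrite E.
    rewrite ge0_integralZl//; try by rewrite lee_fin expR_ge0.
      2: by apply/measurable_EFinP; exact: measurable_indic.
    rewrite integral_indic// setIT; rewrite [X in (_ * X)%E]lebesgue_measure_itv/= lte_fin EFinM muleC.
    have := powR_ge0 (x / s) a; rewrite le_eqVlt => /predU1P[<-|->].
      by rewrite ltxx.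
    by rewrite -EFinB subr0.
  apply/esym; apply: integral0_eq => r _; rewrite /f indicE memNset ?mul0r//= => -[x0 _].
  by move: xD; rewrite notin_setE/= in_itv/= x0.
rewrite fubini_tonelli// [RHS]integral_mkcond.
apply: eq_integral => r _; rewrite patchE.
case: ifPn => [|rD]; last first.
  apply: integral0_eq => x _; rewrite /f indicE memNset ?mul0r//= => -[_ [r0 _]].
  by move: rD; rewrite notin_setE/= in_itv/= r0.
rewrite inE/= in_itv/= andbT => r0.
rewrite -integral_expRN_tail -integral_itv_obnd_cbnd; last first.
  apply/measurable_EFinP; apply: measurable_funTS.
  by apply: (measurableT_comp (@measurable_expR R)); exact: measurable_funN.
rewrite [RHS]integral_mkcond; apply: eq_integral => x _; rewrite patchE /f indicE.
have E : ((x, r) \in A) = (x \in `]s * r `^ a^-1, +oo[%classic).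
  apply/idP/idP; rewrite !inE/= in_itv/= andbT.
    by move=> [/= x0 [_ /=]]; rewrite lt_powR_inv ?divr_ge0// ?(ltW s0)// ltr_pdivlMr// mulrC.
  move=> h; have x0 : 0 <= x by rewrite (le_trans _ (ltW h))// mulr_ge0 ?powR_ge0// ltW.
  by split => //=; split => //=; rewrite lt_powR_inv ?divr_ge0// ?(ltW s0)// ltr_pdivlMr// mulrC.
by rewrite E; case: ifP => _; rewrite ?mul1r ?mul0r.
Qed.

(** Expresses s^(- a) through exponentials that are linear in s, so that a negative moment of a
    random s can be computed from its Laplace transform alone. *)
Lemma eGamma_integral_scale (s a : R) : 0 < s -> 0 < a ->
  ((s `^ (- a))%:E * eGamma_integral (a + 1) =
   \int[mu]_(r in `[0%R, +oo[) (expR (- (s * r `^ a^-1)))%:E)%E.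
Proof.
move=> s0 a0; rewrite -integral_powR_expRN// /eGamma_integral -ge0_integralZl//.
- apply: eq_integral => x; rewrite inE/= in_itv/= andbT => x0.
  rewrite -EFinM addrK; congr EFin; rewrite powRM ?invr_ge0 ?(ltW s0)//.
  by rewrite -powR_inv1 ?(ltW s0)// -powRrM mulN1r; ring.
- apply/measurable_EFinP; apply: measurable_funTS; apply: measurable_funM.
    exact: measurable_powR.
  by apply: measurableT_comp => //; exact: measurable_expR.
- by move=> x _; rewrite lee_fin mulr_ge0 ?powR_ge0 ?expR_ge0.
- by rewrite lee_fin powR_ge0.
Qed.

End LayerCake.

(** * The inverse stable subordinator: measurability, law and moments *)

Section InverseStableSubordinator.
Context {R : realType} {d : measure_display} {Omega : measurableType d}.
Variables (P : probability Omega R) (nu : R) (S : R -> Omega -> R).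
Hypotheses (nu_gt0 : 0 < nu) (S_stable : stable_subordinator P nu S).

Local Notation T := (inverse_process S).

Let mS (s : R) : 0 <= s -> measurable_fun [set: Omega] (S s).
Proof. by case: S_stable => -[h _ _ _ _] _; exact: h. Qed.

Let S_le w (s u : R) : 0 <= s -> s <= u -> S s w <= S u w.
Proof. by case: S_stable => -[_ _ h _ _] _; exact: h. Qed.

Let S_ge0 w (s : R) : 0 <= s -> 0 <= S s w.
Proof.
move=> s0; case: S_stable => -[_ h _ _ _] _.
by rewrite -(h w); exact: S_le.
Qed.

Lemma stable_laplace (g s : R) : 0 <= g -> 0 <= s ->
  (\int[P]_w (expR (- (g * S s w)))%:E = (expR (- (g `^ nu * s)))%:E)%E.
Proof.
move=> g0 s0; have [_ h] := S_stable.
have := h (- g) s; rewrite oppr_le0 normrN (ger0_norm g0) unlock => /(_ g0 s0) <-.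
by apply: eq_integral => w _ /=; rewrite mulNr.
Qed.

(** The exponential Markov inequality. With g and s free it yields that S is unbounded and positive
    at positive times, almost surely, as well as the exponential moments of T. *)
Lemma stable_chernoff (g s t : R) : 0 <= g -> 0 <= s ->
  (P [set w | (S s w <= t)%R] <= (expR (g * t - g `^ nu * s))%:E)%E.
Proof.
move=> g0 s0.
have mA : measurable [set w | S s w <= t] by exact: measurable_le_set (mS s0).
rewrite -[X in P X]setIT -integral_indic//.
have -> : ((expR (g * t - g `^ nu * s))%:E =
   \int[P]_w ((expR (g * t))%:E * (expR (- (g * S s w)))%:E))%E.
  rewrite ge0_integralZl//.
  - by rewrite stable_laplace// -EFinM -expRD.
  - apply/measurable_EFinP; apply: measurableT_comp; first exact: measurable_expR.
    by apply: measurableT_comp => //; apply: measurable_funM => //; exact: mS.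
apply: ge0_le_integral => //.
- by apply/measurable_EFinP; exact: measurable_indic.
- apply/measurable_EFinP; apply: measurable_funM => //.
  apply: measurableT_comp; first exact: measurable_expR.
  by apply: measurableT_comp => //; apply: measurable_funM => //; exact: mS.
- move=> w _; rewrite -EFinM lee_fin -expRD indicE.
  have [h|h] := boolP (w \in _); last by rewrite expR_ge0.
  move: h; rewrite inE/= => h.
  rewrite (le_trans _ (expR_ge1Dx _))// lerDl -mulrBr mulr_ge0// subr_ge0//.
Qed.

Lemma inverse_process_ge0 (t : R) w : 0 <= T t w.
Proof.
rewrite /inverse_process; set A := [set s | _].
have [->|/set0P A0] := eqVneq A set0; first by rewrite inf0.
by apply: lb_le_inf => // s [].
Qed.

Lemma lee_cvg0 (x : \bar R) (u : nat -> R) : u @ \oo --> 0 ->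
  (forall n, (x <= (u n)%:E)%E) -> (x <= 0)%E.
Proof.
move=> cu; case: x => [x| |] h.
- rewrite lee_fin -(cvg_lim _ cu)//; apply: limr_ge; first by apply/cvg_ex; exists 0.
  by apply: nearW => n; rewrite -lee_fin.
- by have := h 0%N; rewrite leye_eq.
- by rewrite leNye.
Qed.

(* Outside this null event [T t] is the infimum of a nonempty set. *)
Let bad (t : R) : set Omega := \bigcap_n [set w | S n%:R w <= t].

Let measurable_bad t : measurable (bad t).
Proof. by apply: bigcap_measurable => // n _; apply: measurable_le_set; exact: mS. Qed.

Let P_bad t : P (bad t) = 0.
Proof.
apply/eqP; rewrite eq_le measure_ge0 andbT.
apply: (@lee_cvg0 _ (fun n => expR t * expR (- n%:R))).
  by rewrite -[X in _ --> X](mulr0 (expR t)); apply: cvgMr; exact: cvgn_expR.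
move=> n; apply: (@le_trans _ _ (P [set w | (S n%:R w <= t)%R])).
  by apply: le_measure; rewrite ?inE//; [apply: measurable_le_set; exact: mS|
    move=> w /(_ n I)].
by have := @stable_chernoff 1 n%:R t ler01 (ler0n _ _); rewrite powR1 !mul1r expRD.
Qed.

Let good_ex t w : ~ bad t w -> exists n : nat, t < S n%:R w.
Proof.
by move=> /existsNP[n /not_implyP[_ /negP]]; rewrite -ltNge => h; exists n.
Qed.

Lemma inverse_process_le (t s : R) w : 0 <= s -> t < S s w -> T t w <= s.
Proof.
move=> s0 h; apply: ge_inf; last by split.
by exists 0 => u [].
Qed.

Let inverse_process_gt t s w : ~ bad t w -> T t w < s -> t < S s w.
Proof.
move=> /good_ex[n hn] Ts.
have : has_inf [set s | 0 <= s /\ t < S s w].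
  by split; [exists n%:R; split|exists 0 => u []].
move=> hinf; have Ts' : 0 < s - T t w by rewrite subr_gt0.
have [u [u0 tu]] := inf_adherent Ts' hinf; rewrite addrC subrK => us.
by rewrite (lt_le_trans tu)// S_le// ltW.
Qed.

(** The times s n / (n + 1) stay below s and approach it, which makes the union countable and the
    inequality strict. The event [bad t] belongs to the set because there T takes the default value
    0 of an empty infimum. *)
Let inverse_process_lt_set t s : 0 < s -> [set w | T t w < s] =
  bad t `|` \bigcup_n [set w | t < S (s * (n%:R / n.+1%:R)) w].
Proof.
move=> s0; apply/seteqP; split => w /=.
  move=> Ts; have [b|b] := pselect (bad t w); [by left|right].
  pose u := (T t w + s) / 2.
  have Tu : T t w < u by rewrite /u ltr_pdivlMr// mulr_natr mulr2n ltrD2l.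
  have us : u < s by rewrite /u ltr_pdivrMr// mulr_natr mulr2n ltrD2r.
  have u0 : 0 <= u by rewrite (le_trans (inverse_process_ge0 t w))// ltW.
  have [n hn] : exists n : nat, u <= s * (n%:R / n.+1%:R).
    have su : 0 < s - u by rewrite subr_gt0.
    (* The requirement u (n + 1) <= s n reads u <= n (s - u), and n (s - u) > s > u for this n. *)
    exists (Num.bound (s / (s - u))); set n := Num.bound _.
    have hn : s / (s - u) < n%:R by rewrite archi_boundP// divr_ge0// ltW.
    rewrite mulrA ler_pdivlMr// -natr1.
    by move: hn; rewrite ltr_pdivrMr// => hn; nra.
  exists n => //=; rewrite (lt_le_trans (inverse_process_gt b Tu))// S_le//.
move=> [b|[n _ /= h]].
  rewrite (_ : T t w = 0)// /inverse_process (_ : [set s | _] = set0) ?inf0//.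
  rewrite -subset0 => u [u0 /= tu].
  have [n hn] : exists n : nat, u <= n%:R.
    by exists (Num.bound u); rewrite ltW// archi_boundP.
  by have := b n I; rewrite /= leNgt (lt_le_trans tu)// S_le.
have n01 : n%:R / n.+1%:R < 1 :> R by rewrite ltr_pdivrMr// mul1r ltr_nat.
apply: (le_lt_trans (inverse_process_le _ h)).
  by rewrite mulr_ge0 ?divr_ge0// ltW.
by rewrite -[ltRHS]mulr1 ltr_pM2l.
Qed.

Lemma measurable_inverse_process (t : R) : measurable_fun [set: Omega] (T t).
Proof.
move=> mD; apply: (measurability _ (RGenInftyO.measurableE R)) => //.
move=> _ [_ [s ->] <-]; rewrite setTI.
rewrite (_ : _ @^-1` _ = [set w | T t w < s]); last first.
  by apply/seteqP; split => w /=; rewrite in_itv.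
have [s0|s0] := leP s 0.
  rewrite (_ : [set w | _] = set0)// -subset0 => w /=.
  by rewrite ltNge (le_trans s0 (inverse_process_ge0 t w)).
rewrite inverse_process_lt_set//; apply: measurableU => //.
apply: bigcup_measurable => n _; apply: measurable_gt_set; apply: mS.
by rewrite mulr_ge0 ?divr_ge0// ltW.
Qed.

Lemma inverse_process0 : P [set w | T 0 w != 0] = 0.
Proof.
have sub : [set w | T 0 w != 0] `<=` \bigcup_n [set w | S (n.+1%:R^-1) w <= 0].
  move=> w /= Tn0.
  have T0 : 0 < T 0 w by rewrite lt_neqAle eq_sym Tn0 inverse_process_ge0.
  exists (Num.bound (T 0 w)^-1) => //=; set n := Num.bound _.
  have hn : (T 0 w)^-1 < n.+1%:R.
    rewrite (lt_trans (y := n%:R)) ?ltr_nat//.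
    by rewrite archi_boundP// invr_ge0 ltW.
  rewrite leNgt; apply/negP => h.
  have n0 : 0 <= n.+1%:R^-1 :> R by rewrite invr_ge0.
  have := inverse_process_le n0 h.
  by rewrite leNgt -ltf_pV2 ?posrE ?invr_gt0// invrK hn.
have null n : P [set w | S (n.+1%:R^-1) w <= 0] = 0.
  have n0 : 0 < n.+1%:R^-1 :> R by rewrite invr_gt0.
  apply/eqP; rewrite eq_le measure_ge0 andbT.
  apply: (@lee_cvg0 _ (fun m => expR (- m%:R))); first exact: cvgn_expR.
  (* At level 0 and time 1 / (n + 1) this rate makes the exponent of the bound equal to - m, with m
     arbitrary. *)
  move=> m; have := @stable_chernoff ((m%:R * n.+1%:R) `^ nu^-1) n.+1%:R^-1 0 (powR_ge0 _ _) (ltW n0).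
  by rewrite -powRrM mulVf ?gt_eqF// powRr1// mulr0 add0r mulfK.
have negl : P.-negligible (\bigcup_n [set w | S (n.+1%:R^-1) w <= 0]).
  apply: negligible_bigcup => n; apply/negligibleP; last exact: null.
  by apply: measurable_le_set; apply: mS; rewrite invr_ge0.
have mT0 : measurable [set w | T 0 w != 0].
  rewrite (_ : [set w | _] = [set w | 0 < T 0 w]); last first.
    by apply/seteqP; split => w /=; rewrite lt_neqAle eq_sym inverse_process_ge0 andbT eq_sym.
  by apply: measurable_gt_set; exact: measurable_inverse_process.
by apply/negligibleP => //; exact: negligibleS sub negl.
Qed.

Let S1_pos : P [set w | S 1 w <= 0] = 0.
Proof.
apply/eqP; rewrite eq_le measure_ge0 andbT.
apply: (@lee_cvg0 _ (fun m => expR (- m%:R))); first exact: cvgn_expR.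
move=> m; have := @stable_chernoff (m%:R `^ nu^-1) 1 0 (powR_ge0 _ _) ler01.
by rewrite -powRrM mulVf ?gt_eqF// powRr1// mulr0 add0r mulr1.
Qed.

(** Both variables have the Laplace transform exp (- g^nu s). *)
Lemma stable_scaling (s t : R) : 0 < s -> 0 < t ->
  P [set w | t < S s w] = P [set w | t < s `^ nu^-1 * S 1 w].
Proof.
move=> s0 t0; apply: (@laplace_ccdf _ _ _ P (S s) (fun w => s `^ nu^-1 * S 1 w)); last exact: t0.
- by apply: mS; exact: ltW.
- by apply: measurable_funM => //; exact: mS.
- by move=> w; apply: S_ge0; exact: ltW.
- by move=> w; rewrite mulr_ge0 ?powR_ge0// S_ge0.
- move=> g g0; rewrite stable_laplace ?(ltW s0)//.
  under [in RHS]eq_integral do rewrite mulrA.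
  rewrite stable_laplace ?mulr_ge0 ?powR_ge0//.
  by rewrite powRM ?powR_ge0// -powRrM mulVf ?gt_eqF// powRr1 ?(ltW s0)// mulr1.
Qed.

(* [(t / S 1) `^ nu], with the law of [T t] by the self-similarity of [S]; it is 0 on
   the null event where [S 1] vanishes. *)
Definition stable_ratio (t : R) (w : Omega) : R := t `^ nu * S 1 w `^ (- nu).

Let mZ t : measurable_fun [set: Omega] (stable_ratio t).
Proof.
apply: measurable_funM => //.
by apply: (measurableT_comp (measurable_powR _)); exact: mS.
Qed.

Let le_setU (A B N : set Omega) : measurable A -> measurable B -> measurable N ->
  P N = 0 -> A `<=` B `|` N -> (P A <= P B)%E.
Proof.
move=> mA mB mN N0 sub; apply: (@le_trans _ _ (P (B `|` N))).
  by apply: le_measure; rewrite ?inE//; exact: measurableU.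
by rewrite (le_trans (measureU2 _ _ _))//= N0 adde0.
Qed.

Let measurable_ge_set (f : Omega -> R) (s : R) :
  measurable_fun [set: Omega] f -> measurable [set w | s <= f w].
Proof.
move=> mf; rewrite (_ : [set w | _] = [set w | - f w <= - s]); last first.
  by apply/seteqP; split => w /=; rewrite lerN2.
by apply: measurable_le_set; exact: measurable_funN.
Qed.

Let stable_le_scaled (s t : R) : 0 < s -> 0 < t ->
  P [set w | S s w <= t] = P [set w | s `^ nu^-1 * S 1 w <= t].
Proof.
move=> s0 t0.
have E (f : Omega -> R) : measurable_fun [set: Omega] f ->
    P [set w | f w <= t] = (1 - P [set w | (t < f w)%R])%E.
  move=> mf; rewrite -probability_setC; last exact: measurable_gt_set.
  by congr (P _); apply/seteqP; split => w /=; rewrite leNgt => /negP.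
rewrite !E ?stable_scaling//; first by apply: measurable_funM => //; exact: mS.
by apply: mS; exact: ltW.
Qed.

Let scaled_le_ratio (s t : R) w : 0 < s -> 0 < t -> 0 < S 1 w ->
  (s `^ nu^-1 * S 1 w <= t) = (s <= stable_ratio t w).
Proof.
move=> s0 t0 S10; rewrite /stable_ratio powRN ler_pdivlMr ?powR_gt0//.
have sE : s * S 1 w `^ nu = (s `^ nu^-1 * S 1 w) `^ nu.
  by rewrite powRM ?powR_ge0 ?(ltW S10)// -powRrM mulVf ?gt_eqF// powRr1// ltW.
have h : s `^ nu^-1 * S 1 w \in Num.nneg by rewrite nnegrE mulr_ge0 ?powR_ge0// ltW.
have h' : t \in Num.nneg by rewrite nnegrE ltW.
rewrite sE; apply/idP/idP => [|hle]; first exact: (ge0_ler_powR (ltW nu_gt0)).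
rewrite leNgt; apply/negP => hlt; move: hle; apply/negP; rewrite -ltNge.
exact: gt0_ltr_powR.
Qed.

(** Up to null events, S s <= t lies between s < T t and s <= T t, and by scaling it has the
    probability of s <= [stable_ratio t]. Hence strict and weak inequalities alternate here and in
    [inverse_ccdf_ge]. *)
Let inverse_ccdf_le (s t : R) : 0 < s -> 0 < t ->
  (P [set w | (s < T t w)%R] <= P [set w | (s <= stable_ratio t w)%R])%E.
Proof.
move=> s0 t0.
apply: (@le_trans _ _ (P [set w | (S s w <= t)%R])).
  apply: le_measure; rewrite ?inE.
  - by apply: measurable_gt_set; exact: measurable_inverse_process.
  - by apply: measurable_le_set; apply: mS; exact: ltW.
  - move=> w /= h; rewrite leNgt; apply/negP => /(inverse_process_le (ltW s0)).
    by rewrite leNgt h.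
rewrite stable_le_scaled//; apply: (le_setU _ _ _ S1_pos).
- by apply: measurable_le_set; apply: measurable_funM => //; exact: mS.
- by apply: measurable_ge_set; exact: mZ.
- by apply: measurable_le_set; exact: mS.
- move=> w /= h; have [h1|h1] := leP (S 1 w) 0; [by right|left].
  by rewrite -scaled_le_ratio.
Qed.

Let inverse_ccdf_ge (s t : R) : 0 < s -> 0 < t ->
  (P [set w | (s <= stable_ratio t w)%R] <= P [set w | (s <= T t w)%R])%E.
Proof.
move=> s0 t0.
apply: (@le_trans _ _ (P [set w | (S s w <= t)%R])).
  rewrite stable_le_scaled//; apply: (le_setU _ _ _ S1_pos).
  - by apply: measurable_ge_set; exact: mZ.
  - by apply: measurable_le_set; apply: measurable_funM => //; exact: mS.
  - by apply: measurable_le_set; exact: mS.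
  - move=> w /= h; have [h1|h1] := leP (S 1 w) 0; [by right|left].
    by rewrite scaled_le_ratio.
apply: (le_setU _ _ _ (P_bad t)).
- by apply: measurable_le_set; apply: mS; exact: ltW.
- by apply: measurable_ge_set; exact: measurable_inverse_process.
- exact: measurable_bad.
- move=> w /= h; have [b|b] := pselect (bad t w); [by right|left].
  rewrite leNgt; apply/negP => /(inverse_process_gt b).
  by rewrite ltNge h.
Qed.

(** The mismatch between strict and weak inequality is absorbed by moving s slightly to the right: s
    < X is the increasing union of the events s + 1 / (n + 1) < X. The points used are positive, so
    s = 0 is covered. *)
Let lee_ccdf (X Y : Omega -> R) : measurable_fun [set: Omega] X ->
  measurable_fun [set: Omega] Y ->
  (forall s : R, 0 < s -> (P [set w | (s < X w)%R] <= P [set w | (s <= Y w)%R])%E) ->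
  forall s : R, 0 <= s -> (P [set w | (s < X w)%R] <= P [set w | (s < Y w)%R])%E.
Proof.
move=> mX mY XY s s0.
have incr : nondecreasing_seq (fun n : nat => [set w | s + n.+1%:R^-1 < X w]).
  apply/nondecreasing_seqP => n; apply/subsetPset => w /=; apply: le_lt_trans.
  by rewrite lerD2l lef_pV2 ?posrE// ler_nat.
have mA n : measurable [set w | s + n.+1%:R^-1 < X w] by exact: measurable_gt_set.
have := nondecreasing_cvg_mu (mu := P) mA (bigcup_measurable (fun n _ => mA n)) incr.
rewrite (_ : \bigcup_n _ = [set w | s < X w]); last first.
  apply/seteqP; split => w /=.
    by move=> [n _ /=]; apply: lt_trans; rewrite ltrDl invr_gt0.
  move=> h; exists (Num.bound (X w - s)^-1) => //=; set n := Num.bound _.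
  have sX : 0 < X w - s by rewrite subr_gt0.
  have hn : (X w - s)^-1 < n.+1%:R.
    by rewrite (lt_trans (y := n%:R)) ?ltr_nat// archi_boundP// invr_ge0 ltW.
  by rewrite addrC -ltrBrDr -ltf_pV2 ?posrE ?invr_gt0// invrK.
move=> /cvg_lim <-//; apply: lime_le.
  apply: ereal_nondecreasing_is_cvgn; apply/nondecreasing_seqP => n.
  apply: le_measure; rewrite ?inE//.
  by apply/subsetPset; apply: incr; exact: leqnSn.
apply: nearW => n; have sn0 : 0 < s + n.+1%:R^-1 by rewrite ltr_wpDl// invr_gt0.
apply: le_trans (XY _ sn0) _; apply: le_measure; rewrite ?inE.
- exact: measurable_ge_set.
- exact: measurable_gt_set.
- by move=> w /=; apply: lt_le_trans; rewrite ltrDl invr_gt0.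
Qed.

Lemma inverse_ccdf (s t : R) : 0 <= s -> 0 < t ->
  P [set w | s < T t w] = P [set w | s < stable_ratio t w].
Proof.
move=> s0 t0; have mT := measurable_inverse_process t.
apply/eqP; rewrite eq_le; apply/andP; split; apply: lee_ccdf => // u u0.
  exact: inverse_ccdf_le.
apply: (le_trans _ (inverse_ccdf_ge u0 t0)).
apply: le_measure; rewrite ?inE.
- exact: measurable_gt_set.
- exact: measurable_ge_set.
- by move=> w /= /ltW.
Qed.

Let ge0_integral_eq_ccdf (X Y : Omega -> R) : measurable_fun [set: Omega] X ->
  measurable_fun [set: Omega] Y -> (forall w, 0 <= X w) -> (forall w, 0 <= Y w) ->
  (forall s, 0 <= s -> P [set w | s < X w] = P [set w | s < Y w]) ->
  (\int[P]_w (X w)%:E = \int[P]_w (Y w)%:E)%E.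
Proof.
move=> mX mY X0 Y0 XY.
pose X' : {RV P >-> R} := mfun_Sub (mem_set mX).
pose Y' : {RV P >-> R} := mfun_Sub (mem_set mY).
have := @ge0_expectation_ccdf _ _ _ P X' X0; rewrite unlock => ->.
have := @ge0_expectation_ccdf _ _ _ P Y' Y0; rewrite unlock => ->.
apply: eq_integral => s; rewrite inE/= in_itv/= andbT => s0.
have E (Z : {RV P >-> R}) : ccdf Z s = P [set w | s < Z w].
  rewrite /ccdf /distribution /pushforward; congr (P _).
  by apply/seteqP; split => w /=; rewrite in_itv/= andbT.
by rewrite !E; exact: XY.
Qed.

Lemma inverse_integral_pow (t : R) (m : nat) : 0 < t -> (0 < m)%N ->
  (\int[P]_w (T t w ^+ m)%:E = \int[P]_w (stable_ratio t w ^+ m)%:E)%E.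
Proof.
move=> t0 m0; have mT := measurable_inverse_process t.
have Z0 w : 0 <= stable_ratio t w by rewrite mulr_ge0 ?powR_ge0.
have T0 := inverse_process_ge0 t.
apply: ge0_integral_eq_ccdf.
- exact: measurable_funX.
- exact: measurable_funX.
- by move=> w; rewrite exprn_ge0.
- by move=> w; rewrite exprn_ge0.
move=> s s0.
have E (X : Omega -> R) : (forall w, 0 <= X w) ->
    [set w | s < X w ^+ m] = [set w | s `^ m%:R^-1 < X w].
  move=> X0; apply/seteqP; split => w /=;
    by rewrite -powR_mulrn// lt_powR_inv// ltr0n.
by rewrite !E// inverse_ccdf// powR_ge0.
Qed.

(* With a = m nu, the Laplace transform of [S 1] at r^(1/a) is integrated over r > 0
   in both orders. *)
Lemma stable_negative_moment (m : nat) : (0 < m)%N ->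
  (\int[P]_w (S 1 w `^ (- (m%:R * nu)))%:E * eGamma_integral (m%:R * nu + 1) =
   m`!%:R%:E)%E.
Proof.
move=> m0; set a := m%:R * nu.
have mR0 : 0 < m%:R :> R by rewrite ltr0n.
have a0 : 0 < a by rewrite mulr_gt0.
have mS1 : measurable_fun [set: Omega] (S 1) by exact: mS.
have G0 : (0 <= eGamma_integral (a + 1))%E.
  by apply: integral_ge0 => x _; rewrite lee_fin mulr_ge0 ?powR_ge0 ?expR_ge0.
rewrite -ge0_integralZr//; last 2 first.
- apply/measurable_EFinP; exact: (measurableT_comp (measurable_powR _)).
- by move=> w _; rewrite lee_fin powR_ge0.
pose f (z : Omega * R) : \bar R :=
  (\1_(`[0, +oo[ : set R) z.2 * expR (- (S 1 z.1 * z.2 `^ a^-1)))%:E.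
have mf : measurable_fun [set: Omega * R] f.
  apply/measurable_EFinP; apply: measurable_funM.
    by apply: (measurableT_comp (measurable_indic _)).
  apply: (measurableT_comp (@measurable_expR R)).
  apply: (measurableT_comp (@oppr_measurable R _)).
  apply: measurable_funM; first exact: (measurableT_comp mS1).
  exact: (measurableT_comp (measurable_powR _)).
have f0 z : (0 <= f z)%E by rewrite lee_fin mulr_ge0 ?expR_ge0.
have fE w : (\int[@lebesgue_measure R]_r f (w, r) =
    \int[@lebesgue_measure R]_(r in `[0%R, +oo[) (expR (- (S 1 w * r `^ a^-1)))%:E)%E.
  rewrite [RHS]integral_mkcond; apply: eq_integral => r _; rewrite patchE /f/= indicE.
  by case: ifP => _; rewrite ?mul1r ?mul0r.
transitivity (\int[P]_w \int[@lebesgue_measure R]_r f (w, r))%E.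
  apply: ge0_ae_eq_integral; first exact: measurableT.
  - apply: emeasurable_funM; last exact: measurable_cst.
    by apply/measurable_EFinP; exact: (measurableT_comp (measurable_powR _)).
  - exact: (@measurable_fun_fubini_tonelli_F _ _ _ _ _ (@lebesgue_measure R) f mf f0).
  - by move=> w _; rewrite mule_ge0// lee_fin powR_ge0.
  - by move=> w _; exact: integral_ge0.
  exists [set w | S 1 w <= 0]; split => //.
    exact: measurable_le_set.
  move=> w /= h; rewrite leNgt; apply/negP => S10; apply: h => _.
  by rewrite fE eGamma_integral_scale.
rewrite fubini_tonelli//.
transitivity (\int[@lebesgue_measure R]_(r in `[0%R, +oo[) (expR (- (1 * r `^ m%:R^-1)))%:E)%E.
  rewrite [RHS]integral_mkcond; apply: eq_integral => r _; rewrite patchE /f/=.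
  have [rD|rD] := boolP (r \in _); last first.
    apply: integral0_eq => w _; rewrite indicE.
    by rewrite (negbTE rD) mul0r.
  under eq_integral do rewrite indicE rD mul1r mulrC.
  rewrite stable_laplace ?powR_ge0//; congr ((expR (- _))%:E).
  rewrite mulr1 mul1r -powRrM /a invfM; congr (_ `^ _).
  by rewrite -mulrA mulVf ?gt_eqF// mulr1.
rewrite -eGamma_integral_scale// powR1 mul1e natr1.
exact: eGamma_integralS.
Qed.

(** The product of the negative moment of S 1 and the Gamma integral is m!, so neither factor can be
    0 or infinite; this settles the sign of Gamma and allows the division. The positivity is stated
    together with the moment because both come from that one identity. *)
Lemma Gamma_gt0_inverse_moment (m : nat) (t : R) : 0 <= t ->
  0 < Gamma (m%:R * nu + 1) :> R /\
  (\int[P]_w (T t w ^+ m)%:E =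
   (m`!%:R * (t `^ (m%:R * nu) / Gamma (m%:R * nu + 1)))%:E)%E.
Proof.
move=> t0; have [->|m0] := posnP m.
  rewrite mul0r add0r powRr0 fact0 -[1]/(1%:R) Gamma_natS fact0 divr1 mulr1.
  split => //; under eq_integral do rewrite expr0.
  by rewrite integral_cst// [X in (_ * X)%E]probability_setT mule1.
set a := m%:R * nu.
have mR0 : 0 < m%:R :> R by rewrite ltr0n.
have a0 : 0 < a by rewrite mulr_gt0.
have mf0 : 0 < m`!%:R :> R by rewrite ltr0n fact_gt0.
have := stable_negative_moment m0; rewrite -/a.
have : (0 <= \int[P]_w (S 1 w `^ (- a))%:E)%E.
  by apply: integral_ge0 => w _; rewrite lee_fin powR_ge0.
set M := (\int[P]_w _)%E => M0.
have : (0 <= eGamma_integral (a + 1))%E.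
  by apply: integral_ge0 => x _; rewrite lee_fin mulr_ge0 ?powR_ge0 ?expR_ge0.
have a10 : 0 < a + 1 by rewrite ltr_wpDl// ltW.
rewrite Gamma_eGamma//.
have MT : (\int[P]_w (T t w ^+ m)%:E = (t `^ a)%:E * M)%E.
  move: t0; rewrite le_eqVlt => /predU1P[<-|t0].
    rewrite powR0 ?gt_eqF// mul0e.
    rewrite -[RHS](@integral0 _ _ _ P setT); apply: ge0_ae_eq_integral => //.
    - apply/measurable_EFinP; apply: measurable_funX.
      exact: measurable_inverse_process.
    - by move=> w _; rewrite lee_fin exprn_ge0// inverse_process_ge0.
    exists [set w | T 0 w != 0]; split.
    - rewrite (_ : [set w | _] = ~` [set w | T 0 w <= 0]).
        apply: measurableC; apply: measurable_le_set.
        exact: measurable_inverse_process.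
      apply/seteqP; split => w /=; rewrite eq_le inverse_process_ge0 andbT => /negP//.
    - exact: inverse_process0.
    - by move=> w /= h; apply/eqP => T0; apply: h => _; rewrite T0 expr0n gtn_eqF.
  rewrite inverse_integral_pow// -ge0_integralZl//.
  - apply: eq_integral => w _; rewrite -EFinM /stable_ratio exprMn.
    rewrite -!powR_mulrn ?powR_ge0// -!powRrM (mulrC nu) /a.
    by congr ((_ * _ `^ _)%:E); ring.
  - by apply/measurable_EFinP; exact: (measurableT_comp (measurable_powR _) (mS ler01)).
  - by move=> w _; rewrite lee_fin powR_ge0.
  - by rewrite lee_fin powR_ge0.
case: (eGamma_integral (a + 1)) => [c| |]// c0.
  move=> Mc; have cn0 : c != 0.
    apply/eqP => c00; move: Mc; rewrite c00 mule0 => /eqP.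
    by rewrite eqe lt_eqF.
  have cp : 0 < c by rewrite lt_neqAle eq_sym cn0 -lee_fin.
  rewrite /= cp; split => //; rewrite MT.
  move: M0 Mc; case: M {MT} => [x| |]// x0.
    rewrite -EFinM => -[Mc]; rewrite -EFinM; congr EFin.
    by rewrite -Mc; field.
  by rewrite gt0_mulye ?lte_fin.
move: M0; rewrite le_eqVlt => /predU1P[<-|Mp].
  by rewrite mul0e => /eqP; rewrite eqe lt_eqF.
by rewrite gt0_muley.
Qed.

(** On n + 1 <= T < n + 2 the integrand is at most exp (K (n + 2)), while n < T forces S n <= t,
    whose probability decays exponentially in n at a rate that can be chosen. *)
Lemma inverse_integral_expR (K t : R) : 0 <= K -> 0 <= t ->
  (\int[P]_w (expR (K * T t w))%:E < +oo)%E.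
Proof.
move=> K0 t0; have mT := measurable_inverse_process t.
(* With g^nu = K + 1 the Chernoff bound beats the growth exp (K n) by exp (- n), leaving the
   constant [C] times a geometric series. *)
pose g := (K + 1) `^ nu^-1.
have gE : g `^ nu = K + 1.
  by rewrite /g -powRrM mulVf ?gt_eqF// powRr1// addr_ge0.
pose C := expR (2 * K + g * t).
pose u (n : nat) w : \bar R := (expR (K * n.+2%:R) * \1_[set w | n%:R < T t w] w)%:E.
have mA n : measurable [set w | n%:R < T t w] by exact: measurable_gt_set.
have mu n : measurable_fun [set: Omega] (u n).
  by apply/measurable_EFinP; apply: measurable_funM => //; exact: measurable_indic.
have u0 n w : (0 <= u n w)%E by rewrite lee_fin mulr_ge0 ?expR_ge0.
have bound w : ((expR (K * T t w))%:E <= (expR K)%:E + \sum_(0 <= n <oo) u n w)%E.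
  have T0 := inverse_process_ge0 t w.
  have [T1|T1] := leP (T t w) 1.
    apply: (@le_trans _ _ (expR K)%:E).
      by rewrite lee_fin ler_expR -[leRHS]mulr1 ler_wpM2l.
    by rewrite leeDl// nneseries_ge0// => n _ _; exact: u0.
  have /andP[nT Tn] := truncn_itv T0.
  have n1 : (0 < Num.truncn (T t w))%N by rewrite truncn_gt0 ltW.
  case: (Num.truncn (T t w)) n1 nT Tn => // n _ nT Tn.
  apply: (@le_trans _ _ (\sum_(0 <= n <oo) u n w)%E); last by rewrite leeDr// lee_fin expR_ge0.
  apply: (le_trans _ (nneseries_lim_ge n.+1 (fun n _ _ => u0 n w))).
  rewrite big_nat_recr//=; apply: (@le_trans _ _ (u n w)); last first.
    by rewrite leeDr// sume_ge0.
  rewrite /u indicE mem_set/=; last by rewrite (lt_le_trans _ nT)// ltr_nat.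
  by rewrite mulr1 lee_fin ler_expR ler_wpM2l// ltW.
apply: (@le_lt_trans _ _ (\int[P]_w ((expR K)%:E + \sum_(0 <= n <oo) u n w))%E).
  apply: ge0_le_integral => //.
  - apply/measurable_EFinP; apply: (measurableT_comp (@measurable_expR R)).
    exact: measurable_funM.
  - apply: emeasurable_funD => //.
    exact: ge0_emeasurable_sum.
rewrite ge0_integralD//; last 2 first.
- by move=> w _; apply: nneseries_ge0 => n _ _; exact: u0.
- exact: ge0_emeasurable_sum.
rewrite integral_cst// [X in (_ * X + _)%E]probability_setT mule1 integral_nneseries//.
pose z : R := expR (-1).
have z1 : z < 1 by rewrite /z expR_lt1 oppr_lt0.
have z0 : 0 <= z by exact: expR_ge0.
have h n : (\int[P]_w u n w <= (C * z ^+ n)%:E)%E.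
  rewrite /u; under eq_integral do rewrite EFinM.
  rewrite ge0_integralZl//; last by apply/measurable_EFinP; exact: measurable_indic.
  rewrite integral_indic// setIT.
  have n0 : 0 <= n%:R :> R by [].
  apply: (@le_trans _ _ ((expR (K * n.+2%:R))%:E * P [set w | (S n%:R w <= t)%R])%E).
    apply: lee_wpmul2l; first by rewrite lee_fin expR_ge0.
    apply: le_measure; rewrite ?inE//.
      by apply: measurable_le_set; exact: mS.
    move=> w /= nT; rewrite leNgt; apply/negP => /(inverse_process_le n0).
    by rewrite leNgt nT.
  apply: (@le_trans _ _ ((expR (K * n.+2%:R))%:E * (expR (g * t - g `^ nu * n%:R))%:E)%E).
    apply: lee_wpmul2l; first by rewrite lee_fin expR_ge0.
    by apply: stable_chernoff => //; exact: powR_ge0.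
  rewrite -EFinM -expRD /C /z -expRM_natl -expRD lee_fin ler_expR gE.
  have -> : n.+2%:R = n%:R + 2 :> R by rewrite -addn2 natrD.
  by rewrite le_eqVlt; apply/orP; left; apply/eqP; ring.
apply: lte_add_pinfty; first exact: ltry.
apply: (@le_lt_trans _ _ (C / (1 - z))%:E); last exact: ltry.
apply: lime_le.
  by apply: is_cvg_nneseries => n _ _; exact: integral_ge0.
apply: nearW => n; apply: (@le_trans _ _ (\sum_(0 <= i < n) (C * z ^+ i)%:E)%E).
  exact: lee_sum.
rewrite sumEFin lee_fin -mulr_sumr ler_wpM2l ?expR_ge0// big_mkord.
have z10 : 0 < 1 - z by rewrite subr_gt0.
rewrite -[leRHS]mul1r ler_pdivlMr//.
have := subrX1 z n; rewrite -opprB -[RHS]opprK -mulNr opprB => E.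
have : 0 <= z ^+ n by exact: exprn_ge0.
nra.
Qed.

End InverseStableSubordinator.

(** * The law of a chain at an independent random time *)

Section TimeChange.
Context {R : realType} {d : measure_display} {Omega : measurableType d}.
Variables (P : probability Omega R) (X : R -> Omega -> int) (T : R -> Omega -> R).
Variable p : R -> int -> int -> R.
Hypothesis mX : forall (t : R) n, 0 <= t -> measurable [set w | X t w = n].
Hypothesis X_rcont : forall w (t : R), 0 <= t -> \forall u \near t^'+, X u w = X t w.
Hypothesis p_itv : forall (t : R) k n, 0 <= t -> 0 <= p t k n <= 1.
Hypothesis p_rcont : forall k n (t : R), 0 <= t -> p u k n @[u --> t^'+] --> p t k n.
Hypothesis X_markov : homogeneous_markov P X p.
Hypothesis XT_indep : independent_processes P X T.
Hypothesis mT : forall t : R, measurable_fun [set: Omega] (T t).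
Hypothesis T_ge0 : forall (t : R) w, 0 <= T t w.

Lemma nneseries_single (f : nat -> \bar R) (j : nat) :
  (forall i, i != j -> f i = 0%E) -> (\sum_(0 <= i <oo) f i = f j)%E.
Proof.
move=> f0; apply: lim_near_cst => //; exists j.+1 => // n /= jn.
rewrite (@big_cat_nat _ _ _ j)//=; last exact: ltnW.
rewrite big_nat big1 ?add0e; last by move=> i /andP[_ ij]; rewrite f0// ltn_eqF.
rewrite big_ltn// big_nat big1 ?adde0// => i /andP[ij _].
by rewrite f0// gtn_eqF.
Qed.

Variables (t : R) (k n : int).
Hypothesis t_ge0 : 0 <= t.

(* T t is approximated from the right by points of a grid, because X and p are only
   right-continuous. *)
Let step (m i : nat) : R := i.+1%:R / m.+1%:R.
Let idx (m : nat) w : nat := Num.truncn (m.+1%:R * T t w).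
Let tau (m : nat) w : R := step m (idx m w).
Let cell (m i : nat) : set R := [set r | i%:R <= m.+1%:R * r < i.+1%:R].

Let step_ge0 m i : 0 <= step m i. Proof. by rewrite divr_ge0. Qed.

Let measurable_cell m i : measurable (cell m i).
Proof.
rewrite (_ : cell m i = `[i%:R / m.+1%:R, i.+1%:R / m.+1%:R[%classic)//.
apply/seteqP; split => r /=; rewrite in_itv/= ler_pdivrMr// ltr_pdivlMr//;
  by rewrite mulrC.
Qed.

Let cellE m i w : cell m i (T t w) -> idx m w = i.
Proof. by move=> /truncn_def. Qed.

Let cell_idx m w : cell m (idx m w) (T t w).
Proof. by rewrite /cell /=; apply: truncn_itv; rewrite mulr_ge0. Qed.

Let tau_cvg w : (fun m => tau m w) @ \oo --> (T t w)^'+.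
Proof.
move=> Q [e /= e0 H].
exists (Num.bound e^-1) => // m /= hm.
have m0 : 0 < m.+1%:R :> R by [].
have /andP[c1 c2] := cell_idx m w.
have lt1 : T t w < tau m w by rewrite /tau /step ltr_pdivlMr// mulrC.
have lt2 : tau m w <= T t w + m.+1%:R^-1.
  by rewrite /tau /step ler_pdivrMr// mulrDl mulVf// mulrC -natr1 lerD2r.
apply: H => //=; rewrite ltr0_norm ?subr_lt0// opprB ltrBlDl.
rewrite (le_lt_trans lt2)// ltrD2l -[ltRHS]invrK ltf_pV2 ?posrE ?invr_gt0//.
rewrite (lt_le_trans (archi_boundP _))// ?invr_ge0 ?(ltW e0)//.
by rewrite ler_nat (leq_trans hm).
Qed.

Let good m i := [set w | X 0 w = k] `&` [set w | X (step m i) w = n] `&`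
  [set w | cell m i (T t w)].

Let measurable_good m i : measurable (good m i).
Proof.
apply: measurableI; first by apply: measurableI; exact: mX.
exact: measurable_preimage_set.
Qed.

(** On one cell the approximating time is deterministic, so finite-dimensional independence applies,
    together with the Markov property at time 0 with empty history. *)
Let P_good m i : P (good m i) =
  (P [set w | X 0 w = k] * ((p (step m i) k n)%:E * P [set w | cell m i (T t w)]))%E.
Proof.
have := @XT_indep 2 (fun j => if j == ord0 then 0 else step m i)
  (fun j => if j == ord0 then k else n) 1 (fun=> t) (fun=> cell m i).
have h1 : forall j : 'I_2, 0 <= (if j == ord0 then 0 else step m i) :> R.
  by move=> j; case: ifP.
move=> /(_ h1 (fun=> t_ge0) (fun=> measurable_cell m i)) /= h.
have -> : good m i = [set w | forall j : 'I_2,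
      X (if j == ord0 then 0 else step m i) w = (if j == ord0 then k else n)] `&`
    [set w | 'I_1 -> cell m i (T t w)].
  apply/seteqP; split => w /=.
    by move=> [[h2 h3] h4]; split => // j; case: ifP.
  by move=> [h2 h3]; split; [split; [exact: (h2 ord0)|exact: (h2 ord_max)]|exact: (h3 ord0)].
rewrite h muleA; congr (_ * _)%E; last first.
  by congr (P _); apply/seteqP; split => w /=; [move=> /(_ ord0)|].
have := @X_markov 0 (fun=> 0) (fun=> 0) 0 (step m i) k n.
move=> /(_ _ (lexx _) (step_ge0 m i)) /=.
rewrite add0r => hm.
transitivity (P ([set w | ('I_0 -> X 0 w = 0) /\ X 0 w = k] `&` [set w | X (step m i) w = n])).
  congr (P _); apply/seteqP; split => w /=.
    by move=> h2; split; [split; [case|exact: (h2 ord0)]|exact: (h2 ord_max)].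
  by move=> [[_ h2] h3] j; case: ifP.
rewrite hm; last by case.
by congr (P _ * _)%E; apply/seteqP; split => w /=; [case|split => //; case].
Qed.

Let u m w : \bar R := (\1_([set w | X 0 w = k] `&` [set w | X (tau m w) w = n]) w)%:E.

Let uE m w : u m w = (\sum_(0 <= i <oo) (\1_(good m i) w)%:E)%E.
Proof.
rewrite (@nneseries_single _ (idx m w)).
  rewrite /u !indicE; congr ((_ : nat)%:R%:E); congr nat_of_bool.
  apply/idP/idP; rewrite !inE/=.
    by move=> [h1 h2]; split => //; exact: cell_idx.
  by move=> [[h1 h2] h3]; split.
move=> i ij; rewrite indicE memNset// => -[_ /cellE] h.
by rewrite h eqxx in ij.
Qed.

Let v m w : \bar R := (p (tau m w) k n)%:E.

Let vE m w : v m w =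
  (\sum_(0 <= i <oo) ((p (step m i) k n)%:E * (\1_[set w | cell m i (T t w)] w)%:E))%E.
Proof.
rewrite (@nneseries_single _ (idx m w)).
  by rewrite indicE mem_set ?mule1//; exact: cell_idx.
move=> i ij; rewrite indicE memNset ?mule0// => /cellE h.
by rewrite h eqxx in ij.
Qed.

Let mv m i : measurable_fun [set: Omega]
  (fun w => (p (step m i) k n)%:E * (\1_[set w | cell m i (T t w)] w)%:E)%E.
Proof.
apply/measurable_EFinP; apply: measurable_funM => //.
by apply: measurable_indic; exact: measurable_preimage_set.
Qed.

Let v_ge0 m i w : (0 <= (p (step m i) k n)%:E * (\1_[set w | cell m i (T t w)] w)%:E)%E.
Proof.
rewrite -EFinM lee_fin mulr_ge0//.
by have /andP[] := p_itv k n (step_ge0 m i).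
Qed.

Let integral_u m : (\int[P]_w u m w = P [set w | X 0 w = k] * \int[P]_w v m w)%E.
Proof.
under eq_integral do rewrite uE.
under [in RHS]eq_integral do rewrite vE.
rewrite !integral_nneseries//; last first.
  by move=> i; apply/measurable_EFinP; exact: measurable_indic.
have -> : P [set w | X 0 w = k] = (fine (P [set w | X 0 w = k]))%:E.
  by rewrite fineK// fin_num_measure//; exact: mX.
rewrite -nneseriesZl; last first.
  by move=> i _; apply: integral_ge0 => w _; exact: v_ge0.
apply: eq_eseriesr => i _.
have -> : (\int[P]_w (\1_(good m i) w)%:E = P (good m i))%E.
  by rewrite integral_indic// setIT.
rewrite P_good fineK ?fin_num_measure//; last exact: mX.
congr (_ * _)%E.
rewrite ge0_integralZl//.
- rewrite integral_indic ?setIT//; exact: measurable_preimage_set.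
- by apply/measurable_EFinP/measurable_indic; exact: measurable_preimage_set.
- by rewrite lee_fin; have /andP[] := p_itv k n (step_ge0 m i).
Qed.

Let target := [set w | X 0 w = k] `&` [set w | X (T t w) w = n].

Let u_cvg w : u m w @[m --> \oo] --> (\1_target w)%:E.
Proof.
apply: cvg_near_cst; near=> m.
have h : X (tau m w) w = X (T t w) w by near: m; exact: (tau_cvg (X_rcont w (T_ge0 t w))).
by rewrite /u !indicE; congr ((_ : nat)%:R%:E); congr nat_of_bool;
  apply/idP/idP; rewrite !inE/= h.
Unshelve. all: by end_near. Qed.

Let v_cvg w : v m w @[m --> \oo] --> (p (T t w) k n)%:E.
Proof.
apply/cvg_EFin; first exact: nearW.
have h := @p_rcont k n _ (T_ge0 t w).
rewrite (_ : _ \o _ = (fun x => p x k n) \o tau ^~ w); last exact/funext.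
exact: (cvg_comp _ _ (@tau_cvg w) h).
Qed.

(** As the paths are right-continuous with discrete values, X at the grid times eventually equals
    its value at T t; the event is thus the lower limit of events that are countable unions over the
    cells. *)
Lemma measurable_time_change_state : measurable [set w | X (T t w) w = n].
Proof.
pose E m := [set w | X (tau m w) w = n].
have mE m : measurable (E m).
  rewrite (_ : E m = \bigcup_i ([set w | X (step m i) w = n] `&`
    [set w | cell m i (T t w)])).
    apply: bigcup_measurable => i _; apply: measurableI; first exact: mX.
    exact: measurable_preimage_set.
  apply/seteqP; split => w /=; first by move=> h; exists (idx m w) => //; split => //; exact: cell_idx.
  by move=> [i _ [h1 /cellE h2]]; rewrite /E/= /tau h2.
rewrite (_ : [set w | _] = \bigcup_M \bigcap_(m in [set m | (M <= m)%N]) E m).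
  apply: bigcup_measurable => M _.
  by apply: bigcap_measurable => [|m _]; [exists M => /=|exact: mE].
apply/seteqP; split => w /=.
  move=> h; have [M _ hM] := tau_cvg (X_rcont w (T_ge0 t w)).
  by exists M => // m /= Mm; rewrite /E/= (hM m Mm).
move=> [M _ h]; have [M' _ hM] := tau_cvg (X_rcont w (T_ge0 t w)).
rewrite -(hM (maxn M M')) /= ?leq_maxr//.
by apply: h => /=; rewrite leq_maxl.
Qed.

(** The identity holds for each grid by summing over the cells; both sides pass to the limit by
    dominated convergence, with the constant 1 as majorant. *)
Lemma time_change_law :
  (P target = P [set w | X 0 w = k] * \int[P]_w (p (T t w) k n)%:E)%E.
Proof.
have mtarget : measurable target.
  by apply: measurableI; [exact: mX|exact: measurable_time_change_state].
have mu m : measurable_fun [set: Omega] (u m).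
  rewrite (_ : u m = fun w => \sum_(0 <= i <oo) (\1_(good m i) w)%:E)%E; last first.
    by apply/funext => w; exact: uE.
  apply: ge0_emeasurable_sum => // i _.
  by apply/measurable_EFinP; exact: measurable_indic.
have mvm m : measurable_fun [set: Omega] (v m).
  rewrite (_ : v m = fun w => \sum_(0 <= i <oo)
    ((p (step m i) k n)%:E * (\1_[set w | cell m i (T t w)] w)%:E))%E; last first.
    by apply/funext => w; exact: vE.
  by apply: ge0_emeasurable_sum => // i w _ _; exact: v_ge0.
have cu : (fun m => \int[P]_w u m w)%E @ \oo --> (\int[P]_w (\1_target w)%:E)%E.
  apply: (@dominated_cvg _ _ _ P setT measurableT _ _ (cst 1%E)) => //.
  - exact: finite_measure_integrable_cst.
  - by move=> m w _ /=; rewrite lee_fin indicE ger0_norm// lern1 leq_b1.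
have cv : (fun m => \int[P]_w v m w)%E @ \oo --> (\int[P]_w (p (T t w) k n)%:E)%E.
  apply: (@dominated_cvg _ _ _ P setT measurableT _ _ (cst 1%E)) => //.
  - exact: finite_measure_integrable_cst.
  - move=> m w _ /=; have /andP[h1 h2] := p_itv k n (step_ge0 m (idx m w)).
    by rewrite lee_fin ger0_norm.
rewrite -[target]setIT -integral_indic//.
apply: (cvg_unique _ cu); first exact: ereal_hausdorff.
rewrite (_ : (fun m => \int[P]_w u m w)%E =
  (fun m => P [set w | X 0 w = k] * \int[P]_w v m w)%E); last first.
  by apply/funext => m; exact: integral_u.
apply: cvgeZl => //; rewrite fin_num_measure//; exact: mX.
Qed.

End TimeChange.

(** * The exponential series grouped by parity *)

Section EvenOddExponentialTerms.
Context {R : realType}.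

Definition even_term (k : nat) (x : R) : R := x ^+ k.*2 / (k.*2)`!%:R.
Definition odd_term (k : nat) (x : R) : R := x ^+ k.*2.+1 / (k.*2.+1)`!%:R.

Lemma even_term_ge0 k x : 0 <= x -> 0 <= even_term k x.
Proof. by move=> x0; rewrite divr_ge0// exprn_ge0. Qed.

Lemma odd_term_ge0 k x : 0 <= x -> 0 <= odd_term k x.
Proof. by move=> x0; rewrite divr_ge0// exprn_ge0. Qed.

Lemma sum_double (u : nat -> R) (n : nat) :
  \sum_(i < n.*2) u i = \sum_(k < n) (u k.*2 + u k.*2.+1).
Proof.
elim: n => [|n IH]; first by rewrite !big_ord0.
by rewrite doubleS !big_ord_recr/= IH addrA.
Qed.

Lemma cvg_double (u : nat -> R) (l : R) : u @ \oo --> l -> (fun n => u n.*2) @ \oo --> l.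
Proof.
move=> ul; apply: (cvg_comp _ _ _ ul) => A [N _ NA].
by exists N => // n /= Nn; apply: NA => /=; rewrite (leq_trans Nn)// -addnn leq_addr.
Qed.

Lemma cvg_pow_fact_sum (x : R) :
  (fun n => \sum_(i < n) x ^+ i / i`!%:R) @ \oo --> expR x.
Proof.
have := is_cvg_series_exp_coeff x; rewrite /expR => h.
rewrite (_ : (fun n => _) = series (exp_coeff x))//.
by apply/funext => n; rewrite /series/= big_mkord.
Qed.

Lemma pow_fact_sum_le (x : R) n : 0 <= x -> \sum_(i < n) x ^+ i / i`!%:R <= expR x.
Proof.
move=> x0; have := @cvg_pow_fact_sum x.
have nd : nondecreasing_seq (fun n => \sum_(i < n) x ^+ i / i`!%:R).
  by apply/nondecreasing_seqP => m; rewrite big_ord_recr/= lerDl divr_ge0// exprn_ge0.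
move=> c; rewrite -(cvg_lim _ c)//; apply: (nondecreasing_cvgn_le nd).
by apply/cvg_ex; exists (expR x).
Qed.

Lemma even_odd_sum_le (x : R) n : 0 <= x ->
  \sum_(k < n) (even_term k x + odd_term k x) <= expR x.
Proof. by move=> x0; rewrite -(sum_double (fun i => x ^+ i / i`!%:R)) pow_fact_sum_le. Qed.

Lemma even_odd_sum_cvg (x : R) :
  (fun n => \sum_(k < n) (even_term k x + odd_term k x)) @ \oo --> expR x.
Proof.
have := cvg_double (@cvg_pow_fact_sum x).
by under eq_fun do rewrite (sum_double (fun i => x ^+ i / i`!%:R)).
Qed.

Lemma even_odd_diff_cvg (x : R) :
  (fun n => \sum_(k < n) (even_term k x - odd_term k x)) @ \oo --> expR (- x).
Proof.
have := @even_odd_sum_cvg (- x).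
rewrite (_ : (fun n => \sum_(k < n) (even_term k (- x) + odd_term k (- x))) =
  (fun n => \sum_(k < n) (even_term k x - odd_term k x)))//.
apply/funext => n; apply: eq_bigr => k _; rewrite /even_term /odd_term.
rewrite !exprS -!mul2n !exprM sqrrN mulNr; congr (_ + _).
by rewrite mulNr.
Qed.

Lemma nonneg_sum_is_cvg (u : nat -> R) (B : R) : (forall k, 0 <= u k) ->
  (forall n, \sum_(k < n) u k <= B) -> cvgn (fun n => \sum_(k < n) u k).
Proof.
move=> u0 uB; apply: nondecreasing_is_cvgn.
  by apply/nondecreasing_seqP => m; rewrite big_ord_recr/= lerDl.
by exists B => _ [n _ <-].
Qed.

Lemma abs_sum_is_cvg (u : nat -> R) (B : R) :
  (forall n, \sum_(k < n) `|u k| <= B) -> cvgn (fun n => \sum_(k < n) u k).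
Proof.
move=> uB; have := @nonneg_sum_is_cvg (fun k => `|u k|) B (fun k => normr_ge0 _) uB.
have E (v : nat -> R) : (fun n => \sum_(k < n) v k) = series v.
  by apply/funext => n; rewrite /series/= big_mkord.
rewrite (E (fun k => `|u k|)) (E u); exact: normed_cvg.
Qed.

End EvenOddExponentialTerms.

(** * Expectations of series in a variable with all exponential moments *)

Section ExpectationOfSeries.
Context {R : realType} {d : measure_display} {Omega : measurableType d}.
Variables (P : probability Omega R) (tau : Omega -> R).
Hypothesis mtau : measurable_fun [set: Omega] tau.
Hypothesis tau_ge0 : forall w, 0 <= tau w.
Hypothesis exp_moments :
  forall K : R, 0 <= K -> (\int[P]_w (expR (K * tau w))%:E < +oo)%E.

Definition expect (f : R -> R) : R := fine (\int[P]_w (f (tau w))%:E)%E.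

(** A class of functions, closed under the operations needed, whose composition with [tau] is
    integrable; the bound is asked only on the half-line where [tau] takes its values. *)
Definition exp_bounded (f : R -> R) : Prop :=
  measurable_fun [set: R] f /\ exists C K, [/\ 0 <= C, 0 <= K &
    forall x : R, 0 <= x -> `|f x| <= C * expR (K * x)].

Let integrable_expR C K : 0 <= K ->
  P.-integrable [set: Omega] (fun w => (C * expR (K * tau w))%:E).
Proof.
move=> K0; rewrite (_ : (fun w => _) = (fun w => C%:E * (expR (K * tau w))%:E)%E)//.
apply: integrableZl => //; apply/integrableP; split.
  apply/measurable_EFinP; apply: (measurableT_comp (@measurable_expR R)).
  exact: measurable_funM.
rewrite (eq_integral (fun w => (expR (K * tau w))%:E)); first exact: exp_moments.
by move=> w _; rewrite gee0_abs// lee_fin expR_ge0.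
Qed.

Lemma exp_bounded_integrable f : exp_bounded f ->
  P.-integrable [set: Omega] (fun w => (f (tau w))%:E).
Proof.
move=> [mf [C [K [C0 K0 fCK]]]].
apply: (@le_integrable _ _ _ P setT measurableT _ (fun w => (C * expR (K * tau w))%:E)).
- by apply/measurable_EFinP; exact: (measurableT_comp mf).
- move=> w _ /=; rewrite lee_fin (ger0_norm (mulr_ge0 C0 (expR_ge0 _))).
  exact: fCK.
- exact: integrable_expR.
Qed.

Lemma expectD f g : exp_bounded f -> exp_bounded g ->
  expect (fun x => f x + g x) = expect f + expect g.
Proof.
move=> /exp_bounded_integrable hf /exp_bounded_integrable hg.
rewrite /expect -fineD; try exact: integrable_fin_num.
by congr fine; rewrite -integralD//; apply: eq_integral => w _; rewrite EFinD.
Qed.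

Lemma expectZ c f : exp_bounded f -> expect (fun x => c * f x) = c * expect f.
Proof.
move=> /exp_bounded_integrable hf; rewrite /expect.
under eq_integral do rewrite EFinM.
by rewrite integralZl// fineM//; exact: integrable_fin_num.
Qed.

(** Dominated convergence with one exponential majorant for all partial sums of absolute values.
    Nothing is assumed on g off the half-line, so its measurability is obtained only after
    composition with [tau], as a limit, and integrability is part of the conclusion. *)
Lemma expect_series (f : nat -> R -> R) (g : R -> R) (C K : R) :
  (forall l, measurable_fun [set: R] (f l)) -> 0 <= C -> 0 <= K ->
  (forall n (x : R), 0 <= x -> \sum_(l < n) `|f l x| <= C * expR (K * x)) ->
  (forall x : R, 0 <= x -> (fun n => \sum_(l < n) f l x) @ \oo --> g x) ->
  P.-integrable [set: Omega] (fun w => (g (tau w))%:E) /\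
  (fun n => \sum_(l < n) expect (f l)) @ \oo --> expect g.
Proof.
move=> mf C0 K0 fB fg.
have bf l : exp_bounded (f l).
  split; first exact: mf.
  exists C, K; split => // x x0; apply: le_trans (fB l.+1 x x0).
  by rewrite big_ord_recr/= lerDr sumr_ge0.
pose F n (w : Omega) : \bar R := (\sum_(l < n) f l (tau w))%:E.
have FE n : (\int[P]_w F n w = (\sum_(l < n) expect (f l))%:E)%E.
  rewrite /F; under eq_integral do rewrite -sumEFin.
  rewrite integral_sum//; last by move=> l; exact: exp_bounded_integrable.
  rewrite -sumEFin; apply: eq_bigr => l _; rewrite /expect fineK//.
  by apply: integrable_fin_num => //; exact: exp_bounded_integrable.
have FB n w : (`|F n w| <= (C * expR (K * tau w))%:E)%E.
  by rewrite /F /= lee_fin (le_trans (ler_norm_sum _ _ _))// fB.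
have mF n : measurable_fun [set: Omega] (F n).
  apply/measurable_EFinP; apply: measurable_sum => l.
  exact: (measurableT_comp (mf l)).
have Fg w : F n w @[n --> \oo] --> (g (tau w))%:E.
  by apply/cvg_EFin; [exact: nearW|exact: fg].
have mg : measurable_fun [set: Omega] (fun w => (g (tau w))%:E).
  by apply: (emeasurable_fun_cvg F) => // w _; exact: Fg.
have ig := integrable_expR C K0.
have gB (x : R) : 0 <= x -> `|g x| <= C * expR (K * x).
  move=> x0; have c : (fun n => `|\sum_(l < n) f l x|) @ \oo --> `|g x|.
    by apply: cvg_norm; exact: fg.
  rewrite -(cvg_lim _ c)//; apply: limr_le; first by apply/cvg_ex; exists `|g x|.
  by apply: nearW => n; rewrite (le_trans (ler_norm_sum _ _ _))// fB.
have gint : P.-integrable [set: Omega] (fun w => (g (tau w))%:E).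
  apply: (@le_integrable _ _ _ P setT measurableT _ (fun w => (C * expR (K * tau w))%:E)) => //.
  move=> w _ /=; rewrite lee_fin (ger0_norm (mulr_ge0 C0 (expR_ge0 _))).
  exact: gB.
split => //.
have := @dominated_cvg _ _ _ P setT measurableT F _ _ mF (fun w _ => Fg w) _ ig
  (fun n w _ => FB n w).
move=> /(_ (fun _ _ => isT)).
under eq_fun do rewrite FE.
by rewrite -(fineK (integrable_fin_num measurableT gint)) => /fine_cvg.
Qed.

(** The variant of linearity that applies to sums of series, for which integrability after
    composition with [tau] is what [expect_series] provides. *)
Lemma expect_linear a b f g : P.-integrable [set: Omega] (fun w => (f (tau w))%:E) ->
  P.-integrable [set: Omega] (fun w => (g (tau w))%:E) ->
  expect (fun x => a * f x + b * g x) = a * expect f + b * expect g.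
Proof.
move=> hf hg; rewrite /expect.
under eq_integral do rewrite EFinD !EFinM.
rewrite integralD//; try exact: integrableZl.
have ff := integrable_fin_num measurableT hf.
have fg := integrable_fin_num measurableT hg.
by rewrite !integralZl// fineD ?fin_numM// !fineM.
Qed.
Lemma pow_fact_le (x : R) (m : nat) : 0 <= x -> x ^+ m / m`!%:R <= expR x.
Proof.
move=> x0; apply: le_trans (pow_fact_sum_le m.+1 x0).
rewrite big_ord_recr/= lerDr sumr_ge0// => i _.
by rewrite divr_ge0// exprn_ge0.
Qed.

Lemma fact_neq0 m : (m`!%:R : R) != 0.
Proof. by rewrite pnatr_eq0 -lt0n fact_gt0. Qed.

Let measurable_pow m : measurable_fun [set: R] (fun x : R => x ^+ m).
Proof. exact: exprn_measurable. Qed.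

Lemma exp_bounded_pow m : exp_bounded (fun x => x ^+ m).
Proof.
split; first exact: measurable_pow.
exists m`!%:R, 1; split => // x x0.
rewrite mul1r ger0_norm ?exprn_ge0//.
by rewrite -ler_pdivrMl ?ltr0n ?fact_gt0// mulrC pow_fact_le.
Qed.

Lemma exp_boundedZ c f : exp_bounded f -> exp_bounded (fun x => c * f x).
Proof.
move=> [mf [C [K [C0 K0 fB]]]]; split; first exact: measurable_funM.
exists (`|c| * C), K; split => // [|x x0]; first exact: mulr_ge0.
by rewrite normrM -mulrA ler_wpM2l// fB.
Qed.

(** * Damped moments E [exp (- s tau) tau^i / i!] *)

Variables (nu y s : R).
Hypothesis s_gt0 : 0 < s.
Hypothesis moments : forall m : nat, 0 < Gamma (m%:R * nu + 1) :> R /\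
  (\int[P]_w (tau w ^+ m)%:E = (m`!%:R * (y ^+ m / Gamma (m%:R * nu + 1)))%:E)%E.

Let expect_pow c m :
  expect (fun x => c * x ^+ m) = c * (m`!%:R * (y ^+ m / Gamma (m%:R * nu + 1))).
Proof.
rewrite expectZ; last exact: exp_bounded_pow.
by rewrite /expect; have [_ ->] := moments m.
Qed.

Definition damped_moment (i : nat) : R :=
  expect (fun x => expR (- (s * x)) * (x ^+ i / i`!%:R)).

Let measurable_expRN : measurable_fun [set: R] (fun x : R => expR (- (s * x))).
Proof.
apply: (measurableT_comp (@measurable_expR R)).
apply: (measurableT_comp (@oppr_measurable R _)).
exact: measurable_funM.
Qed.

Let measurable_powf i : measurable_fun [set: R] (fun x : R => x ^+ i / i`!%:R).
Proof. exact: measurable_funM. Qed.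

Let expRN_le1 (x : R) : 0 <= x -> 0 <= expR (- (s * x)) <= 1.
Proof. by move=> x0; rewrite expR_ge0 expR_le1 oppr_le0 mulr_ge0// ltW. Qed.

Let exp_bounded_damped i :
  exp_bounded (fun x => expR (- (s * x)) * (x ^+ i / i`!%:R)).
Proof.
split; first exact: measurable_funM.
exists 1, 1; split => // x x0; have /andP[e0 e1] := expRN_le1 x0.
have p0 : 0 <= x ^+ i / i`!%:R by rewrite divr_ge0// exprn_ge0.
rewrite !mul1r (ger0_norm (mulr_ge0 e0 p0)).
by rewrite (le_trans _ (pow_fact_le i x0))// ler_piMl.
Qed.

(** The bound on c turns x into s x in the exponential terms; the odd term has one power of x more
    than c has powers of s, which costs the factor 1 / s. *)
Let term_bound (c : nat -> R) (d0 d1 x : R) k : (forall k, `|c k| <= s ^+ k.*2) -> 0 <= x ->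
  `|c k * (d0 * even_term k x + d1 * odd_term k x)| <=
  (`|d0| + `|d1| / s) * (even_term k (s * x) + odd_term k (s * x)).
Proof.
move=> cs x0; rewrite normrM.
have e0 := even_term_ge0 k x0; have o0 := odd_term_ge0 k x0.
have sx0 : 0 <= s * x by rewrite mulr_ge0// ltW.
have es0 := even_term_ge0 k sx0; have os0 := odd_term_ge0 k sx0.
have E1 : s ^+ k.*2 * even_term k x = even_term k (s * x).
  by rewrite /even_term exprMn mulrA.
have E2 : s ^+ k.*2 * odd_term k x = odd_term k (s * x) / s.
  by rewrite /odd_term exprMn !exprS; field; rewrite fact_neq0 gt_eqF.
apply: (@le_trans _ _ (s ^+ k.*2 * (`|d0| * even_term k x + `|d1| * odd_term k x))).
  apply: ler_pM => //; rewrite (le_trans (ler_normD _ _))// (normrM d0) (normrM d1).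
  by rewrite (ger0_norm e0) (ger0_norm o0).
have -> : s ^+ k.*2 * (`|d0| * even_term k x + `|d1| * odd_term k x) =
  `|d0| * (s ^+ k.*2 * even_term k x) + `|d1| * (s ^+ k.*2 * odd_term k x) by ring.
rewrite E1 E2.
have h1 : 0 <= `|d0| * odd_term k (s * x) by rewrite mulr_ge0.
have h2 : 0 <= `|d1| / s * even_term k (s * x) by rewrite mulr_ge0// divr_ge0// ltW.
rewrite -subr_ge0 [X in 0 <= X](_ : _ = `|d0| * odd_term k (s * x) +
  `|d1| / s * even_term k (s * x)); first exact: addr_ge0.
by ring.
Qed.

Lemma walk_series_is_cvg (c : nat -> R) (d0 d1 x : R) :
  (forall k, `|c k| <= s ^+ k.*2) -> 0 <= x ->
  cvgn (fun n => \sum_(k < n) c k * (d0 * even_term k x + d1 * odd_term k x)).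
Proof.
move=> cs x0; apply: (@abs_sum_is_cvg _ (fun k => c k * (d0 * even_term k x + d1 * odd_term k x))
  ((`|d0| + `|d1| / s) * expR (s * x))) => n.
have sx0 : 0 <= s * x by rewrite mulr_ge0// ltW.
apply: (@le_trans _ _ (\sum_(k < n) (`|d0| + `|d1| / s) *
   (even_term k (s * x) + odd_term k (s * x)))).
  by apply: ler_sum => k _; exact: term_bound.
rewrite -mulr_sumr ler_wpM2l ?even_odd_sum_le//.
by rewrite addr_ge0// divr_ge0// ltW.
Qed.

(** The factor exp (- s x) undoes the centering of the generator; being at most 1 on the half-line,
    it leaves the majorant unchanged. *)
Lemma expect_walk_series (c : nat -> R) (d0 d1 : R) (g : R -> R) :
  (forall k, `|c k| <= s ^+ k.*2) ->
  (forall x : R, 0 <= x ->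
    (fun n => \sum_(k < n) c k * (d0 * even_term k x + d1 * odd_term k x)) @ \oo --> g x) ->
  P.-integrable [set: Omega] (fun w => (expR (- (s * tau w)) * g (tau w))%:E) /\
  (fun n => \sum_(k < n) c k * (d0 * damped_moment k.*2 + d1 * damped_moment k.*2.+1))
    @ \oo --> expect (fun x => expR (- (s * x)) * g x).
Proof.
move=> cs cg.
have DE k : c k * (d0 * damped_moment k.*2 + d1 * damped_moment k.*2.+1) =
    expect (fun x => expR (- (s * x)) * (c k * (d0 * even_term k x + d1 * odd_term k x))).
  have h i := exp_bounded_damped i.
  rewrite mulrDr !mulrA -!expectZ// -expectD; try exact: exp_boundedZ.
  rewrite /expect; congr fine; apply: eq_integral => w _; congr EFin.
  by rewrite /even_term /odd_term; ring.
rewrite (_ : (fun n => \sum_(k < n) c k * (d0 * damped_moment k.*2 +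
    d1 * damped_moment k.*2.+1)) = (fun n => \sum_(k < n) expect (fun x =>
    expR (- (s * x)) * (c k * (d0 * even_term k x + d1 * odd_term k x))))); last first.
  by apply/funext => n; apply: eq_bigr => k _; exact: DE.
have C0 : 0 <= `|d0| + `|d1| / s by rewrite addr_ge0// divr_ge0// ltW.
apply: (expect_series (f := fun k x =>
  expR (- (s * x)) * (c k * (d0 * even_term k x + d1 * odd_term k x)))
  _ C0 (ltW s_gt0)).
- move=> k; apply: measurable_funM => //; apply: measurable_funM => //.
  by apply: measurable_funD; apply: measurable_funM => //; exact: measurable_powf.
- move=> n x x0; have /andP[e0 e1] := expRN_le1 x0.
  have sx0 : 0 <= s * x by rewrite mulr_ge0// ltW.
  apply: (@le_trans _ _ (\sum_(k < n) (`|d0| + `|d1| / s) *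
     (even_term k (s * x) + odd_term k (s * x)))).
    apply: ler_sum => k _; rewrite normrM (ger0_norm e0).
    by rewrite (le_trans _ (term_bound d0 d1 k cs x0))// ler_piMl.
  by rewrite -mulr_sumr ler_wpM2l ?even_odd_sum_le.
- move=> x x0; under eq_fun do rewrite -mulr_sumr.
  by apply: cvgMr; exact: cg.
Qed.

(** Identifies a value of W, defined as a bare limit, from a convergent multiple of its partial
    sums. If c = 0, as may happen at time 0, both sides are 0 whatever the limit is. *)
Lemma cvg_scale_lim (u : nat -> R) (c A : R) :
  (fun n => c * u n) @ \oo --> A -> A = c * limn u.
Proof.
have [->|c0] := eqVneq c 0.
  under eq_fun do rewrite mul0r.
  by move=> h; rewrite mul0r -(cvg_lim _ h)// lim_cst.
move=> h; have : (fun n => c^-1 * (c * u n)) @ \oo --> c^-1 * A by apply: cvgMr.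
under eq_fun do rewrite mulKf//.
by move=> /cvg_lim ->//; rewrite mulVKf.
Qed.

(** The map m selects the even or the odd exponents, so that G is the hyperbolic cosine or sine. The
    majorant has rate s + 1 because x^i / i! is bounded by exp x. *)
Let expect_entire (m : nat -> nat) (G : R -> R) (i : nat) :
  (forall n (x : R), 0 <= x -> \sum_(k < n) x ^+ m k / (m k)`!%:R <= expR x) ->
  (forall x : R, 0 <= x -> (fun n => \sum_(k < n) x ^+ m k / (m k)`!%:R) @ \oo --> G x) ->
  (fun n => \sum_(k < n) s ^+ m k / (m k)`!%:R / i`!%:R *
     ((i + m k)`!%:R * (y ^+ (i + m k) / Gamma ((i + m k)%:R * nu + 1)))) @ \oo -->
  expect (fun x => G (s * x) * (x ^+ i / i`!%:R)).
Proof.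
move=> mle mG.
under eq_fun do under eq_bigr do rewrite -expect_pow.
have fE k x : s ^+ m k / (m k)`!%:R / i`!%:R * x ^+ (i + m k) =
    (s * x) ^+ m k / (m k)`!%:R * (x ^+ i / i`!%:R).
  by rewrite exprD exprMn; ring.
apply: (proj2 (expect_series (f := fun k x =>
  s ^+ m k / (m k)`!%:R / i`!%:R * x ^+ (i + m k)) (C := 1) (K := s + 1) _ _ _ _ _)) => //.
- by move=> k; exact: measurable_funM.
- by rewrite addr_ge0// ltW.
- move=> n x x0; have sx0 : 0 <= s * x by rewrite mulr_ge0// ltW.
  rewrite mul1r mulrDl mul1r expRD.
  under eq_bigr do rewrite fE ger0_norm ?mulr_ge0 ?invr_ge0 ?exprn_ge0//.
  rewrite -mulr_suml ler_pM//.
  + by rewrite sumr_ge0// => k _; rewrite divr_ge0// exprn_ge0.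
  + by rewrite divr_ge0// exprn_ge0.
  + exact: mle.
  + exact: pow_fact_le.
- move=> x x0; have sx0 : 0 <= s * x by rewrite mulr_ge0// ltW.
  under eq_fun do under eq_bigr do rewrite fE.
  under eq_fun do rewrite -mulr_suml.
  by apply: cvgMl; exact: mG.
Qed.

Let moment_coef (i m : nat) : R := s ^+ m / m`!%:R / i`!%:R *
  ((i + m)`!%:R * (y ^+ (i + m) / Gamma ((i + m)%:R * nu + 1))).

Let exp_bounded_expR i : exp_bounded (fun x => expR (s * x) * (x ^+ i / i`!%:R)).
Proof.
split.
  apply: measurable_funM => //; apply: (measurableT_comp (@measurable_expR R)).
  exact: measurable_funM.
exists 1, (s + 1); split => // [|x x0]; first by rewrite addr_ge0// ltW.
rewrite mul1r mulrDl mul1r expRD ger0_norm ?mulr_ge0 ?expR_ge0 ?invr_ge0 ?exprn_ge0//.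
by rewrite ler_wpM2l ?expR_ge0// pow_fact_le.
Qed.

(** This is exp (- z) = cosh z - sinh z under the expectation; the two parts grow exponentially, and
    they are separately integrable thanks to the exponential moments. *)
Lemma damped_moment_split i : exists A B : R,
  [/\ (fun n => \sum_(k < n) moment_coef i k.*2) @ \oo --> A,
      (fun n => \sum_(k < n) moment_coef i k.*2.+1) @ \oo --> B &
      damped_moment i = A - B].
Proof.
have sumE (x : R) n : \sum_(k < n) even_term k x = 2^-1 *
    (\sum_(k < n) (even_term k x + odd_term k x) +
     \sum_(k < n) (even_term k x - odd_term k x)).
  by rewrite -big_split/= mulr_sumr; apply: eq_bigr => k _; field.
have sumO (x : R) n : \sum_(k < n) odd_term k x = 2^-1 *
    (\sum_(k < n) (even_term k x + odd_term k x) -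
     \sum_(k < n) (even_term k x - odd_term k x)).
  by rewrite -sumrB mulr_sumr; apply: eq_bigr => k _; field.
set U := expect (fun x => expR (s * x) * (x ^+ i / i`!%:R)).
have exA : expect (fun x => (2^-1 * (expR (s * x) + expR (- (s * x)))) * (x ^+ i / i`!%:R)) =
    2^-1 * U + 2^-1 * damped_moment i.
  rewrite -!expectZ// -expectD; try exact: exp_boundedZ.
  by rewrite /expect; congr fine; apply: eq_integral => w _; congr EFin; ring.
have exB : expect (fun x => (2^-1 * (expR (s * x) - expR (- (s * x)))) * (x ^+ i / i`!%:R)) =
    2^-1 * U + (- 2^-1) * damped_moment i.
  rewrite -!expectZ// -expectD; try exact: exp_boundedZ.
  by rewrite /expect; congr fine; apply: eq_integral => w _; congr EFin; ring.
exists (2^-1 * U + 2^-1 * damped_moment i), (2^-1 * U + (- 2^-1) * damped_moment i).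
split; last by field.
- rewrite -exA; apply: (expect_entire (m := double)
    (G := fun z => 2^-1 * (expR z + expR (- z)))).
  + move=> n x x0; apply: le_trans (even_odd_sum_le n x0).
    by apply: ler_sum => k _; rewrite lerDl odd_term_ge0.
  + move=> x x0; under eq_fun do rewrite sumE.
    apply: cvgMr; apply: cvgD; first exact: even_odd_sum_cvg.
    exact: even_odd_diff_cvg.
- rewrite -exB; apply: (expect_entire (m := fun k => k.*2.+1)
    (G := fun z => 2^-1 * (expR z - expR (- z)))).
  + move=> n x x0; apply: le_trans (even_odd_sum_le n x0).
    by apply: ler_sum => k _; rewrite lerDr even_term_ge0.
  + move=> x x0; under eq_fun do rewrite sumO.
    apply: cvgMr; apply: cvgB; first exact: even_odd_sum_cvg.
    exact: even_odd_diff_cvg.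
Qed.

(** * Damped moments in terms of W *)

Let z := (y * s) ^+ 2.

Let W_limE a omega b : W nu a omega b z = limn (fun N => \sum_(k < N)
  (z ^+ k / k`!%:R * (Gamma (a + 2 * k%:R) * Gamma (1 + k%:R) /
    (Gamma (omega + 2 * k%:R) * Gamma (b + 2 * nu * k%:R))))).
Proof.
rewrite /W /fox_wright; congr (limn _); apply/funext => N.
rewrite big_mkord; apply: eq_bigr => k _.
by rewrite !big_cons !big_nil /= !mulr1 mul1r.
Qed.

Let Gamma_fact (a m : nat) : Gamma (a.+1%:R + 2 * m%:R) = (a + m.*2)`!%:R :> R.
Proof.
by rewrite -Gamma_natS -natrM -natrD mul2n addSn.
Qed.

Let Gamma_1D (m : nat) : Gamma (1 + m%:R) = m`!%:R :> R.
Proof. by rewrite -Gamma_natS nat1r. Qed.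

Let Gamma_nu (i m : nat) :
  Gamma (i%:R * nu + 1 + 2 * nu * m%:R) = Gamma ((i + m.*2)%:R * nu + 1).
Proof. by rewrite natrD -mul2n natrM; congr Gamma; ring. Qed.

Let Gamma_neq0 (m : nat) : Gamma (m%:R * nu + 1) != 0 :> R.
Proof. by have [h _] := moments m; rewrite gt_eqF. Qed.

Let zE k : z ^+ k = y ^+ k.*2 * s ^+ k.*2.
Proof. by rewrite /z -exprM mul2n exprMn. Qed.

(** The parameter pair (1, 1) of W cancels the factorial in z^k / k!, and Gamma (i + 1 + 2 k) /
    Gamma (1 + 2 k) is the quotient (i + 2 k)! / (2 k)! of the moment series. *)
Lemma even_moments_W i A :
  (fun n => \sum_(k < n) moment_coef i k.*2) @ \oo --> A ->
  A = y ^+ i / i`!%:R * W nu i.+1%:R 1 (i%:R * nu + 1) z.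
Proof.
move=> cA; rewrite W_limE; apply: cvg_scale_lim.
rewrite (_ : (fun n => _) = (fun n => \sum_(k < n) moment_coef i k.*2))//.
apply/funext => n; rewrite mulr_sumr; apply: eq_bigr => k _.
rewrite Gamma_fact Gamma_1D -[1 + 2 * _]/(1%:R + 2 * k%:R) Gamma_fact Gamma_nu zE add0n.
rewrite /moment_coef exprD.
by field; rewrite !fact_neq0 Gamma_neq0.
Qed.

(** The odd part can be written with second parameter 2 or, after an index shift, with 0. The
    theorem uses this form for even i and that of [odd_moments_W0] for odd i. *)
Lemma odd_moments_W2 i B :
  (fun n => \sum_(k < n) moment_coef i k.*2.+1) @ \oo --> B ->
  B = s * y ^+ i.+1 / i`!%:R * W nu i.+2%:R 2 (i.+1%:R * nu + 1) z.
Proof.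
move=> cB; rewrite W_limE; apply: cvg_scale_lim.
rewrite (_ : (fun n => _) = (fun n => \sum_(k < n) moment_coef i k.*2.+1))//.
apply/funext => n; rewrite mulr_sumr; apply: eq_bigr => k _.
rewrite Gamma_fact Gamma_1D -[2 + 2 * _]/(2%:R + 2 * k%:R) Gamma_fact Gamma_nu zE add1n.
rewrite /moment_coef !addSn addnS !exprS exprD.
by field; rewrite !fact_neq0 Gamma_neq0.
Qed.

(* The first term of this W vanishes since 1 / Gamma 0 = 0, whence the shift. *)
Lemma odd_moments_W0 i B :
  (fun n => \sum_(k < n) moment_coef i.+1 k.*2.+1) @ \oo --> B ->
  B = s^-1 * y ^+ i / i.+1`!%:R * W nu i.+1%:R 0 (i%:R * nu + 1) z.
Proof.
move=> cB; rewrite W_limE; apply: cvg_scale_lim.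
rewrite -cvg_shiftS.
rewrite (_ : [sequence _]_n = (fun n => \sum_(k < n) moment_coef i.+1 k.*2.+1))//.
apply/funext => n; rewrite /= big_ord_recl/= !mulr0 !addr0 Gamma0 mul0r invr0 !mulr0 add0r.
rewrite mulr_sumr; apply: eq_bigr => k _.
rewrite Gamma_fact Gamma_1D Gamma_nu zE /bump/= add0r.
have -> : 2 * (1 + k)%:R = 2%:R + 2 * k%:R :> R by rewrite natrD mulrDr mulr1.
rewrite Gamma_fact add1n.
rewrite /moment_coef doubleS !addSn !addnS !exprS exprD.
by field; rewrite !fact_neq0 Gamma_neq0 gt_eqF.
Qed.

Lemma damped_moment_even k : damped_moment k.*2 =
  y ^+ k.*2 / (k.*2)`!%:R * W nu k.*2.+1%:R 1 (k.*2%:R * nu + 1) z -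
  s * y ^+ k.*2.+1 / (k.*2)`!%:R * W nu k.*2.+2%:R 2 (k.*2.+1%:R * nu + 1) z.
Proof.
have [A [B [cA cB ->]]] := damped_moment_split k.*2.
by rewrite (even_moments_W cA) (odd_moments_W2 cB).
Qed.

Lemma damped_moment_odd k : damped_moment k.*2.+1 =
  y ^+ k.*2.+1 / (k.*2.+1)`!%:R * W nu k.*2.+2%:R 1 (k.*2.+1%:R * nu + 1) z -
  s^-1 * y ^+ k.*2 / (k.*2.+1)`!%:R * W nu k.*2.+1%:R 0 (k.*2%:R * nu + 1) z.
Proof.
have [A [B [cA cB ->]]] := damped_moment_split k.*2.+1.
by rewrite (even_moments_W cA) (odd_moments_W0 cB).
Qed.

End ExpectationOfSeries.

(** * Bounds, symmetry and parity of the walk coefficients *)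

Section WalkCoefBounds.
Context {R : realType}.

(** The recursion has nonnegative weights whose sum is kappa^2 / 4 + (a1 + a2) (b1 + b2) = s^2. *)
Lemma walk_coef_bound (a1 a2 b1 b2 : R) k j :
  0 < a1 -> 0 < a2 -> 0 < b1 -> 0 < b2 ->
  `|walk_coef a1 a2 b1 b2 k j| <= ((a1 + a2 + b1 + b2) / 2) ^+ k.*2.
Proof.
move=> a10 a20 b10 b20; elim: k j => [|k IH] j.
  by rewrite walk_coef0 double0 expr0 normr_nat lern1 leq_b1.
rewrite walk_coefS doubleS.
set u := _ ^+ k.*2 in IH; set m : R := (a1 + a2 - b1 - b2) ^+ 2 / 4 + (a1 * b2 + a2 * b1).
have m0 : 0 <= m by rewrite /m addr_ge0 ?divr_ge0 ?sqr_ge0// addr_ge0// mulr_ge0// ltW.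
have -> : ((a1 + a2 + b1 + b2) / 2) ^+ k.*2.+2 = a1 * b1 * u + a2 * b2 * u + m * u.
  by rewrite !exprS -/u /m; field.
have tri c x : 0 <= c -> `|walk_coef a1 a2 b1 b2 k x * c| <= c * u.
  by move=> c0; rewrite normrM (ger0_norm c0) mulrC ler_wpM2l.
rewrite (le_trans (ler_normD _ _))// lerD//; last by rewrite mulrC tri.
by rewrite (le_trans (ler_normD _ _))// lerD// mulrC tri// mulr_ge0// ltW.
Qed.

(** The polynomial is symmetric in the two pairs of rates. Hence the coefficients with exchanged
    rates, used for odd starting states, describe the same kernel. *)
Lemma walk_coefC (a1 a2 b1 b2 : R) k j :
  walk_coef b1 b2 a1 a2 k j = walk_coef a1 a2 b1 b2 k j.
Proof.
rewrite /walk_coef (_ : walk_poly b1 b2 a1 a2 = walk_poly a1 a2 b1 b2)//.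
rewrite /walk_poly (mulrC b1 a1) (mulrC b2 a2); congr (_ + _%:P * _ + _).
by field.
Qed.

Lemma walk_kernel_even (a1 a2 b1 b2 : R) k (j x : int) : x = 2 * j ->
  walk_kernel a1 a2 b1 b2 k x = walk_coef a1 a2 b1 b2 k j.
Proof.
move=> ->; rewrite /walk_kernel ifT; last by lia.
by congr walk_coef; lia.
Qed.

Lemma walk_kernel_odd (a1 a2 b1 b2 : R) k (j x : int) : x = 2 * j + 1 ->
  walk_kernel a1 a2 b1 b2 k x = 0.
Proof. by move=> ->; rewrite /walk_kernel ifF//; lia. Qed.

(** A jump to a neighbour leaves an odd displacement, where the kernel vanishes, so only the
    diagonal entry - kappa / 2 contributes; on odd states its sign is reversed. *)
Lemma centered_walk_kernel_even_even (a1 a2 b1 b2 : R) k (r q : int) :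
  centered_generator a1 a2 b1 b2 (fun y => walk_kernel a1 a2 b1 b2 k (2 * q - y)) (2 * r) =
  - ((a1 + a2 - b1 - b2) / 2) * walk_coef a1 a2 b1 b2 k (q - r).
Proof.
have e : (2 %| 2 * r)%Z by lia.
rewrite /centered_generator /nbr_op /up_rate /down_rate e.
rewrite (@walk_kernel_even _ _ _ _ _ (q - r)); last by lia.
rewrite (@walk_kernel_odd _ _ _ _ _ (q - r - 1)); last by lia.
rewrite (@walk_kernel_odd _ _ _ _ _ (q - r)); last by lia.
by rewrite !mulr0 !addr0; field.
Qed.

Lemma centered_walk_kernel_odd_odd (a1 a2 b1 b2 : R) k (r q : int) :
  centered_generator a1 a2 b1 b2
    (fun y => walk_kernel a1 a2 b1 b2 k (2 * q + 1 - y)) (2 * r + 1) =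
  (a1 + a2 - b1 - b2) / 2 * walk_coef a1 a2 b1 b2 k (q - r).
Proof.
have e : (2 %| 2 * r + 1)%Z = false by lia.
rewrite /centered_generator /nbr_op /up_rate /down_rate e.
rewrite (@walk_kernel_even _ _ _ _ _ (q - r)); last by lia.
rewrite (@walk_kernel_odd _ _ _ _ _ (q - r - 1)); last by lia.
rewrite (@walk_kernel_odd _ _ _ _ _ (q - r)); last by lia.
by rewrite !mulr0 !addr0; field.
Qed.

(** Staying leaves an odd displacement and contributes nothing; the jump up leaves 2 (q - r), the
    jump down 2 (q - r + 1). *)
Lemma centered_walk_kernel_even_odd (a1 a2 b1 b2 : R) k (r q : int) :
  centered_generator a1 a2 b1 b2
    (fun y => walk_kernel a1 a2 b1 b2 k (2 * q + 1 - y)) (2 * r) =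
  a1 * walk_coef a1 a2 b1 b2 k (q - r) + a2 * walk_coef a1 a2 b1 b2 k (q - r + 1).
Proof.
have e : (2 %| 2 * r)%Z by lia.
rewrite /centered_generator /nbr_op /up_rate /down_rate e.
rewrite (@walk_kernel_odd _ _ _ _ _ (q - r)); last by lia.
rewrite (@walk_kernel_even _ _ _ _ _ (q - r)); last by lia.
rewrite (@walk_kernel_even _ _ _ _ _ (q - r + 1)); last by lia.
by rewrite mulr0 add0r.
Qed.

Lemma centered_walk_kernel_odd_even (a1 a2 b1 b2 : R) k (r q : int) :
  centered_generator a1 a2 b1 b2
    (fun y => walk_kernel a1 a2 b1 b2 k (2 * q - y)) (2 * r + 1) =
  b2 * walk_coef a1 a2 b1 b2 k (q - r) + b1 * walk_coef a1 a2 b1 b2 k (q - r - 1).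
Proof.
have e : (2 %| 2 * r + 1)%Z = false by lia.
rewrite /centered_generator /nbr_op /up_rate /down_rate e.
rewrite (@walk_kernel_odd _ _ _ _ _ (q - r - 1)); last by lia.
rewrite (@walk_kernel_even _ _ _ _ _ (q - r - 1)); last by lia.
rewrite (@walk_kernel_even _ _ _ _ _ (q - r)); last by lia.
by rewrite mulr0 add0r addrC.
Qed.

Lemma has_sum_from_support (m : nat) (f u : nat -> R) (l : R) :
  (forall k, (k < m)%N -> u k = 0) -> (forall k, (m <= k)%N -> f k = u k) ->
  has_sum_from 0 u l -> has_sum_from m f l.
Proof.
move=> u0 fu cu; move: cu; rewrite /has_sum_from.
rewrite (_ : (fun n => \sum_(0 <= k < n) u k) = (fun n => \sum_(m <= k < n) f k))//.
apply/funext => n; have [mn|nm] := leqP m n.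
  rewrite (big_cat_nat (leq0n m) mn)//= big_nat big1 ?add0r.
    by apply: eq_big_nat => k /andP[mk _]; rewrite fu.
  by move=> k /andP[_ km]; rewrite u0.
rewrite [RHS]big_geq ?(ltnW nm)// big_nat big1// => k /andP[_ kn].
by rewrite u0// (ltn_trans kn).
Qed.

Lemma walk_coef_has_sum (a1 a2 b1 b2 : R) (j : int) (f g : nat -> R) (l : R) :
  has_sum_from 0 (fun k => walk_coef a1 a2 b1 b2 k j * g k) l ->
  (forall k, (`|j| <= k)%N -> f k = walk_coef a1 a2 b1 b2 k j * g k) ->
  has_sum_from (absz j) f l.
Proof.
by move=> cl fg; apply: (has_sum_from_support _ fg cl) => k kj;
  rewrite walk_coef_out ?mul0r.
Qed.

Lemma walk_coef_theta_swap (a1 a2 b1 b2 : R) k (r s : int) :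
  0 < a1 -> 0 < a2 -> 0 < b1 -> 0 < b2 ->
  a1 + a2 - b1 - b2 != 0 -> (`|s - r| <= k)%N ->
  walk_coef a1 a2 b1 b2 k (s - r) =
  ((a1 * b1) / (a2 * b2)) ^ (s - r) * theta_coef k r s b1 b2 a1 a2 *
  ((a1 + a2 - b1 - b2) / 2) ^+ k.*2.
Proof.
move=> a10 a20 b10 b20 kap0 sr; have kE : b1 + b2 - a1 - a2 = - (a1 + a2 - b1 - b2) by ring.
rewrite -walk_coefC walk_coef_theta ?kE ?oppr_eq0//.
by rewrite mulNr -mul2n !exprM sqrrN (mulrC b1) (mulrC b2).
Qed.

Lemma walk_coef_eta_swap (a1 a2 b1 b2 : R) k (r s : int) :
  0 < a1 -> 0 < a2 -> 0 < b1 -> 0 < b2 ->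
  a1 + a2 - b1 - b2 = 0 -> (`|s - r| <= k)%N ->
  walk_coef a1 a2 b1 b2 k (s - r) =
  ((a1 * b1) / (a2 * b2)) ^ (s - r) * eta_coef k r s b1 b2 a1 a2.
Proof.
move=> a10 a20 b10 b20 kap0 sr; have kE : b1 + b2 - a1 - a2 = - (a1 + a2 - b1 - b2) by ring.
by rewrite -walk_coefC walk_coef_eta ?kE ?kap0 ?oppr0// (mulrC b1) (mulrC b2).
Qed.

End WalkCoefBounds.

(** * State probabilities of the time-changed chain *)

Section FractionalChain.
Context {R : realType} {d : measure_display} {Omega : measurableType d}.
Variables (P : probability Omega R) (a1 a2 b1 b2 nu : R).
Variables (X : R -> Omega -> int) (S : R -> Omega -> R) (p : R -> int -> int -> R).
Hypotheses (a1_gt0 : 0 < a1) (a2_gt0 : 0 < a2) (b1_gt0 : 0 < b1) (b2_gt0 : 0 < b2).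
Hypothesis nu_gt0 : 0 < nu.
Hypothesis mX : forall (t : R) n, 0 <= t -> measurable [set w | X t w = n].
Hypothesis X_rcont : forall w (t : R), 0 <= t -> \forall u \near t^'+, X u w = X t w.
Hypothesis tf : transition_function p.
Hypothesis X_markov : homogeneous_markov P X p.
Hypothesis rates : forall k n,
  (fun t => (p t k n - p 0 k n) / t) @ 0^'+ --> generator a1 a2 b1 b2 k n.
Hypothesis S_stable : stable_subordinator P nu S.
Hypothesis XT_indep : independent_processes P X (inverse_process S).

Local Notation T := (inverse_process S).
Local Notation pnu := (state_prob P (time_change X T)).
Local Notation start k := (P [set w | time_change X T 0 w = k]).
Local Notation s := ((a1 + a2 + b1 + b2) / 2).
Local Notation kappa := (a1 + a2 - b1 - b2).
Local Notation c := (walk_coef a1 a2 b1 b2).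
Local Notation V t := (damped_moment P (T t) s).

Let p_itv (t : R) k n : 0 <= t -> 0 <= p t k n <= 1.
Proof.
move=> t0; apply/andP; split; first by case: (tf) => _ h _ _; exact: h.
exact: transition_le1.
Qed.

Let p_rcont k n (t : R) : 0 <= t -> p u k n @[u --> t^'+] --> p t k n.
Proof. exact: (transition_right_continuous tf rates). Qed.

Let mT (t : R) : measurable_fun [set: Omega] (T t).
Proof. exact: (measurable_inverse_process S_stable). Qed.

Let T_ge0 (t : R) w : 0 <= T t w. Proof. exact: inverse_process_ge0. Qed.

Let T_exp (t : R) : 0 <= t ->
  forall K : R, 0 <= K -> (\int[P]_w (expR (K * T t w))%:E < +oo)%E.
Proof. by move=> t0 K K0; exact: (inverse_integral_expR nu_gt0 S_stable). Qed.

Let measurable_state t n : measurable [set w | time_change X T t w = n].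
Proof. exact: (measurable_time_change_state mX X_rcont mT T_ge0). Qed.

Let eq_measure_null (A B N : set Omega) : measurable A -> measurable B ->
  measurable N -> P N = 0 -> (forall w, ~ N w -> A w <-> B w) -> P A = P B.
Proof.
move=> mA mB mN N0 AB.
have h (C D : set Omega) : measurable C -> measurable D ->
    (forall w, ~ N w -> C w -> D w) -> (P C <= P D)%E.
  move=> mC mD CD; apply: (@le_trans _ _ (P (D `|` N))).
    apply: le_measure; rewrite ?inE//; first exact: measurableU.
    by move=> w Cw; have [|Nw] := pselect (N w); [right|left; exact: CD].
  by rewrite (le_trans (measureU2 _ _ _))//= N0 adde0.
by apply/eqP; rewrite eq_le !h// => w Nw; apply AB.
Qed.

(** The initial state of the time-changed process is X at T 0, and T 0 vanishes only almost surely;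
    off this null event the law of the time change applies and the initial probability cancels. *)
Lemma state_prob_expect (t : R) (k n : int) : 0 <= t -> (0 < start k)%E ->
  pnu k n t = expect P (T t) (fun x => p x k n).
Proof.
move=> t0; have N0 := inverse_process0 nu_gt0 S_stable.
have mN : measurable [set w | T 0 w != 0].
  rewrite (_ : [set w | _] = ~` [set w | T 0 w <= 0]).
    by apply: measurableC; exact: measurable_le_set.
  by apply/seteqP; split => w /=; rewrite eq_le T_ge0 andbT => /negP.
have T0 w : ~ [set w | T 0 w != 0] w -> T 0 w = 0 by move=> /= /negP; rewrite negbK => /eqP.
have E1 : start k = P [set w | X 0 w = k].
  apply: (eq_measure_null _ _ mN N0) => //; first exact: mX.
  by move=> w /T0 T0w; rewrite /= /time_change T0w.
have E2 : P ([set w | time_change X T t w = n] `&` [set w | time_change X T 0 w = k]) =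
    P ([set w | X 0 w = k] `&` [set w | X (T t w) w = n]).
  apply: (eq_measure_null _ _ mN N0).
  - exact: measurableI.
  - by apply: measurableI; [exact: mX|exact: measurable_state].
  - by move=> w /T0 T0w; rewrite /= /time_change T0w; split => -[].
rewrite /state_prob E2 E1 (time_change_law mX X_rcont p_itv p_rcont X_markov XT_indep mT T_ge0)//.
move=> P0.
have fin0 : P [set w | X 0 w = k] \is a fin_num by rewrite fin_num_measure//; exact: mX.
(* The integral times the positive initial probability is itself a probability, so the integral
   cannot be infinite. *)
have finI : (\int[P]_w (p (T t w) k n)%:E)%E \is a fin_num.
  have Plt : (P [set w | X 0 w = k] * \int[P]_w (p (T t w) k n)%:E < +oo)%E.
    rewrite -(time_change_law mX X_rcont p_itv p_rcont X_markov XT_indep mT T_ge0)//.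
    by rewrite (le_lt_trans (probability_le1 _ _)) ?ltry//; apply: measurableI;
      [exact: mX|exact: measurable_state].
  have I0 : (0 <= \int[P]_w (p (T t w) k n)%:E)%E.
    by apply: integral_ge0 => w _; rewrite lee_fin; have /andP[] := p_itv k n (T_ge0 t w).
  rewrite ge0_fin_numE// ltNge leye_eq; apply/negP => /eqP I1.
  by move: Plt; rewrite I1 gt0_muley// ltxx.
rewrite fineM// mulrAC mulfV ?mul1r//.
by rewrite fine_eq0// gt_eqF.
Qed.

Let tau_moments (t : R) : 0 <= t -> forall m : nat, 0 < Gamma (m%:R * nu + 1) :> R /\
  (\int[P]_w (T t w ^+ m)%:E =
   (m`!%:R * ((t `^ nu) ^+ m / Gamma (m%:R * nu + 1)))%:E)%E.
Proof.
move=> t0 m; have [h ->] := Gamma_gt0_inverse_moment nu_gt0 S_stable m t0.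
by split => //; rewrite (mulrC (m%:R)) powRrM powR_mulrn ?powR_ge0.
Qed.

Lemma transition_even_odd_cvg (k n : int) (x : R) : 0 <= x ->
  (fun N => \sum_(i < N) (walk_kernel a1 a2 b1 b2 i (n - k) * even_term i x +
     centered_generator a1 a2 b1 b2 (fun y => walk_kernel a1 a2 b1 b2 i (n - y)) k *
     odd_term i x)) @ \oo --> expR (s * x) * p x k n.
Proof.
move=> x0.
have := cvg_double (@transition_expansion _ _ _ _ _ _ tf rates a1_gt0 a2_gt0 b1_gt0 b2_gt0 k n x x0).
under eq_fun do rewrite (sum_double (fun i => iter i _ _ k * (x ^+ i / i`!%:R))).
under eq_fun do under eq_bigr do
  rewrite iter_centered_generator_even iter_centered_generator_odd.
by [].
Qed.

Let s_gt0 : 0 < s. Proof. by rewrite divr_gt0// !addr_gt0. Qed.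

Let expect_damped t k n : expect P (T t) (fun x => expR (- (s * x)) * (expR (s * x) * p x k n))
  = expect P (T t) (fun x => p x k n).
Proof.
rewrite /expect; congr fine; apply: eq_integral => w _.
by rewrite mulrA -expRD addNr expR0 mul1r.
Qed.

Let c_bound j k : `|c k j| <= s ^+ k.*2. Proof. exact: walk_coef_bound. Qed.

Lemma state_prob_even_even (t : R) (r q : int) : 0 <= t -> (0 < start (2 * r)%R)%E ->
  has_sum_from 0 (fun k => c k (q - r) * (1 * V t k.*2 + - (kappa / 2) * V t k.*2.+1))
    (pnu (2 * r) (2 * q) t).
Proof.
move=> t0 P0; rewrite /has_sum_from; under eq_fun do rewrite big_mkord.
rewrite state_prob_expect// -expect_damped.
apply: (proj2 (expect_walk_series (mT t) (T_ge0 t) (T_exp t0) s_gt0 (c_bound (q - r)) _)).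
move=> x x0; have := @transition_even_odd_cvg (2 * r) (2 * q) x x0.
apply: cvg_trans; apply: near_eq_cvg; apply: nearW => N; apply: eq_bigr => k _.
rewrite centered_walk_kernel_even_even (@walk_kernel_even _ _ _ _ _ _ (q - r)).
  by ring.
by rewrite mulrBr.
Qed.

Lemma state_prob_odd_odd (t : R) (r q : int) : 0 <= t -> (0 < start (2 * r + 1)%R)%E ->
  has_sum_from 0 (fun k => c k (q - r) * (1 * V t k.*2 + kappa / 2 * V t k.*2.+1))
    (pnu (2 * r + 1) (2 * q + 1) t).
Proof.
move=> t0 P0; rewrite /has_sum_from; under eq_fun do rewrite big_mkord.
rewrite state_prob_expect// -expect_damped.
apply: (proj2 (expect_walk_series (mT t) (T_ge0 t) (T_exp t0) s_gt0 (c_bound (q - r)) _)).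
move=> x x0; have := @transition_even_odd_cvg (2 * r + 1) (2 * q + 1) x x0.
apply: cvg_trans; apply: near_eq_cvg; apply: nearW => N; apply: eq_bigr => k _.
rewrite centered_walk_kernel_odd_odd (@walk_kernel_even _ _ _ _ _ _ (q - r)).
  by ring.
by rewrite opprD addrACA subrr addr0 mulrBr.
Qed.

(** Between states of different parity two walk coefficients occur, and their series have to
    converge separately, since they start at different indices in the theorem. Therefore each is
    summed pathwise to a function [G] before the expectation is taken. *)
Let state_prob_odd_jump (t : R) (k n : int) (g h : R) (j i : int) : 0 <= t -> (0 < start k)%E ->
  (forall m, walk_kernel a1 a2 b1 b2 m (n - k) = 0) ->
  (forall m, centered_generator a1 a2 b1 b2
     (fun y => walk_kernel a1 a2 b1 b2 m (n - y)) k = g * c m j + h * c m i) ->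
  exists A B : R,
  [/\ has_sum_from 0 (fun m => c m j * V t m.*2.+1) A,
      has_sum_from 0 (fun m => c m i * V t m.*2.+1) B &
      pnu k n t = g * A + h * B].
Proof.
move=> t0 P0 k0 kE.
pose G j x := limn (fun n => \sum_(m < n) c m j * (0 * even_term m x + 1 * odd_term m x)).
have cG j' x : 0 <= x ->
    (fun n => \sum_(m < n) c m j' * (0 * even_term m x + 1 * odd_term m x)) @ \oo --> G j' x.
  by move=> x0; exact: (@walk_series_is_cvg _ _ s_gt0 _ 0 1 x (c_bound j') x0).
have cA j' := expect_walk_series (mT t) (T_ge0 t) (T_exp t0) s_gt0 (c_bound j') (cG j').
set A := fun j' => expect P (T t) (fun x => expR (- (s * x)) * G j' x).
have cA' j' : has_sum_from 0 (fun m => c m j' * V t m.*2.+1) (A j').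
  rewrite /has_sum_from; under eq_fun do rewrite big_mkord.
  have [_] := cA j'; under eq_fun do under eq_bigr do rewrite mul0r add0r mul1r.
  by [].
exists (A j), (A i); split => //.
rewrite state_prob_expect// -expect_damped -expect_linear.
rewrite /expect; congr fine; apply: eq_integral => w _; congr EFin.
rewrite (mulrCA g) (mulrCA h) -mulrDr; congr (_ * _).
have c1 := @transition_even_odd_cvg k n (T t w) (T_ge0 t w).
have c2 : (fun N => \sum_(m < N) (walk_kernel a1 a2 b1 b2 m (n - k) * even_term m (T t w) +
     centered_generator a1 a2 b1 b2 (fun y => walk_kernel a1 a2 b1 b2 m (n - y)) k *
     odd_term m (T t w))) @ \oo --> g * G j (T t w) + h * G i (T t w).
  rewrite (_ : (fun N => _) = (fun N =>
    g * (\sum_(m < N) c m j * (0 * even_term m (T t w) + 1 * odd_term m (T t w))) +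
    h * (\sum_(m < N) c m i * (0 * even_term m (T t w) + 1 * odd_term m (T t w))))).
    by apply: cvgD; apply: cvgMr; exact: cG.
  apply/funext => N; rewrite !mulr_sumr -big_split/=; apply: eq_bigr => m _.
  by rewrite k0 kE; ring.
exact: (cvg_unique _ c1 c2).
- by case: (cA j).
- by case: (cA i).
Qed.

Lemma state_prob_even_odd (t : R) (r q : int) : 0 <= t -> (0 < start (2 * r)%R)%E ->
  exists A B : R,
  [/\ has_sum_from 0 (fun m => c m (q - r) * V t m.*2.+1) A,
      has_sum_from 0 (fun m => c m (q - r + 1) * V t m.*2.+1) B &
      pnu (2 * r) (2 * q + 1) t = a1 * A + a2 * B].
Proof.
move=> t0 P0; apply: state_prob_odd_jump => // m.
  by apply: (@walk_kernel_odd _ _ _ _ _ _ (q - r)); lia.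
exact: centered_walk_kernel_even_odd.
Qed.

Lemma state_prob_odd_even (t : R) (r q : int) : 0 <= t -> (0 < start (2 * r + 1)%R)%E ->
  exists A B : R,
  [/\ has_sum_from 0 (fun m => c m (q - r) * V t m.*2.+1) A,
      has_sum_from 0 (fun m => c m (q - r - 1) * V t m.*2.+1) B &
      pnu (2 * r + 1) (2 * q) t = b2 * A + b1 * B].
Proof.
move=> t0 P0; apply: state_prob_odd_jump => // m.
  by apply: (@walk_kernel_odd _ _ _ _ _ _ (q - r - 1)); lia.
exact: centered_walk_kernel_odd_even.
Qed.

(** The argument z is tied to t by an equation, so that the different expressions for it in the two
    cases of the theorem can both be used. *)
Lemma damped_inverse_moment_even (t z : R) k : 0 <= t -> z = (t `^ nu * s) ^+ 2 ->
  V t k.*2 =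
  t `^ (k.*2%:R * nu) / (k.*2)`!%:R * W nu k.*2.+1%:R 1 (k.*2%:R * nu + 1) z -
  s * t `^ (k.*2.+1%:R * nu) / (k.*2)`!%:R *
    W nu k.*2.+2%:R 2 (k.*2.+1%:R * nu + 1) z.
Proof.
move=> t0 ->; rewrite !(mulrC _ nu) !powRrM !powR_mulrn ?powR_ge0// !(mulrC nu).
exact: (damped_moment_even (mT t) (T_ge0 t) (T_exp t0) s_gt0 (tau_moments t0)).
Qed.

Lemma damped_inverse_moment_odd (t z : R) k : 0 <= t -> z = (t `^ nu * s) ^+ 2 ->
  V t k.*2.+1 =
  t `^ (k.*2.+1%:R * nu) / (k.*2.+1)`!%:R *
    W nu k.*2.+2%:R 1 (k.*2.+1%:R * nu + 1) z -
  s^-1 * t `^ (k.*2%:R * nu) / (k.*2.+1)`!%:R *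
    W nu k.*2.+1%:R 0 (k.*2%:R * nu + 1) z.
Proof.
move=> t0 ->; rewrite !(mulrC _ nu) !powRrM !powR_mulrn ?powR_ge0// !(mulrC nu).
exact: (damped_moment_odd (mT t) (T_ge0 t) (T_exp t0) s_gt0 (tau_moments t0)).
Qed.

End FractionalChain.

(** * The eight formulas *)

Theorem propositionA2 (R : realType) (d : measure_display)
  (Omega : measurableType d) (P : probability Omega R)
  (alpha1 alpha2 beta1 beta2 nu : R)
  (X1 : R -> Omega -> int) (S : R -> Omega -> R)
  (alpha1_gt0 : 0 < alpha1) (alpha2_gt0 : 0 < alpha2)
  (beta1_gt0 : 0 < beta1) (beta2_gt0 : 0 < beta2)
  (nu_gt0 : 0 < nu) (nu_lt1 : nu < 1)
  (X1_chain : markov_chain_with_generator P X1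
                (generator alpha1 alpha2 beta1 beta2))
  (S_stable : stable_subordinator P nu S)
  (X1_T_independent : independent_processes P X1 (inverse_process S)) :
  let Xnu := time_change X1 (inverse_process S) in
  let start := fun k : int => P [set o | Xnu 0 o = k] in
  let pnu := state_prob P Xnu in
  let sigma := alpha1 + alpha2 + beta1 + beta2 in
  let kappa := alpha1 + alpha2 - beta1 - beta2 in
  let rho := (alpha1 * beta1) / (alpha2 * beta2) in
  let z := fun t : R => (t `^ nu * sigma) ^+ 2 / 4 in
  let w := fun t : R => (t `^ nu * (alpha1 + alpha2)) ^+ 2 in
  (alpha1 + alpha2 <> beta1 + beta2 ->
   forall (r s : int) (t : R), 0 <= t ->
   [/\ ((0 < start (2 * r)%R)%E ->
      has_sum_from (absz (s - r)%R)
        (fun k => rho ^ (s - r) * theta_coef k r s alpha1 alpha2 beta1 beta2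
           * (kappa / 2) ^+ k.*2 *
           (t `^ (k.*2%:R * nu) * kappa / (sigma * (k.*2.+1)`!%:R)
               * W nu k.*2.+1%:R 0 (k.*2%:R * nu + 1) (z t)
            + t `^ (k.*2%:R * nu) / (k.*2)`!%:R
                * W nu k.*2.+1%:R 1 (k.*2%:R * nu + 1) (z t)
            - t `^ (k.*2.+1%:R * nu) * kappa / (2 * (k.*2.+1)`!%:R)
                * W nu k.*2.+2%:R 1 (k.*2.+1%:R * nu + 1) (z t)
            - t `^ (k.*2.+1%:R * nu) * sigma / (2 * (k.*2)`!%:R)
                * W nu k.*2.+2%:R 2 (k.*2.+1%:R * nu + 1) (z t)))
        (pnu (2 * r)%R (2 * s)%R t)),
     ((0 < start (2 * r)%R)%E ->
      exists A B : R,
      [/\ has_sum_from (absz (s - r)%R)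
            (fun k => rho ^ (s - r) * theta_coef k r s alpha1 alpha2 beta1 beta2
               * (kappa / 2) ^+ k.*2 *
               (t `^ (k.*2.+1%:R * nu) / (k.*2.+1)`!%:R
                   * W nu k.*2.+2%:R 1 (k.*2.+1%:R * nu + 1) (z t)
                - 2 * t `^ (k.*2%:R * nu) / (sigma * (k.*2.+1)`!%:R)
                    * W nu k.*2.+1%:R 0 (k.*2%:R * nu + 1) (z t)))
            A,
          has_sum_from (absz (s - r + 1)%R)
            (fun k => rho ^ (s - r + 1) * theta_coef k r (s + 1) alpha1 alpha2 beta1 beta2
               * (kappa / 2) ^+ k.*2 *
               (t `^ (k.*2.+1%:R * nu) / (k.*2.+1)`!%:R
                   * W nu k.*2.+2%:R 1 (k.*2.+1%:R * nu + 1) (z t)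
                - 2 * t `^ (k.*2%:R * nu) / (sigma * (k.*2.+1)`!%:R)
                    * W nu k.*2.+1%:R 0 (k.*2%:R * nu + 1) (z t)))
            B &
          pnu (2 * r)%R (2 * s + 1)%R t = alpha1 * A + alpha2 * B]),
     ((0 < start (2 * r + 1)%R)%E ->
      exists A B : R,
      [/\ has_sum_from (absz (s - r)%R)
            (fun k => rho ^ (s - r) * theta_coef k r s beta1 beta2 alpha1 alpha2
               * (kappa / 2) ^+ k.*2 *
               (t `^ (k.*2.+1%:R * nu) / (k.*2.+1)`!%:R
                   * W nu k.*2.+2%:R 1 (k.*2.+1%:R * nu + 1) (z t)
                - 2 * t `^ (k.*2%:R * nu) / (sigma * (k.*2.+1)`!%:R)
                    * W nu k.*2.+1%:R 0 (k.*2%:R * nu + 1) (z t)))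
            A,
          has_sum_from (absz (s - r - 1)%R)
            (fun k => rho ^ (s - r - 1) * theta_coef k r (s - 1) beta1 beta2 alpha1 alpha2
               * (kappa / 2) ^+ k.*2 *
               (t `^ (k.*2.+1%:R * nu) / (k.*2.+1)`!%:R
                   * W nu k.*2.+2%:R 1 (k.*2.+1%:R * nu + 1) (z t)
                - 2 * t `^ (k.*2%:R * nu) / (sigma * (k.*2.+1)`!%:R)
                    * W nu k.*2.+1%:R 0 (k.*2%:R * nu + 1) (z t)))
            B &
          pnu (2 * r + 1)%R (2 * s)%R t = beta2 * A + beta1 * B]) &
     ((0 < start (2 * r + 1)%R)%E ->
      has_sum_from (absz (s - r)%R)
        (fun k => rho ^ (s - r) * theta_coef k r s beta1 beta2 alpha1 alpha2
           * (kappa / 2) ^+ k.*2 *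
           (- (t `^ (k.*2%:R * nu) * kappa / (sigma * (k.*2.+1)`!%:R)
               * W nu k.*2.+1%:R 0 (k.*2%:R * nu + 1) (z t))
            + t `^ (k.*2%:R * nu) / (k.*2)`!%:R
                * W nu k.*2.+1%:R 1 (k.*2%:R * nu + 1) (z t)
            - t `^ (k.*2.+1%:R * nu) * sigma / (2 * (k.*2)`!%:R)
                * W nu k.*2.+2%:R 2 (k.*2.+1%:R * nu + 1) (z t)
            + t `^ (k.*2.+1%:R * nu) * kappa / (2 * (k.*2.+1)`!%:R)
                * W nu k.*2.+2%:R 1 (k.*2.+1%:R * nu + 1) (z t)))
        (pnu (2 * r + 1)%R (2 * s + 1)%R t))])
  /\
  (alpha1 + alpha2 = beta1 + beta2 ->
   forall (r s : int) (t : R), 0 <= t ->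
   [/\ ((0 < start (2 * r)%R)%E ->
      has_sum_from (absz (s - r)%R)
        (fun k => rho ^ (s - r) * eta_coef k r s alpha1 alpha2 beta1 beta2 *
           (t `^ (k.*2%:R * nu) / (k.*2)`!%:R
               * W nu k.*2.+1%:R 1 (k.*2%:R * nu + 1) (w t)
            - (alpha1 + alpha2) * (t `^ (k.*2.+1%:R * nu) / (k.*2)`!%:R)
                * W nu k.*2.+2%:R 2 (k.*2.+1%:R * nu + 1) (w t)))
        (pnu (2 * r)%R (2 * s)%R t)),
     ((0 < start (2 * r)%R)%E ->
      exists A B : R,
      [/\ has_sum_from (absz (s - r)%R)
            (fun k => rho ^ (s - r) * eta_coef k r s alpha1 alpha2 beta1 beta2 *
               (t `^ (k.*2.+1%:R * nu) / (k.*2.+1)`!%:R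
                   * W nu k.*2.+2%:R 1 (k.*2.+1%:R * nu + 1) (w t)
                - t `^ (k.*2%:R * nu) / ((alpha1 + alpha2) * (k.*2.+1)`!%:R)
                    * W nu k.*2.+1%:R 0 (k.*2%:R * nu + 1) (w t)))
            A,
          has_sum_from (absz (s - r + 1)%R)
            (fun k => rho ^ (s - r + 1) * eta_coef k r (s + 1) alpha1 alpha2 beta1 beta2 *
               (t `^ (k.*2.+1%:R * nu) / (k.*2.+1)`!%:R
                   * W nu k.*2.+2%:R 1 (k.*2.+1%:R * nu + 1) (w t)
                - t `^ (k.*2%:R * nu) / ((alpha1 + alpha2) * (k.*2.+1)`!%:R)
                    * W nu k.*2.+1%:R 0 (k.*2%:R * nu + 1) (w t)))
            B &
          pnu (2 * r)%R (2 * s + 1)%R t = alpha1 * A + alpha2 * B]),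
     ((0 < start (2 * r + 1)%R)%E ->
      exists A B : R,
      [/\ has_sum_from (absz (s - r)%R)
            (fun k => rho ^ (s - r) * eta_coef k r s beta1 beta2 alpha1 alpha2 *
               (t `^ (k.*2.+1%:R * nu) / (k.*2.+1)`!%:R
                   * W nu k.*2.+2%:R 1 (k.*2.+1%:R * nu + 1) (w t)
                - t `^ (k.*2%:R * nu) / ((alpha1 + alpha2) * (k.*2.+1)`!%:R)
                    * W nu k.*2.+1%:R 0 (k.*2%:R * nu + 1) (w t)))
            A,
          has_sum_from (absz (s - r - 1)%R)
            (fun k => rho ^ (s - r - 1) * eta_coef k r (s - 1) beta1 beta2 alpha1 alpha2 *
               (t `^ (k.*2.+1%:R * nu) / (k.*2.+1)`!%:R
                   * W nu k.*2.+2%:R 1 (k.*2.+1%:R * nu + 1) (w t)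
                - t `^ (k.*2%:R * nu) / ((alpha1 + alpha2) * (k.*2.+1)`!%:R)
                    * W nu k.*2.+1%:R 0 (k.*2%:R * nu + 1) (w t)))
            B &
          pnu (2 * r + 1)%R (2 * s)%R t = beta2 * A + beta1 * B]) &
     ((0 < start (2 * r + 1)%R)%E ->
      has_sum_from (absz (s - r)%R)
        (fun k => rho ^ (s - r) * eta_coef k r s beta1 beta2 alpha1 alpha2 *
           (t `^ (k.*2%:R * nu) / (k.*2)`!%:R
               * W nu k.*2.+1%:R 1 (k.*2%:R * nu + 1) (w t)
            - (alpha1 + alpha2) * (t `^ (k.*2.+1%:R * nu) / (k.*2)`!%:R)
                * W nu k.*2.+2%:R 2 (k.*2.+1%:R * nu + 1) (w t)))
        (pnu (2 * r + 1)%R (2 * s + 1)%R t))]).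
Proof.
move=> Xnu start pnu sigma kappa rho z w.
have [mX X_rcont [p [tf X_markov rates]]] := X1_chain.
pose ee := state_prob_even_even alpha1_gt0 alpha2_gt0 beta1_gt0 beta2_gt0
  nu_gt0 mX X_rcont tf X_markov rates S_stable X1_T_independent.
pose eo := state_prob_even_odd alpha1_gt0 alpha2_gt0 beta1_gt0 beta2_gt0
  nu_gt0 mX X_rcont tf X_markov rates S_stable X1_T_independent.
pose oe := state_prob_odd_even alpha1_gt0 alpha2_gt0 beta1_gt0 beta2_gt0
  nu_gt0 mX X_rcont tf X_markov rates S_stable X1_T_independent.
pose oo := state_prob_odd_odd alpha1_gt0 alpha2_gt0 beta1_gt0 beta2_gt0
  nu_gt0 mX X_rcont tf X_markov rates S_stable X1_T_independent.
pose Ve := damped_inverse_moment_even alpha1_gt0 alpha2_gt0 beta1_gt0 beta2_gt0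
  nu_gt0 S_stable.
pose Vo := damped_inverse_moment_odd alpha1_gt0 alpha2_gt0 beta1_gt0 beta2_gt0
  nu_gt0 S_stable.
have sigma_neq0 : alpha1 + alpha2 + beta1 + beta2 != 0 by rewrite gt_eqF// !addr_gt0.
split => [neq|eq] r s t t0.
  have kappa_neq0 : alpha1 + alpha2 - beta1 - beta2 != 0.
    by rewrite -addrA -opprD subr_eq0; exact/eqP.
  have zE : z t = (t `^ nu * ((alpha1 + alpha2 + beta1 + beta2) / 2)) ^+ 2.
    by rewrite /z /sigma; field.
  split => P0.
  - apply: (walk_coef_has_sum (ee t r s t0 P0)) => k kj.
    rewrite (walk_coef_theta _ _ _ _ kappa_neq0 kj)//; congr (_ * _).
    rewrite (Ve t _ k t0 zE) (Vo t _ k t0 zE) /sigma /kappa.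
    by field; rewrite !fact_neq0 sigma_neq0.
  - have [A [B [cA cB pE]]] := eo t r s t0 P0.
    exists A, B; split => //.
      apply: (walk_coef_has_sum cA) => k kj.
      rewrite (walk_coef_theta _ _ _ _ kappa_neq0 kj)//; congr (_ * _).
      rewrite (Vo t _ k t0 zE) /sigma.
      by field; rewrite !fact_neq0 sigma_neq0.
    (* Reading s - r + 1 as (s + 1) - r gives the second series the theta coefficient with s + 1 in
       place of s. *)
    rewrite (addrAC s) in cB *; apply: (walk_coef_has_sum cB) => k kj.
    rewrite (walk_coef_theta _ _ _ _ kappa_neq0 kj)//; congr (_ * _).
    rewrite (Vo t _ k t0 zE) /sigma.
    by field; rewrite !fact_neq0 sigma_neq0.
  - have [A [B [cA cB pE]]] := oe t r s t0 P0.
    exists A, B; split => //.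
      apply: (walk_coef_has_sum cA) => k kj.
      rewrite (walk_coef_theta_swap _ _ _ _ kappa_neq0 kj)//; congr (_ * _).
      rewrite (Vo t _ k t0 zE) /sigma.
      by field; rewrite !fact_neq0 sigma_neq0.
    rewrite (addrAC s) in cB *; apply: (walk_coef_has_sum cB) => k kj.
    rewrite (walk_coef_theta_swap _ _ _ _ kappa_neq0 kj)//; congr (_ * _).
    rewrite (Vo t _ k t0 zE) /sigma.
    by field; rewrite !fact_neq0 sigma_neq0.
  - apply: (walk_coef_has_sum (oo t r s t0 P0)) => k kj.
    rewrite (walk_coef_theta_swap _ _ _ _ kappa_neq0 kj)//; congr (_ * _).
    rewrite (Ve t _ k t0 zE) (Vo t _ k t0 zE) /sigma /kappa.
    by field; rewrite !fact_neq0 sigma_neq0.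
have kappa0 : alpha1 + alpha2 - beta1 - beta2 = 0.
  by rewrite -addrA -opprD eq subrr.
(* For equal total rates the centering constant is the common total rate and the diagonal of the
   centered generator vanishes, so no odd damped moments enter the formulas between states of equal
   parity. *)
have sE : (alpha1 + alpha2 + beta1 + beta2) / 2 = alpha1 + alpha2.
  by rewrite -addrA -eq; field.
have alpha_neq0 : alpha1 + alpha2 != 0 by rewrite gt_eqF// addr_gt0.
have wE : w t = (t `^ nu * ((alpha1 + alpha2 + beta1 + beta2) / 2)) ^+ 2.
  by rewrite sE.
split => P0.
- apply: (walk_coef_has_sum (ee t r s t0 P0)) => k kj.
  rewrite (walk_coef_eta _ _ _ _ kappa0 kj)//; congr (_ * _).
  rewrite (Ve t _ k t0 wE) kappa0 mul0r oppr0 mul0r addr0 sE mul1r.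
  by field; rewrite !fact_neq0.
- have [A [B [cA cB pE]]] := eo t r s t0 P0.
  exists A, B; split => //.
    apply: (walk_coef_has_sum cA) => k kj.
    rewrite (walk_coef_eta _ _ _ _ kappa0 kj)//; congr (_ * _).
    rewrite (Vo t _ k t0 wE) sE.
    by field; rewrite !fact_neq0 alpha_neq0.
  rewrite (addrAC s) in cB *; apply: (walk_coef_has_sum cB) => k kj.
  rewrite (walk_coef_eta _ _ _ _ kappa0 kj)//; congr (_ * _).
  rewrite (Vo t _ k t0 wE) sE.
  by field; rewrite !fact_neq0 alpha_neq0.
- have [A [B [cA cB pE]]] := oe t r s t0 P0.
  exists A, B; split => //.
    apply: (walk_coef_has_sum cA) => k kj.
    rewrite (walk_coef_eta_swap _ _ _ _ kappa0 kj)//; congr (_ * _).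
    rewrite (Vo t _ k t0 wE) sE.
    by field; rewrite !fact_neq0 alpha_neq0.
  rewrite (addrAC s) in cB *; apply: (walk_coef_has_sum cB) => k kj.
  rewrite (walk_coef_eta_swap _ _ _ _ kappa0 kj)//; congr (_ * _).
  rewrite (Vo t _ k t0 wE) sE.
  by field; rewrite !fact_neq0 alpha_neq0.
- apply: (walk_coef_has_sum (oo t r s t0 P0)) => k kj.
  rewrite (walk_coef_eta_swap _ _ _ _ kappa0 kj)//; congr (_ * _).
  rewrite (Ve t _ k t0 wE) kappa0 mul0r mul0r addr0 sE mul1r.
  by field; rewrite !fact_neq0.
Qed.
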